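(* Let $K\in\{-1,0,1\}$, $c_1,c_2\in\mathbb{R}$, and let $v\in C^2(\overline{\mathbb{R}^2_+}\setminus\{0\})$ solve $$\Delta v+2Ke^v=0\text{ in }\mathbb{R}^2_+=\{(s,t):t>0\},\qquad \frac{\partial v}{\partial t}=c_1e^{v/2}\text{ on }\{t=0,s>0\},\qquad \frac{\partial v}{\partial t}=c_2e^{v/2}\text{ on }\{t=0,s<0\},$$ with $\int_{\mathbb{R}^2_+}e^v<\infty$. Then $v$ is a canonical solution.
   Context: Identify $\mathbb{R}^2\equiv\mathbb{C}$, $z=s+it$. On the closed upper half-plane minus $0$, $\log z=\ln|z|+i\arg z$ with $\arg z\in[0,\pi]$, $z^\gamma=e^{\gamma\log z}$. A canonical solution is a function of one of the forms: (a) $v_1=\log\dfrac{4\lambda^2\gamma^2|z|^{2(\gamma-1)}}{(K\lambda^2+|z^\gamma-z_0|^2)^2}$ with $\gamma,\lambda>0$, $z_0\in\mathbb{C}$ such that $K\lambda^2+|z^\gamma-z_0|^2\neq0$ for all $z$ in the closed upper half-plane; (b) $v_2=\log\dfrac{4\lambda^2}{|z|^2(K\lambda^2+|\log z-z_0|^2)^2}$ with $\lambda>0$, $z_0\in\mathbb{C}$ such that $K\lambda^2+|\log z-z_0|^2\neq0$ for all $z\neq0$ in the closed upper half-plane. *)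

(* Defs.v *)
From HB Require Import structures.
From mathcomp Require Import all_boot all_order all_algebra.
From mathcomp Require Import all_classical all_reals all_analysis.
Set Implicit Arguments. Unset Strict Implicit. Unset Printing Implicit Defensive.
Import Order.TTheory GRing.Theory Num.Theory.
Import numFieldNormedType.Exports.
Local Open Scope classical_set_scope.
Local Open Scope ring_scope.

Section Defs.
Variable R : realType.

(* Points z = s + i t of C = R^2 are pairs (s, t). *)

Definition uhp : set (R * R) := [set p | 0 < p.2].
Definition cuhp0 : set (R * R) := [set p | 0 <= p.2 /\ p != (0, 0)].

Definition ds (f : R * R -> R) (p : R * R) : R := derive1 (fun x => f (x, p.2)) p.1.
Definition dt (f : R * R -> R) (p : R * R) : R := derive1 (fun y => f (p.1, y)) p.2.

Definition partials_at (f : R * R -> R) (p : R * R) : Prop :=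
  derivable (fun x => f (x, p.2)) p.1 1 /\ derivable (fun y => f (p.1, y)) p.2 1.

Definition derivs2 (v : R * R -> R) : seq (R * R -> R) :=
  [:: v; ds v; dt v; ds (ds v); ds (dt v); dt (ds v); dt (dt v)].

Definition C2_uhp (v : R * R -> R) : Prop :=
  forall p, uhp p ->
    [/\ partials_at v p, partials_at (ds v) p, partials_at (dt v) p &
        forall f, f \in derivs2 v -> {for p, continuous f}].

(* v belongs to C^2(closed upper half-plane \ {0}) in the sense of
   Gilbarg-Trudinger: v is C^2 in the open half-plane, v is continuous on
   the closed half-plane minus 0, and every derivative of order <= 2
   extends continuously to the boundary points (s,0), s <> 0. *)
Definition C2_cuhp0 (v : R * R -> R) : Prop :=
  [/\ C2_uhp v,
      (forall q, cuhp0 q -> v p @[p --> within cuhp0 (nbhs q)] --> v q) &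
      forall q, cuhp0 q -> forall f, f \in derivs2 v ->
        exists l : R, f p @[p --> within uhp (nbhs q)] --> l].

Definition laplacian (v : R * R -> R) (p : R * R) : R :=
  ds (ds v) p + dt (dt v) p.

Definition cabs (z : R * R) : R := Num.sqrt (z.1 ^+ 2 + z.2 ^+ 2).
(* arg z in [0, pi] for z in the closed upper half-plane minus 0 *)
Definition carg (z : R * R) : R := acos (z.1 / cabs z).
Definition clog (z : R * R) : R * R := (ln (cabs z), carg z).
(* z^gamma = e^{gamma log z} = |z|^gamma (cos (gamma arg z) + i sin(gamma arg z));
   at z = 0 this gives 0 (for gamma > 0) *)
Definition cpow (z : R * R) (g : R) : R * R :=
  (powR (cabs z) g * cos (g * carg z), powR (cabs z) g * sin (g * carg z)).
Definition cdist2 (z w : R * R) : R := (z.1 - w.1) ^+ 2 + (z.2 - w.2) ^+ 2.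

Definition canonical_a (K : R) (v : R * R -> R) : Prop :=
  exists (g l : R) (z0 : R * R),
    [/\ 0 < g, 0 < l,
        (forall z : R * R, 0 <= z.2 -> K * l ^+ 2 + cdist2 (cpow z g) z0 != 0) &
        forall z, cuhp0 z ->
          v z = ln (4 * l ^+ 2 * g ^+ 2 * powR (cabs z) (2 * (g - 1))
                    / (K * l ^+ 2 + cdist2 (cpow z g) z0) ^+ 2)].

Definition canonical_b (K : R) (v : R * R -> R) : Prop :=
  exists (l : R) (z0 : R * R),
    [/\ 0 < l,
        (forall z : R * R, cuhp0 z -> K * l ^+ 2 + cdist2 (clog z) z0 != 0) &
        forall z, cuhp0 z ->
          v z = ln (4 * l ^+ 2
                    / (cabs z ^+ 2 * (K * l ^+ 2 + cdist2 (clog z) z0) ^+ 2))].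

Definition canonical_solution (K : R) (v : R * R -> R) : Prop :=
  canonical_a K v \/ canonical_b K v.

End Defs.

(* Main.v *)
Require Import Defs.
From HB Require Import structures.
From mathcomp Require Import all_boot all_order all_algebra.
From mathcomp Require Import all_classical all_reals all_analysis.
From mathcomp Require Import measurable_realfun.
From mathcomp Require Import ring lra.
Import Order.TTheory GRing.Theory Num.Theory.
Import numFieldNormedType.Exports.
Local Open Scope classical_set_scope.
Local Open Scope ring_scope.
Set Implicit Arguments.
Unset Strict Implicit.
Unset Printing Implicit Defensive.

(** The conformal change [z = e^(x + i y)], [u = v + 2 x], turns the half-plane into the strip
    [0 < y < pi]; the equation and the boundary conditions keep their form and the area becomes
    the integral over the strip of [e^u]. The Hopf differential [q = u_ww - u_w^2 / 2] is
    holomorphic because of the Liouville equation and real on both boundary lines because of the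
    boundary conditions, so each Fourier moment of [q] along vertical segments equals
    [const * e^(-n x)]. Finite area forces these moments to grow at most polynomially at a
    sequence of abscissas going to [+oo] and [-oo], hence those with [n <> 0] vanish and
    [Im q = 0].

    The growth bound only uses functions of the single variable [x]. The slice area
    [Y = int e^u dy] satisfies [Y'' >= E / 2 - C (Y + Y^3)], where [E = int e^u u_y^2 dy]; this is
    scale invariant, so small area implies boundedness of [Y]. Then [int u dy] is bounded below
    by a quadratic polynomial, and [int u^2 dy] satisfies a Keller-Osserman inequality
    [V'' >= c V^3], which bounds it, and then the Dirichlet energy at suitable abscissas.

    Finally [Im q = 0] means that [f = e^(-u/2)] has [f_xy = 0], so [f = A(x) + B(y)]; the
    Liouville equation [f Delta f - |grad f|^2 = K] separates into linear equations with
    constant coefficients for [A] and [B], and finite area selects the canonical solutions. *)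

(** * Derivatives and continuity *)

(** Since [v] is only C^2, so is [u], and [q] is merely continuous: its Cauchy-Riemann equations
    cannot be written down and are used in integrated form. The second derivatives in a moment of
    [q] are removed by an integration by parts in [y]; what remains contains only [u], its gradient
    and boundary values, and can be differentiated once in [x]. The same form explains why a bound
    on the Dirichlet energy of a slice controls the moments. Finite area gives no pointwise bound by
    itself, and [c1], [c2] may have either sign; hence the passage through slice integrals, where
    boundary terms of order e^(3u/2) are absorbed by the weighted energy E. Each moment is exactly a
    multiple of e^(-n x), so control at one abscissa in every window of length 3 suffices. Functions
    on the strip are encoded as functions continuous on all of R x R whose derivatives are asserted
    for 0 < y < pi only. Every integrand is then globally continuous, and boundary facts are reached
    from the interior by continuity. *)

Definition cts (R : realType) (T : topologicalType) (f : T -> R) : Prop := continuous f.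

Section Calculus.
Variable R : realType.
Implicit Types (f g F : R -> R) (x a b : R).

Definition der f x (d : R) : Prop := is_derive x (1 : R) f d.

Lemma der_eq f x d d' : der f x d -> d = d' -> der f x d'.
Proof. by move=> h <-. Qed.

Lemma der_cst (c : R) x : der (fun _ => c) x 0.
Proof. exact: is_derive_cst. Qed.

Lemma der_id x : der (fun y => y) x 1.
Proof. exact: is_derive_id. Qed.

Lemma derD f g x df dg : der f x df -> der g x dg ->
  der (fun y => f y + g y) x (df + dg).
Proof. by move=> hf hg; exact: is_deriveD. Qed.

Lemma derN f x df : der f x df -> der (fun y => - f y) x (- df).
Proof. by move=> hf; exact: is_deriveN. Qed.

Lemma derM f g x df dg : der f x df -> der g x dg ->
  der (fun y => f y * g y) x (df * g x + f x * dg).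
Proof.
move=> hf hg; apply: (@der_eq _ _ (f x *: dg + g x *: df)).
  exact: is_deriveM.
by rewrite /GRing.scale /=; ring.
Qed.

Lemma derX f (n : nat) x df : der f x df ->
  der (fun y => f y ^+ n) x (n%:R * f x ^+ n.-1 * df).
Proof.
elim: n => [|n IH] h.
  by rewrite !mul0r; apply: der_cst.
have -> : (fun y => f y ^+ n.+1) = (fun y => f y * f y ^+ n).
  by apply: funext => y; rewrite exprS.
apply: (der_eq (derM h (IH h))).
case: n {IH} => [|n] /=; first by rewrite !expr0; ring.
by rewrite exprS -(natr1 n.+1); ring.
Qed.

Lemma der_comp f g x df dg : der g x dg -> der f (g x) df ->
  der (fun y => f (g y)) x (df * dg).
Proof.
move=> hg hf.
have h := @is_derive1_comp R f g x df dg hf hg.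
by apply: (der_eq h); rewrite /GRing.scale /= mulrC.
Qed.

Lemma der_expR f x df : der f x df -> der (fun y => expR (f y)) x (expR (f x) * df).
Proof. by move=> h; apply: (der_comp h); exact: is_derive_expR. Qed.

Lemma der_cos f x df : der f x df -> der (fun y => cos (f y)) x (- sin (f x) * df).
Proof. by move=> h; apply: (der_comp h); exact: is_derive_cos. Qed.

Lemma der_sin f x df : der f x df -> der (fun y => sin (f y)) x (cos (f x) * df).
Proof. by move=> h; apply: (der_comp h); exact: is_derive_sin. Qed.

Lemma derV f x df : f x != 0 -> der f x df ->
  der (fun y => (f y)^-1) x (- (f x) ^- 2 * df).
Proof.
move=> f0 h; exact: (is_deriveV f0 h).
Qed.

Lemma der_near f g x d : (\forall y \near x, f y = g y) -> der g x d -> der f x d.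
Proof.
move=> h hg.
have h' : \forall y \near x, g y = f y by near do apply/esym; apply: h.
exact: (near_eq_is_derive h' hg).
Unshelve. all: by end_near. Qed.

Lemma der_cont f x d : der f x d -> {for x, continuous f}.
Proof.
by case=> h _; apply: differentiable_continuous; exact/derivable1_diffP.
Qed.

Lemma der_uniq f x d d' : der f x d -> der f x d' -> d = d'.
Proof. by case=> _ <- [_ <-]. Qed.

Lemma der_mvt f df a b : a < b -> cts f ->
  (forall x, a < x < b -> der f x (df x)) ->
  exists c, a < c < b /\ f b - f a = df c * (b - a).
Proof.
move=> ab cf h.
have [c] := @MVT R f df a b ab (fun x hx => h x ltac:(by move: hx; rewrite in_itv))
  (continuous_subspaceT (fun t => cf t)).
by rewrite in_itv /= => hc e; exists c.
Qed.

Lemma der_le f df a b : a <= b -> cts f ->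
  (forall x, a < x < b -> der f x (df x)) ->
  (forall x, a < x < b -> 0 <= df x) -> f a <= f b.
Proof.
rewrite le_eqVlt => /orP[/eqP->//|ab] cf h h0.
have [c [hc e]] := der_mvt ab cf h.
by rewrite -subr_ge0 e mulr_ge0 ?h0 // subr_ge0 ltW.
Qed.

Lemma der_const f df a b : a <= b -> cts f ->
  (forall x, a < x < b -> der f x (df x)) ->
  (forall x, a < x < b -> df x = 0) -> f a = f b.
Proof.
rewrite le_eqVlt => /orP[/eqP->//|ab] cf h h0.
have [c [hc e]] := der_mvt ab cf h.
by apply/eqP; rewrite eq_sym -subr_eq0 e (h0 _ hc) mul0r.
Qed.

End Calculus.

Section Continuity.
Variables (R : realType) (T : topologicalType).
Implicit Types f g : T -> R.

Lemma ct_cst (c : R) : cts (fun _ : T => c).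
Proof. by move=> x; exact: cvg_cst. Qed.
Lemma ctD f g : cts f -> cts g -> cts (fun t => f t + g t).
Proof. by move=> hf hg x; apply: (@cvgD R R); [exact: hf|exact: hg]. Qed.
Lemma ctN f : cts f -> cts (fun t => - f t).
Proof. by move=> hf x; apply: (@cvgN R R); exact: hf. Qed.
Lemma ctM f g : cts f -> cts g -> cts (fun t => f t * g t).
Proof. by move=> hf hg x; apply: cvgM; [exact: hf|exact: hg]. Qed.
Lemma ctX f n : cts f -> cts (fun t => f t ^+ n).
Proof.
move=> hf; elim: n => [|n IH]; first exact: ct_cst.
have -> : (fun t => f t ^+ n.+1) = (fun t => f t * f t ^+ n) by apply: funext => t; rewrite exprS.
exact: (ctM hf IH).
Qed.
Lemma ct_comp (h : R -> R) f : cts h -> cts f -> cts (fun t => h (f t)).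
Proof. by move=> hh hf x; apply: continuous_comp; [exact: hf|exact: hh]. Qed.
Lemma ct_expR f : cts f -> cts (fun t => expR (f t)).
Proof. by apply: ct_comp; move=> x; exact: continuous_expR. Qed.
Lemma ct_cos f : cts f -> cts (fun t => cos (f t)).
Proof. by apply: ct_comp; move=> x; exact: continuous_cos. Qed.
Lemma ct_sin f : cts f -> cts (fun t => sin (f t)).
Proof. by apply: ct_comp; move=> x; exact: continuous_sin. Qed.
Lemma ct_norm f : cts f -> cts (fun t => `|f t|).
Proof. by apply: ct_comp; move=> x; exact: norm_continuous. Qed.
Lemma ctV f : (forall t, f t != 0) -> cts f -> cts (fun t => (f t)^-1).
Proof. by move=> f0 hf x; apply: cvgV; [exact: f0|exact: hf]. Qed.
End Continuity.

Lemma ct_id (R : realType) : cts (fun t : R => t).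
Proof. by move=> x; exact: cvg_id. Qed.
Lemma ct_fst (R : realType) : cts (fun p : R * R => p.1).
Proof. by move=> x; exact: cvg_fst. Qed.
Lemma ct_snd (R : realType) : cts (fun p : R * R => p.2).
Proof. by move=> x; exact: cvg_snd. Qed.

Definition ct2 (R : realType) (G : R -> R -> R) := cts (fun p : R * R => G p.1 p.2).

Lemma ct2_comp (R : realType) (T : topologicalType) (G : R -> R -> R) (a b : T -> R) :
  ct2 G -> cts a -> cts b -> cts (fun t => G (a t) (b t)).
Proof.
move=> hG ha hb x.
exact: (cvg_comp2 (ha x) (hb x) (hG (a x, b x))).
Qed.

Ltac cts_tac := match goal with
 | |- ct2 ?G => change (cts (fun p => G p.1 p.2)); cbv beta; cts_tac
 | |- @cts ?R ?T (fun t => ?c) => exact (@ct_cst R T c)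
 | |- @cts ?R _ (fun t => t) => exact (@ct_id R)
 | |- @cts ?R _ (fun t => t.1) => exact (@ct_fst R)
 | |- @cts ?R _ (fun t => t.2) => exact (@ct_snd R)
 | H : cts ?f |- cts ?f => exact: H
 | |- cts (fun t => @?f t + @?g t) => refine (@ctD _ _ f g _ _); cts_tac
 | |- cts (fun t => - @?f t) => refine (@ctN _ _ f _); cts_tac
 | |- cts (fun t => @?f t * @?g t) => refine (@ctM _ _ f g _ _); cts_tac
 | |- cts (fun t => @?f t ^+ ?n) => refine (@ctX _ _ f n _); cts_tac
 | |- cts (fun t => expR (@?f t)) => refine (@ct_expR _ _ f _); cts_tac
 | |- cts (fun t => cos (@?f t)) => refine (@ct_cos _ _ f _); cts_tac
 | |- cts (fun t => sin (@?f t)) => refine (@ct_sin _ _ f _); cts_tac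
 | |- cts (fun t => `|@?f t|) => refine (@ct_norm _ _ f _); cts_tac
 | H : ct2 ?G |- cts (fun t => ?G (@?a t) (@?b t)) => refine (@ct2_comp _ _ G a b H _ _); cts_tac
 | H : ct2 ?G |- cts (?G ?a) => refine (@ct2_comp _ _ G (fun=> a) (fun y => y) H _ _); cts_tac
 | H : cts ?h |- cts (fun t => ?h (@?f t)) => refine (@ct_comp _ _ h f H _); cts_tac
 | _ => idtac
 end.

Ltac der_rules := cbv beta; match goal with
 | |- @der ?R (fun t => ?c) ?x _ => exact (@der_cst R c x)
 | |- @der ?R (fun t => t) ?x _ => exact (@der_id R x)
 | |- der (fun t => @?f t + @?g t) ?x _ => refine (@derD _ f g x _ _ _ _); der_rules
 | |- der (fun t => - @?f t) ?x _ => refine (@derN _ f x _ _); der_rules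
 | |- der (fun t => @?f t * @?g t) ?x _ => refine (@derM _ f g x _ _ _ _); der_rules
 | |- der (fun t => @?f t ^+ ?n) ?x _ => refine (@derX _ f n x _ _); der_rules
 | |- der (fun t => expR (@?f t)) ?x _ => refine (@der_expR _ f x _ _); der_rules
 | |- der (fun t => cos (@?f t)) ?x _ => refine (@der_cos _ f x _ _); der_rules
 | |- der (fun t => sin (@?f t)) ?x _ => refine (@der_sin _ f x _ _); der_rules
 | H : der ?f ?x _ |- der ?f ?x _ => exact H
 | H : forall x, der ?f x _ |- der ?f _ _ => exact (H _)
 | _ => idtac
 end.
(** The value of the derivative is left open, [der_rules] computes it from the syntax, and the
    remaining goal equates it with the expected value. *)
Ltac der_tac := refine (@der_eq _ _ _ _ _ _ _); [der_rules | cbv beta].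

(** * Integrals of continuous functions *)

Section Integral.
Variable R : realType.
Implicit Types (f g F : R -> R) (x a b : R).
Notation mu := (@lebesgue_measure R).

Definition itg a b f : R := \int[mu]_(y in `[a, b]) f y.

Lemma cts_integrable f a b : cts f -> mu.-integrable `[a, b] (EFin \o f).
Proof.
move=> cf; apply: continuous_compact_integrable; first exact: segment_compact.
by apply: continuous_subspaceT => x; exact: cf.
Qed.

Lemma itgD a b f g : cts f -> cts g ->
  itg a b (fun y => f y + g y) = itg a b f + itg a b g.
Proof. by move=> cf cg; apply: RintegralD => //; exact: cts_integrable. Qed.

Lemma itgZ a b f c : cts f -> itg a b (fun y => c * f y) = c * itg a b f.
Proof. by move=> cf; apply: RintegralZl => //; exact: cts_integrable. Qed.

Lemma itgN a b f : cts f -> itg a b (fun y => - f y) = - itg a b f.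
Proof.
move=> cf; rewrite -mulN1r -itgZ //; apply: eq_Rintegral => y _.
by rewrite mulN1r.
Qed.

Lemma itgB a b f g : cts f -> cts g ->
  itg a b (fun y => f y - g y) = itg a b f - itg a b g.
Proof.
move=> cf cg; rewrite (@itgD a b f (fun y => - g y)) ?itgN //.
by cts_tac.
Qed.

Lemma itg_cst a b c : a <= b -> itg a b (fun _ => c) = c * (b - a).
Proof.
rewrite le_eqVlt => /orP[/eqP<-|ab]; rewrite /itg.
  by rewrite set_itv1 Rintegral_set1 subrr mulr0.
by rewrite Rintegral_cst //= lebesgue_measure_itv /= lte_fin ab.
Qed.

Lemma itg_ge0 a b f : (forall y, a <= y <= b -> 0 <= f y) -> 0 <= itg a b f.
Proof. by move=> h; apply: Rintegral_ge0 => y /=; rewrite in_itv /=; exact: h. Qed.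

Lemma itg_le a b f g : cts f -> cts g -> (forall y, a <= y <= b -> f y <= g y) ->
  itg a b f <= itg a b g.
Proof.
move=> cf cg h; apply: le_Rintegral => //; try exact: cts_integrable.
Qed.

Lemma itg_norm a b f : cts f -> `|itg a b f| <= itg a b (fun y => `|f y|).
Proof. by move=> cf; apply: le_normr_Rintegral => //; exact: cts_integrable. Qed.

(** Derivatives on the strip are known only for interior [y]; differentiation under the integral
    sign is therefore carried out over the open interval, which gives the same integral. *)
Lemma itg_open a b f : cts f -> itg a b f = \int[mu]_(y in `]a, b[) f y.
Proof.
move=> cf.
have h1 : mu.-integrable `]a, b] (EFin \o f).
  apply: (integrableS _ _ _ (cts_integrable a b cf)) => //.
  by apply: subset_itvr; rewrite bnd_simp.
have h2 : mu.-integrable `]a, b[ (EFin \o f).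
  apply: (integrableS _ _ _ h1) => //.
  by apply: subset_itvl; rewrite bnd_simp.
by rewrite /itg -Rintegral_itv_obnd_cbnd // -Rintegral_itv_bndo_bndc.
Qed.

Lemma eq_itg a b f g : (forall y, a <= y <= b -> f y = g y) -> itg a b f = itg a b g.
Proof.
move=> h; apply: eq_Rintegral => y; rewrite inE /= in_itv /=; exact: h.
Qed.

Lemma itg_xx a f : itg a a f = 0.
Proof. by rewrite /itg set_itv1 Rintegral_set1. Qed.

Lemma itg_FTC a b f F : a <= b -> cts f -> cts F ->
  (forall y, a < y < b -> der F y (f y)) -> itg a b f = F b - F a.
Proof.
rewrite le_eqVlt => /orP[/eqP<-|ab] cf cF h; first by rewrite itg_xx subrr.
rewrite /itg /Rintegral (@continuous_FTC2 R f F a b ab) //.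
- by apply: continuous_subspaceT => x; exact: cf.
- split.
  + by move=> x; rewrite in_itv /= => /h[].
  + by apply: cvg_at_right_filter; exact: cF.
  + by apply: cvg_at_left_filter; exact: cF.
- by move=> x; rewrite in_itv /= => /h[_ h']; rewrite derive1E.
Qed.

Lemma primitive f a : cts f ->
  forall x, a < x -> der (fun x => itg a x f) x (f x).
Proof.
move=> cf x ax.
have xx : x < x + 1 by rewrite ltrDl.
have [h1 h2] := @continuous_FTC1_closed R f a x (x + 1) xx
  (cts_integrable a (x + 1) cf) ax (cf x).
by split; [exact: h1|rewrite -derive1E].
Qed.

Lemma itg_cat a b c f : a <= b -> b <= c -> cts f ->
  itg a b f + itg b c f = itg a c f.
Proof.
move=> ab bc cf.
have i2 : mu.-integrable `]b, c] (EFin \o f).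
  apply: (integrableS _ _ _ (cts_integrable b c cf)) => //.
  by apply: subset_itvr; rewrite bnd_simp.
have := @Rintegral_itvB R f (BLeft a) (BRight c) b (cts_integrable a c cf).
rewrite !bnd_simp => /(_ ab bc); rewrite Rintegral_itv_obnd_cbnd // /itg => <-.
by rewrite addrC subrK.
Qed.

Lemma itg_sub a a' b b' f : a' <= a -> a <= b -> b <= b' -> cts f ->
  (forall x, a' <= x <= b' -> 0 <= f x) -> itg a b f <= itg a' b' f.
Proof.
move=> h1 h2 h3 cf f0.
rewrite -(@itg_cat a' a b') //; last exact: le_trans h2 h3.
rewrite -(@itg_cat a b b') //.
have : 0 <= itg a' a f by apply: itg_ge0 => y hy; apply: f0; lra.
have : 0 <= itg b b' f by apply: itg_ge0 => y hy; apply: f0; lra.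
by lra.
Qed.

Lemma cts_max a b f : a <= b -> cts f ->
  exists c, a <= c <= b /\ forall x, a <= x <= b -> f x <= f c.
Proof.
move=> ab cf; have [c] := EVT_max ab (continuous_subspaceT (fun t => cf t)).
rewrite in_itv /= => hc h; exists c; split => // x hx; apply: h.
Qed.

Lemma ct2_bounded (G : R -> R -> R) a b c d : ct2 G ->
  exists M, 0 <= M /\ forall x y, a <= x <= b -> c <= y <= d -> `|G x y| <= M.
Proof.
move=> cG.
have cp : compact (`[a, b] `*` `[c, d] : set (R * R)).
  by apply: compact_setX; exact: segment_compact.
have cG' : {within (`[a, b] `*` `[c, d] : set (R * R)), continuous (fun p => G p.1 p.2)}.
  by apply: continuous_subspaceT => p; exact: cG.
have := compact_bounded (continuous_compact cG' cp).
move=> [M [Mr hM]].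
exists (Num.max 0 (M + 1)); split; first by rewrite le_max lexx.
move=> x y hx hy; rewrite le_max; apply/orP; right.
apply: (hM (M + 1)); first by rewrite ltrDl.
by exists (x, y) => //; split; rewrite /= in_itv.
Qed.

Lemma cts_itg (G : R -> R -> R) a b : ct2 G -> cts (fun x => itg a b (G x)).
Proof.
move=> cG x0.
have [M [M0 hM]] := ct2_bounded (x0 - 1) (x0 + 1) a b cG.
have x0i : x0 \in `](x0 - 1), (x0 + 1)[%classic.
  by rewrite inE /= in_itv /=; lra.
apply: (@continuity_under_integral R _ _ mu G `[a, b] _ (x0 - 1) (x0 + 1) _ _ (fun _ => M)) => //.
- by move=> x _; apply: cts_integrable; cts_tac.
- apply: aeW => y _ x _; have : cts (fun x => G x y) by cts_tac.
  exact.
- apply: (cts_integrable (f := fun _ => M)); cts_tac.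
- move=> x; rewrite /= in_itv /= => hx; apply: aeW => y; rewrite /= in_itv /= => hy.
  by apply: hM => //; lra.
Qed.

Lemma der_itg (G Gx : R -> R -> R) a b x0 : ct2 G -> ct2 Gx ->
  (forall x y, a < y < b -> der (fun x => G x y) x (Gx x y)) ->
  der (fun x => itg a b (G x)) x0 (itg a b (Gx x0)).
Proof.
move=> cG cGx hd.
have [M [M0 hM]] := ct2_bounded (x0 - 1) (x0 + 1) a b cGx.
have -> : (fun x => itg a b (G x)) = (fun x => \int[mu]_(y in `]a, b[) G x y).
  by apply: funext => x; rewrite itg_open //; cts_tac.
have e : forall x y, a < y < b -> partial1of2 G x y = Gx x y.
  by move=> x y hy; rewrite partial1of2E; case: (hd x y hy).
have mI : measurable (`]a, b[ : set R) by [].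
have x0i : `](x0 - 1), (x0 + 1)[%classic x0 by rewrite /= in_itv /=; lra.
have iS : forall h : R -> R, cts h -> mu.-integrable `]a, b[ (EFin \o h).
  move=> h ch; apply: (integrableS _ _ _ (cts_integrable a b ch)) => //.
  by apply: subset_itvW.
have h1 : forall x, `](x0 - 1), (x0 + 1)[%classic x -> mu.-integrable `]a, b[ (EFin \o G x).
  by move=> x _; apply: iS; cts_tac.
have h2 : forall x y, `](x0 - 1), (x0 + 1)[%classic x -> `]a, b[%classic y ->
    derivable (G ^~ y) x 1.
  by move=> x y _; rewrite /= in_itv /= => /(hd x)[].
have h3 : mu.-integrable `]a, b[ (EFin \o (fun _ : R => M)) by apply: iS; cts_tac.
have h4 : forall x y, `](x0 - 1), (x0 + 1)[%classic x -> `]a, b[%classic y ->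
    `|partial1of2 G x y| <= M.
  move=> x y; rewrite /= !in_itv /= => hx hy; rewrite e //; apply: hM; lra.
split.
  exact: (@derivable_under_integral R _ _ mu G _ mI x0 _ _ x0i h1 h2 (fun=> M) (fun=> M0) h3 h4).
rewrite -derive1E (@differentiation_under_integral R _ _ mu G _ mI x0 _ _ x0i h1 h2 (fun=> M) (fun=> M0) h3 h4).
rewrite itg_open; last by cts_tac.
by apply: eq_Rintegral => y; rewrite inE /= in_itv /= => hy; rewrite e.
Qed.

End Integral.

(** * Second-order differential inequalities *)

Section ODE.
Variable R : realType.
Implicit Types (Y V : R -> R) (x a b : R).

Lemma der_cts f (df : R -> R) : (forall x, der f x (df x)) -> cts f.
Proof. by move=> h x; exact: (der_cont (h x)). Qed.

(** Adding [a / 2 * (t - x1) ^+ 2] makes [Y] convex on [l, h], so that it lies above its tangent at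
    [x1]. *)
Lemma taylor_ge Y Y1 Y2 a l h x1 x : 
  (forall x, der Y x (Y1 x)) -> (forall x, der Y1 x (Y2 x)) ->
  (forall x, l <= x <= h -> - a <= Y2 x) -> l <= x1 <= h -> l <= x <= h ->
  Y x1 + Y1 x1 * (x - x1) - a / 2 * (x - x1) ^+ 2 <= Y x.
Proof.
move=> dY dY1 hY h1 h2.
pose G t := Y t + a / 2 * (t - x1) ^+ 2.
pose G1 t := Y1 t + a * (t - x1).
have dG t : der G t (G1 t) by rewrite /G; der_tac; rewrite /G1; field.
have dG1 t : der G1 t (Y2 t + a) by rewrite /G1; der_tac; ring.
have cG := der_cts dG. have cG1 := der_cts dG1.
have mono s t : l <= s -> s <= t -> t <= h -> G1 s <= G1 t.
  move=> ls st th; apply: (@der_le _ G1 (fun x => Y2 x + a)) => //.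
  by move=> z hz; have := hY z; lra.
have -> : Y x = G x - a / 2 * (x - x1) ^+ 2 by rewrite /G; ring.
have -> : Y x1 = G x1 by rewrite /G subrr; ring.
have -> : Y1 x1 = G1 x1 by rewrite /G1 subrr; ring.
suff : G x1 + G1 x1 * (x - x1) <= G x by lra.
have [e|n] := eqVneq x x1; first by rewrite e subrr; lra.
have [xx1|xx1] := ltP x x1.
  have [c [hc e]] := der_mvt xx1 cG (fun z _ => dG z).
  have m : G1 c <= G1 x1 by apply: mono; lra.
  have := ler_wpM2r (_ : 0 <= x1 - x) m; rewrite subr_ge0 (ltW xx1) -e => /(_ isT).
  by lra.
have xx2 : x1 < x by rewrite lt_neqAle eq_sym n.
have [c [hc e]] := der_mvt xx2 cG (fun z _ => dG z).
have m : G1 x1 <= G1 c by apply: mono; lra.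
have := ler_wpM2r (_ : 0 <= x - x1) m; rewrite subr_ge0 xx1 -e => /(_ isT).
by lra.
Qed.

(** The linear term of the tangent cancels over an interval symmetric about [x]; the quadratic error
    is replaced by its largest value, the one at distance [r]. *)
Lemma itg_ge_taylor Y dY ddY a x r : 0 <= r -> 
  (forall x, der Y x (dY x)) -> (forall x, der dY x (ddY x)) ->
  (forall t, x - r <= t <= x + r -> - a <= ddY t) -> 0 <= a ->
  2 * r * Y x - a * r ^+ 3 <= itg (x - r) (x + r) Y.
Proof.
move=> r0 hY hdY h a0.
pose P t := Y x + dY x * (t - x) - a / 2 * r ^+ 2.
pose Q t := Y x * t + dY x * (t - x) ^+ 2 / 2 - a / 2 * r ^+ 2 * t.
have cP : cts P by rewrite /P; cts_tac.
have cQ : cts Q by rewrite /Q; cts_tac.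
have -> : 2 * r * Y x - a * r ^+ 3 = itg (x - r) (x + r) P.
  rewrite (itg_FTC (F := Q)) //; first by rewrite /Q; field.
    by lra.
  by move=> y _; rewrite /Q; der_tac; rewrite /P; field.
apply: itg_le => //; first exact: der_cts hY.
move=> y hy; have := taylor_ge hY hdY h _ hy => /(_ x).
rewrite /P => H; apply: le_trans (H _); last by lra.
rewrite lerD2l lerN2; apply: ler_wpM2l; first by lra.
rewrite -[leRHS]real_normK ?num_real // -[leLHS]real_normK ?num_real //.
by rewrite ler_sqr ?nnegrE // ler_norml (ger0_norm r0); lra.
Qed.

(** Point picking. Let [x1] maximise [(1 - |x - x0|) * Y x] and put [m = Y x1]; then [Y <= 2 * m]
    within distance [r = k / m] of [x1]. There [Y''] is at least [- 10 * C * m ^+ 3], so the area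
    over that interval is at least [2 * k - 10 * C * k ^+ 3 >= k], whatever [m] is. This exceeds the
    allowed [k / 2]. *)
Lemma small_area_bound (C : R) : 0 < C -> exists2 d : R, 0 < d &
  forall Y dY ddY x0,
  (forall x, der Y x (dY x)) -> (forall x, der dY x (ddY x)) ->
  (forall x, 0 < Y x) -> (forall x, - C * (Y x + Y x ^+ 3) <= ddY x) ->
  itg (x0 - 1) (x0 + 1) Y <= d -> Y x0 <= 1.
Proof.
move=> C0.
(* [k <= 1 / 2] keeps the interval of radius [k / m] where the weight is at least half its value at
   [x1]; [10 * C * k ^+ 2 <= 1] handles the error term. The 10 comes from
   [2 * m + (2 * m) ^+ 3 <= 10 * m ^+ 3] for [m >= 1]. *)
pose k := (2 + 10 * C)^-1.
have kd : (2 + 10 * C) * k = 1 by rewrite divff //; lra.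
have k0 : 0 < k by rewrite invr_gt0; lra.
have k2 : k <= 1 / 2 by nra.
have kC : 10 * C * k ^+ 2 <= 1 by rewrite expr2; nra.
exists (k / 2); first by lra.
move=> Y dY ddY x0 hY hdY Y0 hdd hi.
have cY : cts Y := der_cts hY.
rewrite leNgt; apply/negP => Y1.
have cf : cts (fun x => (1 - `|x - x0|) * Y x) by cts_tac.
have [|x1 [x1i hmax]] := @cts_max _ (x0 - 1) (x0 + 1) _ _ cf; first by lra.
set m := Y x1 in hmax.
pose d := 1 - `|x1 - x0|.
have L1 : 1 < d * m.
  apply: lt_le_trans (hmax x0 _); last by lra.
  by rewrite subrr normr0; lra.
have m0 : 0 < m := Y0 x1.
have d1 : d <= 1 by rewrite /d; have := normr_ge0 (x1 - x0); lra.
have d0 : 0 < d by rewrite -(pmulr_lgt0 _ m0); lra.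
have m1 : 1 < m by nra.
pose r := k / m.
have rm : r * m = k by rewrite /r divfK //; apply: lt0r_neq0.
have r0 : 0 < r by rewrite divr_gt0.
have rd : r <= d / 2 by rewrite -(ler_pM2r m0) rm; lra.
have near t : x1 - r <= t <= x1 + r -> d / 2 <= 1 - `|t - x0|.
  move=> ht; have : `|t - x0| <= `|t - x1| + `|x1 - x0|.
    by rewrite (_ : t - x0 = (t - x1) + (x1 - x0)) ?ler_normD //; ring.
  have : `|t - x1| <= r by rewrite ler_norml; lra.
  by rewrite /d in rd *; lra.
have inI t : x1 - r <= t <= x1 + r -> x0 - 1 <= t <= x0 + 1.
  move=> /near h; have : `|t - x0| <= 1 by lra.
  by rewrite ler_norml; lra.
have Ym t : x1 - r <= t <= x1 + r -> Y t <= 2 * m.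
  move=> ht; have := hmax t (inI t ht); have := near t ht.
  rewrite -/d; have := Y0 t; set q := 1 - _ => Yt hq hle.
  have : d / 2 * Y t <= d * m by apply: le_trans hle; rewrite ler_pM2r.
  by move=> h3; rewrite -(ler_pM2l d0); lra.
have a0 : 0 <= 10 * C * m ^+ 3.
  by apply: mulr_ge0; [lra|rewrite exprn_ge0 // ltW].
have hsub : itg (x1 - r) (x1 + r) Y <= itg (x0 - 1) (x0 + 1) Y.
  have b1 : x0 - 1 <= x1 - r <= x0 + 1 by apply: inI; lra.
  have b2 : x0 - 1 <= x1 + r <= x0 + 1 by apply: inI; lra.
  by apply: itg_sub => // [|||y _]; [lra|lra|lra|exact: ltW].
have H t : x1 - r <= t <= x1 + r -> - (10 * C * m ^+ 3) <= ddY t.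
  move=> ht; apply: le_trans (hdd t); rewrite mulNr lerN2.
  have Yt := Ym t ht; have Y3 : Y t ^+ 3 <= (2 * m) ^+ 3.
    by rewrite lerXn2r ?nnegrE // ?(ltW (Y0 t)) //; lra.
  have m3 : m <= m ^+ 3 by rewrite -{1}(expr1 m) ler_eXn2l.
  have : Y t + Y t ^+ 3 <= 10 * m ^+ 3 by move: Y3; rewrite exprMn; lra.
  by move=> h3; rewrite -(ler_pM2l C0) in h3; lra.
have := itg_ge_taylor (ltW r0) hY hdY H a0; rewrite -/m.
have -> : 2 * r * m - 10 * C * m ^+ 3 * r ^+ 3 = 2 * (r * m) - 10 * C * (r * m) ^+ 3.
  by ring.
rewrite rm => h2.
have : 10 * C * k ^+ 3 <= k.
  by rewrite exprS mulrCA -[leRHS]mulr1 ler_pM2l.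
by lra.
Qed.

(** A symmetric interval whose integral is within [d] of the supremum leaves at most [d] for an
    interval beyond it. *)
Lemma tail_small Y (M d : R) : 0 < d -> cts Y -> (forall x, 0 <= Y x) ->
  (forall a b, a < b -> itg a b Y <= M) ->
  exists2 X, 0 < X & forall x, X <= `|x| -> itg (x - 1) (x + 1) Y <= d.
Proof.
move=> d0 cY Y0 hM.
pose S := [set itg (- x) x Y | x in [set x | 0 < x]].
have hs : has_sup S.
  split; first by exists (itg (- 1) 1 Y), 1; rewrite /= ?ltr01.
  exists M => _ [x /= x0 <-]; apply: hM; lra.
have [_ [N /= N0 <-] hN] := sup_adherent d0 hs.
exists (N + 1); first by lra.
move=> x hx.
have up N' : 0 < N' -> itg (- N') N' Y <= sup S.
  by move=> h; apply: ub_le_sup; [exact: hs.2|exists N'].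
have Nx : 0 < `|x| + 1 by have := normr_ge0 x; lra.
have := up _ Nx; set N' := `|x| + 1 => hN'.
suff : itg (- N) N Y + itg (x - 1) (x + 1) Y <= itg (- N') N' Y by lra.
have sub a b c e : - N' <= a -> a <= b -> b <= c -> c <= e -> e <= N' ->
    itg a b Y + itg c e Y <= itg (- N') N' Y.
  move=> *; rewrite -(@itg_cat _ (- N') b N') //; [|lra|lra].
  by apply: lerD; apply: itg_sub => //; lra.
have [x0|x0] := leP 0 x.
  have eN : N' = x + 1 by rewrite /N' ger0_norm.
  rewrite ger0_norm // in hx.
  by apply: sub; lra.
have eN : N' = - x + 1 by rewrite /N' ltr0_norm.
rewrite ltr0_norm // in hx.
by rewrite addrC; apply: sub; lra.
Qed.

Lemma finite_area_bounded (C M : R) Y dY ddY : 0 < C -> 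
  (forall x, der Y x (dY x)) -> (forall x, der dY x (ddY x)) ->
  (forall x, 0 < Y x) -> (forall x, - C * (Y x + Y x ^+ 3) <= ddY x) ->
  (forall a b, a < b -> itg a b Y <= M) -> exists B, forall x, Y x <= B.
Proof.
move=> C0 hY hdY Y0 hdd hM; have cY := der_cts hY.
have [d d0 hd] := small_area_bound C0.
have [X X0 hX] := tail_small d0 cY (fun x => ltW (Y0 x)) hM.
have [|c [hc hmax]] := @cts_max _ (- X) X _ _ cY; first by lra.
exists (Num.max 1 (Y c)) => x; rewrite le_max.
have [xX|xX] := leP X `|x|.
  by apply/orP; left; apply: (hd _ _ _ _ hY hdY) => //; apply: hX.
by apply/orP; right; apply: hmax; move: xX; rewrite ltr_norml; lra.
Qed.

Lemma max_test (f f1 f2 : R -> R) a b c :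
  (forall x, der f x (f1 x)) -> (forall x, der f1 x (f2 x)) -> cts f2 ->
  a < c < b -> (forall x, a <= x <= b -> f x <= f c) -> f1 c = 0 /\ f2 c <= 0.
Proof.
move=> df df1 cf2 hc hmax.
have e1 : f1 c = 0.
  have h := @derive1_at_max R f a b c.
  have ab : a <= b by lra.
  have ic : c \in `]a, b[ by rewrite in_itv.
  have : is_derive c 1 f 0.
    apply: h => // [t|t]; rewrite in_itv /= => ht.
      by case: (df t).
    by apply: hmax; lra.
  by move=> h'; exact: (der_uniq (df c) h').
split => //; rewrite leNgt; apply/negP => pos.
have : \forall t \near c, 0 < f2 t by move: pos; apply: cvgr_gt (cf2 c) _.
move=> [e /= e0 he].
pose h := Num.min (e / 2) ((b - c) / 2).
have h0 : 0 < h by rewrite lt_min; lra.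
have he2 : h <= e / 2 by rewrite ge_min lexx.
have hb : h <= (b - c) / 2 by rewrite ge_min lexx orbT.
have cch : c < c + h by lra.
have [t [ht et]] := der_mvt cch (der_cts df) (fun z _ => df z).
have ct' : c < t by lra.
have [s [hs es]] := der_mvt ct' (der_cts df1) (fun z _ => df1 z).
have f2s : 0 < f2 s.
  by apply: he; rewrite /= ltr0_norm; lra.
have : 0 < f1 t - f1 c by rewrite es mulr_gt0 // subr_gt0.
rewrite e1 subr0 => f1t.
have : 0 < f (c + h) - f c by rewrite et mulr_gt0 //; lra.
by have := hmax (c + h); lra.
Qed.

(** The cut-off [q] vanishes at the ends of the interval, so a value of [q * V] above [L] forces an
    interior maximum. There the first-order condition eliminates [dV] and the second-order one gives
    [q ^+ 2 * V'' <= 10 * V], hence [c * (q * V) ^+ 2 <= 10], against the choice of [L]. The bound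
    is thus independent of the values of [V] at the ends. *)
Lemma keller_osserman (c T X : R) V dV ddV : 0 < c -> 0 <= T ->
  (forall x, der V x (dV x)) -> (forall x, der dV x (ddV x)) -> cts ddV ->
  (forall x, X - 1 <= x <= X + 1 -> T <= V x -> c * V x ^+ 3 <= ddV x) ->
  (forall L, T < L -> 10 < c * L ^+ 2 -> V X <= L).
Proof.
move=> c0 T0 hV hdV cdd hc L TL cL; rewrite leNgt; apply/negP => VX.
pose q x := 1 - (x - X) ^+ 2.
pose f x := q x * V x.
pose f1 x := - 2 * (x - X) * V x + q x * dV x.
pose f2 x := - 2 * V x - 4 * (x - X) * dV x + q x * ddV x.
have df x : der f x (f1 x) by rewrite /f /q; der_tac; rewrite /f1 /q; ring.
have df1 x : der f1 x (f2 x) by rewrite /f1 /q; der_tac; rewrite /f2 /q; ring.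
have cV := der_cts hV; have cdV := der_cts hdV.
have cf2 : cts f2 by rewrite /f2 /q; cts_tac.
have [|m [hm hmax]] := @cts_max _ (X - 1) (X + 1) _ _ (der_cts df); first by lra.
have fm : L < f m.
  by apply: lt_le_trans (hmax X _); rewrite /f /q ?subrr ?expr0n /=; lra.
have L0 : 0 < L by lra.
have qle : q m <= 1 by rewrite /q; have := sqr_ge0 (m - X); lra.
have q0 : 0 <= q m by rewrite /q; nra.
have V0 : 0 < V m by rewrite ltNge; apply/negP => Vn; move: fm; rewrite /f; nra.
have q1 : 0 < q m by rewrite -(pmulr_lgt0 _ V0) -/(f m); lra.
have VL : L < V m by apply: lt_le_trans fm _; rewrite /f ler_piMl // ltW.
have mi : X - 1 < m < X + 1 by move: q1; rewrite /q; nra.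
have [e1 e2] := max_test df df1 cf2 mi hmax.
have h3 := hc m hm (ltW (lt_trans TL VL)).
have e3 : q m ^+ 2 * ddV m <= 10 * V m.
  have : q m * f2 m <= 0 by rewrite mulr_ge0_le0 // ltW.
  have -> : q m * f2 m = q m ^+ 2 * ddV m - 4 * (m - X) * (q m * dV m) - 2 * V m * q m.
    by rewrite /f2; ring.
  have -> : q m * dV m = 2 * (m - X) * V m by move: e1; rewrite /f1; lra.
  have : (1 - q m) * V m = (m - X) ^+ 2 * V m by rewrite /q; ring.
  have : q m * V m <= V m by rewrite ler_piMl // ltW.
  have : 0 < q m * V m by rewrite mulr_gt0.
  by lra.
have : q m ^+ 2 * (c * V m ^+ 3) <= 10 * V m.
  by apply: le_trans e3; apply: ler_wpM2l => //; rewrite exprn_ge0.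
have -> : q m ^+ 2 * (c * V m ^+ 3) = (c * f m ^+ 2) * V m by rewrite /f; ring.
rewrite ler_pM2r //.
have : L ^+ 2 <= f m ^+ 2 by rewrite lerXn2r ?nnegrE; lra.
by move=> h4; rewrite -(ler_pM2l c0) in h4; lra.
Qed.

End ODE.

(** * Area of the slices of a strip solution *)

(** [u] is [v + 2 * x] in the coordinates z = e^(x + i y): the summand [2 * x] is the logarithm of
    the Jacobian, which preserves the shape of the equation, of the boundary conditions and of the
    area. The sign in [sbcpi] arises because the angular derivative points downwards on the negative
    real axis. For [y] outside [0, pi] only continuity is recorded. *)
Record strip_solution (R : realType) (K c1 c2 : R)
    (u ux uy uxx uxy uyy : R -> R -> R) : Prop := StripSolution {
  su : ct2 u; sux : ct2 ux; suy : ct2 uy;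
  suxx : ct2 uxx; suxy : ct2 uxy; suyy : ct2 uyy;
  sdux : forall x y : R, 0 < y < pi -> der (fun x => u x y) x (ux x y);
  sduy : forall x y : R, 0 < y < pi -> der (fun y => u x y) y (uy x y);
  sduxx : forall x y : R, 0 < y < pi -> der (fun x => ux x y) x (uxx x y);
  sduxy : forall x y : R, 0 < y < pi -> der (fun y => ux x y) y (uxy x y);
  sduyx : forall x y : R, 0 < y < pi -> der (fun x => uy x y) x (uxy x y);
  sduyy : forall x y : R, 0 < y < pi -> der (fun y => uy x y) y (uyy x y);
  spde : forall x y : R, 0 <= y <= pi -> uxx x y + uyy x y = - 2 * K * expR (u x y);
  sbc0 : forall x, uy x 0 = c1 * expR (u x 0 / 2);
  sbcpi : forall x, uy x pi = - c2 * expR (u x pi / 2);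
  sarea : exists M, forall a b, a < b ->
    itg a b (fun x => itg 0 pi (fun y => expR (u x y))) <= M
}.

Lemma eq_imp_le (R : realType) (a b : R) : a = b -> a <= b.
Proof. by move=> ->. Qed.

Section Agmon.
Variable R : realType.
Local Notation I := (@itg R 0 pi).

(** The inequality [p y1 <= p y2 + I q] holds for every [y2] and is averaged over [y2]. A majorant
    [q] of [|dp|] is taken so that Young's inequality can be applied beforehand. *)
Lemma agmon (p dp q : R -> R) (y1 : R) : cts p -> cts dp -> cts q ->
  (forall y : R, 0 < y < pi -> der p y (dp y)) ->
  (forall y : R, `|dp y| <= q y) -> 0 <= y1 <= pi ->
  p y1 <= I p / pi + I q.
Proof.
move=> cp cdp cq hd hq h1.
have q0 (y : R) : 0 <= q y := le_trans (normr_ge0 _) (hq y).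
have pi0 := pi_gt0 R.
have H (y2 : R) : 0 <= y2 <= pi -> p y1 <= p y2 + I q.
  move=> h2; have [y21|y12] := leP y2 y1.
    have : itg y2 y1 dp = p y1 - p y2.
      by apply: itg_FTC => // y hy; apply: hd; lra.
    have : itg y2 y1 dp <= itg y2 y1 q.
      by apply: itg_le => // y _; exact: le_trans (ler_norm _) (hq y).
    have : itg y2 y1 q <= I q by apply: itg_sub => //; lra.
    by lra.
  have : itg y1 y2 dp = p y2 - p y1.
    by apply: itg_FTC => //; [lra|move=> y hy; apply: hd; lra].
  have : itg y1 y2 (fun y => - dp y) <= itg y1 y2 q.
    apply: itg_le => //; first by cts_tac.
    by move=> y _; apply: le_trans (hq y); rewrite -normrN ler_norm.
  have : itg y1 y2 q <= I q by apply: itg_sub => //; lra.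
  by rewrite itgN //; lra.
have : I (fun _ => p y1) <= I (fun y => p y + I q).
  by apply: itg_le; [cts_tac|cts_tac|exact: H].
rewrite itgD //; last by cts_tac.
rewrite !itg_cst ?pi_ge0 // !subr0 => h.
by rewrite -(ler_pM2r pi0) mulrDl divfK ?lt0r_neq0.
Qed.

End Agmon.

Section SliceArea.
Variables (R : realType) (K c1 c2 : R) (u ux uy uxx uxy uyy : R -> R -> R).
Hypothesis S : strip_solution K c1 c2 u ux uy uxx uxy uyy.
Hypothesis K1 : `|K| <= 1.
Local Notation I := (@itg R 0 pi).

Let cu : ct2 u := su S. Let cux : ct2 ux := sux S. Let cuy : ct2 uy := suy S.
Let cuxx : ct2 uxx := suxx S. Let cuxy : ct2 uxy := suxy S. Let cuyy : ct2 uyy := suyy S.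

Let c_ex : exists c : R, [/\ 1 <= c, `|c1| <= c & `|c2| <= c].
Proof.
exists (1 + `|c1| + `|c2|).
by have := normr_ge0 c1; have := normr_ge0 c2; split; lra.
Qed.

Definition slice_area x := I (fun y => expR (u x y)).
Definition dslice_area x := I (fun y => expR (u x y) * ux x y).
Definition ddslice_area x := I (fun y => expR (u x y) * ux x y * ux x y + expR (u x y) * uxx x y).
Definition weighted_energy x := I (fun y => expR (u x y) * uy x y ^+ 2).
Definition slice_exp2 x := I (fun y => expR (2 * u x y)).
Definition energy x := I (fun y => ux x y ^+ 2 + uy x y ^+ 2).

Lemma der_slice_area x : der slice_area x (dslice_area x).
Proof.
apply: (@der_itg _ (fun x y => expR (u x y)) (fun x y => expR (u x y) * ux x y)).
- by cts_tac.
- by cts_tac.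
- by move=> z y hy; apply: der_expR; exact: (sdux S).
Qed.

Lemma der_dslice_area x : der dslice_area x (ddslice_area x).
Proof.
apply: (@der_itg _ (fun x y => expR (u x y) * ux x y)
  (fun x y => expR (u x y) * ux x y * ux x y + expR (u x y) * uxx x y)).
- by cts_tac.
- by cts_tac.
- move=> z y hy; apply: derM; last exact: (sduxx S).
  by apply: der_expR; exact: (sdux S).
Qed.

Lemma expR_double (a : R) : expR (2 * a) = expR a ^+ 2.
Proof. by rewrite -expRM_natl. Qed.
Lemma expR_half (a : R) : expR a = expR (a / 2) ^+ 2.
Proof. by rewrite -expRM_natl mulrC divfK. Qed.

(** The equation trades [uxx] for [- uyy], and [e^u uyy] is integrated by parts. The boundary
    conditions turn [e^u uy] into multiples of e^(3u/2), which have no sign and must be absorbed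
    later. *)
Lemma ddslice_areaE x : ddslice_area x = I (fun y => expR (u x y) * ux x y ^+ 2) + weighted_energy x
  + c1 * expR (u x 0 / 2) ^+ 3 + c2 * expR (u x pi / 2) ^+ 3 - 2 * K * slice_exp2 x.
Proof.
have e : I (fun y => expR (u x y) * uy x y * uy x y + expR (u x y) * uyy x y)
   = expR (u x pi) * uy x pi - expR (u x 0) * uy x 0.
  apply: (itg_FTC (F := fun y => expR (u x y) * uy x y)); rewrite ?pi_ge0 //; [cts_tac|cts_tac|].
  move=> y hy; apply: derM; last exact: (sduyy S).
  by apply: der_expR; exact: (sduy S).
have -> : ddslice_area x = I (fun y => expR (u x y) * ux x y ^+ 2) + weighted_energy x - 2 * K * slice_exp2 x
    - I (fun y => expR (u x y) * uy x y * uy x y + expR (u x y) * uyy x y).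
  rewrite /weighted_energy /slice_exp2 -itgD -?itgZ -?itgB; try by cts_tac.
  apply: eq_itg => y hy.
  have -> : uxx x y = - uyy x y - 2 * K * expR (u x y) by have := spde S x hy; lra.
  by rewrite expR_double; ring.
rewrite e (sbc0 S) (sbcpi S) (expR_half (u x pi)) (expR_half (u x 0)).
by ring.
Qed.

Lemma slice_area_gt0 x : 0 < slice_area x.
Proof.
have cf : cts (fun y => expR (u x y)) by cts_tac.
have [m [hm hmin]] := @cts_max _ 0 pi (fun y => - expR (u x y)) (pi_ge0 R) ltac:(cts_tac).
have : I (fun _ => expR (u x m)) <= slice_area x.
  by apply: itg_le; [cts_tac|cts_tac|move=> y /hmin; rewrite lerN2].
rewrite itg_cst ?pi_ge0 // subr0; apply: lt_le_trans.
by rewrite mulr_gt0 ?expR_gt0 ?pi_gt0.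
Qed.

Lemma weighted_energy_ge0 x : 0 <= weighted_energy x.
Proof. by apply: itg_ge0 => y _; rewrite mulr_ge0 ?expR_ge0 ?sqr_ge0. Qed.

Lemma energy_ge0 x : 0 <= energy x.
Proof. by apply: itg_ge0 => y _; rewrite addr_ge0 ?sqr_ge0. Qed.

Lemma slice_exp2_ge0 x : 0 <= slice_exp2 x.
Proof. by apply: itg_ge0 => y _; rewrite expR_ge0. Qed.

Lemma divpi_le (a : R) : 0 <= a -> a / pi <= a.
Proof.
move=> a0; rewrite ler_pdivrMr ?pi_gt0 // ler_peMr //.
by have := pi_ge2 R; lra.
Qed.

(** [agmon] for e^u, with [|uy| <= k + uy ^+ 2 / (4 * k)]. The parameter [k] stays free because its
    useful value depends on the slice. *)
Lemma expu_le k x y : 0 < k -> 0 <= y <= pi ->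
  expR (u x y) <= (1 + k) * slice_area x + weighted_energy x / (4 * k).
Proof.
move=> k0 hy.
have k4 : 0 < 4 * k by lra.
have := @agmon R (fun y => expR (u x y)) (fun y => expR (u x y) * uy x y)
  (fun y => k * expR (u x y) + (4 * k)^-1 * (expR (u x y) * uy x y ^+ 2)) y.
move=> /(_ ltac:(cts_tac) ltac:(cts_tac) ltac:(cts_tac)).
rewrite itgD ?itgZ; try by cts_tac.
move=> /(_ _ _ hy) h; apply: le_trans (h _ _) _.
- by move=> z hz; apply: der_expR; exact: (sduy S).
- move=> z; rewrite normrM (ger0_norm (expR_ge0 _)).
  set e := expR _; have e0 : 0 <= e := expR_ge0 _.
  have -> : k * e + (4 * k)^-1 * (e * uy x z ^+ 2) =
    e * (k + (4 * k)^-1 * uy x z ^+ 2) by ring.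
  apply: ler_wpM2l => //.
  rewrite -(ler_pM2l k4) mulrDr mulrA divff ?lt0r_neq0 // mul1r.
  have := sqr_ge0 (`|uy x z| - 2 * k); rewrite -(real_normK (num_real (uy x z))).
  by rewrite !expr2; lra.
- have := divpi_le (ltW (slice_area_gt0 x)); rewrite -/(slice_area x) -/(weighted_energy x).
  by rewrite (mulrC (_^-1)); lra.
Qed.

Lemma slice_exp2_le k x : 0 < k -> slice_exp2 x <= ((1 + k) * slice_area x + weighted_energy x / (4 * k)) * slice_area x.
Proof.
move=> k0; rewrite -itgZ; last by cts_tac.
apply: itg_le; [cts_tac|cts_tac|].
move=> y hy; rewrite expR_double expr2 ler_wpM2r ?expR_ge0 //.
exact: expu_le.
Qed.

(** With [k] proportional to the slice area, the coefficient of the weighted energy becomes the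
    prescribed [e], at the price of a cubic term in the area. *)
Lemma slice_exp2_le_eps e x : 0 < e -> slice_exp2 x <= slice_area x ^+ 2 + slice_area x ^+ 3 / (4 * e) + e * weighted_energy x.
Proof.
move=> e0; have Y0 := slice_area_gt0 x.
have k0 : 0 < slice_area x / (4 * e) by rewrite divr_gt0 //; lra.
apply: le_trans (slice_exp2_le x k0) _; apply: eq_imp_le.
by field; rewrite !lt0r_neq0.
Qed.

(** [agmon] for e^(3u/2): its derivative is split by Young's inequality into multiples of e^(2u) and
    of [e^u uy ^+ 2], and its integral is at most the average of [slice_area] and [slice_exp2]. *)
Lemma exp3u_le k x y : 0 < k -> 0 <= y <= pi ->
  expR (u x y / 2) ^+ 3 <= (slice_area x + slice_exp2 x) / 2 + k * slice_exp2 x + 9 / (16 * k) * weighted_energy x.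
Proof.
move=> k0 hy.
have k4 : 0 < 16 * k by lra.
have := @agmon R (fun y => expR (u x y / 2) ^+ 3)
  (fun y => 3 / 2 * expR (u x y / 2) ^+ 3 * uy x y)
  (fun y => k * expR (2 * u x y) + 9 / (16 * k) * (expR (u x y) * uy x y ^+ 2)) y.
move=> /(_ ltac:(cts_tac) ltac:(cts_tac) ltac:(cts_tac)).
rewrite itgD ?itgZ; try by cts_tac.
move=> /(_ _ _ hy) h; apply: le_trans (h _ _) _.
- move=> z hz; have d := sduy S x hz; der_tac.
  by rewrite /=; field.
- move=> z; rewrite expR_double (expR_half (u x z)) normrM.
  set e := expR _; have e0 : 0 <= e := expR_ge0 _.
  rewrite (ger0_norm (_ : 0 <= 3 / 2 * e ^+ 3)); last first.
    by rewrite mulr_ge0 ?exprn_ge0 //; lra.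
  have -> : k * e ^+ 2 ^+ 2 + 9 / (16 * k) * (e ^+ 2 * uy x z ^+ 2) =
    e ^+ 2 * (k * e ^+ 2 + 9 / (16 * k) * uy x z ^+ 2) by ring.
  have -> : 3 / 2 * e ^+ 3 * `|uy x z| = e ^+ 2 * (3 / 2 * e * `|uy x z|) by ring.
  apply: ler_wpM2l; first by rewrite sqr_ge0.
  rewrite -(ler_pM2l k4).
  have -> : 16 * k * (k * e ^+ 2 + 9 / (16 * k) * uy x z ^+ 2) =
    16 * k ^+ 2 * e ^+ 2 + 9 * uy x z ^+ 2 by field; rewrite lt0r_neq0.
  have := sqr_ge0 (4 * k * e - 3 * `|uy x z|); rewrite -(real_normK (num_real (uy x z))).
  by rewrite !expr2; lra.
- have h3 : I (fun y => expR (u x y / 2) ^+ 3) <= (slice_area x + slice_exp2 x) / 2.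
    rewrite /slice_area /slice_exp2 -itgD; [|cts_tac|cts_tac].
    rewrite mulrC -itgZ; last by cts_tac.
    apply: itg_le; [cts_tac|cts_tac|].
    move=> z _; rewrite expR_double (expR_half (u x z)).
    set e := expR _; have e0 : 0 <= e := expR_ge0 _.
    have : 0 <= e ^+ 2 * (1 - e) ^+ 2 by rewrite mulr_ge0 ?sqr_ge0.
    by rewrite !expr2 !exprS expr0; lra.
  have := divpi_le (@itg_ge0 R 0 pi (fun y => expR (u x y / 2) ^+ 3) _).
  move=> /(_ (fun y _ => exprn_ge0 _ (expR_ge0 _))).
  by rewrite -/(slice_exp2 x) -/(weighted_energy x); lra.
Qed.

(** The terms without sign in [ddslice_areaE] together cost half of the weighted energy: an eighth
    for each boundary term and a quarter for the multiple of [slice_exp2]. *)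
Lemma ddslice_area_ge : exists2 C, 0 < C & forall x, weighted_energy x / 2 - C * (slice_area x + slice_area x ^+ 3) <= ddslice_area x.
Proof.
have [c [c_gt0 c1c c2c]] := c_ex.
(* [A] is the total coefficient of [slice_exp2]: each boundary term contributes
   [c / 2 + 9 / 2 * c ^+ 2], and [2 * K] at most 2. *)
pose A := c + 9 * c ^+ 2 + 2.
have A0 : 0 < A by rewrite /A; have := sqr_ge0 c; lra.
have c0 : 0 < c by lra.
exists (A + A ^+ 2 + c); first by have := sqr_ge0 A; lra.
move=> x; rewrite ddslice_areaE.
have Y0 := slice_area_gt0 x; have E0 := weighted_energy_ge0 x; have Q0 := slice_exp2_ge0 x.
(* For [k = 9 / 2 * c], [c] times the factor [9 / (16 * k)] of the weighted energy is an eighth. *)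
have k0 : 0 < 9 / 2 * c by lra.
have pi1 : 0 <= (0 : R) <= pi by rewrite lexx pi_ge0.
have pi2 : 0 <= (pi : R) <= pi by rewrite lexx pi_ge0.
have g0 := exp3u_le x k0 pi1; have gp := exp3u_le x k0 pi2.
have ge z : 0 <= expR (u x z / 2) ^+ 3 := exprn_ge0 _ (expR_ge0 _).
have b1 : - c * expR (u x 0 / 2) ^+ 3 <= c1 * expR (u x 0 / 2) ^+ 3.
  by apply: ler_wpM2r => //; have := c1c; rewrite ler_norml; lra.
have b2 : - c * expR (u x pi / 2) ^+ 3 <= c2 * expR (u x pi / 2) ^+ 3.
  by apply: ler_wpM2r => //; have := c2c; rewrite ler_norml; lra.
have b3 : 2 * K * slice_exp2 x <= 2 * slice_exp2 x.
  by apply: ler_wpM2r => //; have := K1; rewrite ler_norml; lra.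
have e0 : 0 < (4 * A)^-1 by rewrite invr_gt0; lra.
have q := slice_exp2_le_eps x e0.
have ux0 : 0 <= I (fun y => expR (u x y) * ux x y ^+ 2).
  by apply: itg_ge0 => y _; rewrite mulr_ge0 ?expR_ge0 ?sqr_ge0.
have AQ : A * slice_exp2 x <= A * slice_area x ^+ 2 + A ^+ 2 * slice_area x ^+ 3 + weighted_energy x / 4.
  apply: le_trans (ler_wpM2l (ltW A0) q) _; apply: eq_imp_le.
  by field; rewrite lt0r_neq0.
have cg (g : R) : g <= (slice_area x + slice_exp2 x) / 2 + 9 / 2 * c * slice_exp2 x + 9 / (16 * (9 / 2 * c)) * weighted_energy x ->
    c * g <= c / 2 * slice_area x + (c / 2 + 9 / 2 * c ^+ 2) * slice_exp2 x + weighted_energy x / 8.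
  move=> h; apply: le_trans (ler_wpM2l (ltW c0) h) _; apply: eq_imp_le.
  by field; rewrite lt0r_neq0.
have {}g0 := cg _ g0; have {}gp := cg _ gp.
have Y23 : A * slice_area x ^+ 2 <= A * (slice_area x + slice_area x ^+ 3).
  apply: ler_wpM2l; first exact: ltW.
  have : 0 <= slice_area x * (1 - slice_area x) ^+ 2 by rewrite mulr_ge0 ?sqr_ge0 // ltW.
  by rewrite !exprS !expr0; nra.
have Y3 : 0 <= slice_area x ^+ 3 by rewrite exprn_ge0 // ltW.
have AY : 0 <= A ^+ 2 * slice_area x by rewrite mulr_ge0 ?sqr_ge0 // ltW.
have cY : 0 <= c * slice_area x ^+ 3 by rewrite mulr_ge0 // ltW.
have : A * slice_exp2 x = c * slice_exp2 x + 9 * c ^+ 2 * slice_exp2 x + 2 * slice_exp2 x by rewrite /A; ring.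
by lra.
Qed.

End SliceArea.

(** * Growth of a strip solution *)

Section Growth.
Variables (R : realType) (K c1 c2 : R) (u ux uy uxx uxy uyy : R -> R -> R).
Hypothesis S : strip_solution K c1 c2 u ux uy uxx uxy uyy.
Hypothesis K1 : `|K| <= 1.
Local Notation I := (@itg R 0 pi).
Local Notation Y := (slice_area u).
Local Notation E := (weighted_energy u uy).
Local Notation Q := (slice_exp2 u).
Local Notation D := (energy ux uy).

Let cu : ct2 u := su S. Let cux : ct2 ux := sux S. Let cuy : ct2 uy := suy S.
Let cuxx : ct2 uxx := suxx S. Let cuxy : ct2 uxy := suxy S. Let cuyy : ct2 uyy := suyy S.

Let Y_gt0 x : 0 < Y x := slice_area_gt0 S x.
Let E_ge0 x : 0 <= E x := weighted_energy_ge0 u uy x.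
Let D_ge0 x : 0 <= D x := energy_ge0 ux uy x.
Let Q_ge0 x : 0 <= Q x := slice_exp2_ge0 u x.

Lemma slice_area_bounded : exists B, forall x, Y x <= B.
Proof.
have [C C0 h] := ddslice_area_ge S K1; have [M hM] := sarea S.
apply: (finite_area_bounded C0 (der_slice_area S) (der_dslice_area S) _ _ hM) => // x.
by have := h x; have := E_ge0 x; lra.
Qed.

(** Once the slice area is bounded its powers are constants, and the weighted energy is dominated by
    a second derivative in [x]. An error term in [E] can then be compensated by adding a multiple of
    [Y]. *)
Lemma slice_area_ineq : exists2 C, 0 < C & forall x,
  Y x <= C /\ E x <= 2 * ddslice_area u ux uxx x + C.
Proof.
have [C C0 h] := ddslice_area_ge S K1; have [B hB] := slice_area_bounded.
pose A := C * (B + B ^+ 3).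
have B0 : 0 < B := lt_le_trans (Y_gt0 0) (hB 0).
have A0 : 0 < A by rewrite mulr_gt0 // addr_gt0 ?exprn_gt0.
exists (B + 2 * A); first by lra.
move=> x; have YB := hB x; split; first by lra.
have : A >= C * (Y x + Y x ^+ 3).
  apply: ler_wpM2l; first exact: ltW.
  by apply: lerD => //; apply: lerXn2r => //; rewrite nnegrE ltW.
by have := h x; lra.
Qed.

Lemma boundary_exp_bound : exists2 C, 0 < C & forall x y, 0 <= y <= pi ->
  expR (u x y / 2) ^+ 2 <= C * (1 + E x).
Proof.
have [B B0 hB] := slice_area_ineq.
exists (2 * B + 1); first by lra.
move=> x y hy; have [YB _] := hB x; have E0 := E_ge0 x.
rewrite -expR_half; apply: le_trans (expu_le S _ ltr01 hy) _.
have : 0 <= B * E x by rewrite mulr_ge0 // ltW.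
by lra.
Qed.

Lemma slice_exp2_bound : exists2 C, 0 < C & forall x, Q x <= C * (1 + E x).
Proof.
have [B B0 hB] := slice_area_ineq.
exists (B ^+ 2 + B ^+ 3 + 1); first by rewrite !addr_gt0 // exprn_gt0.
move=> x; have [YB _] := hB x; have E0 := E_ge0 x; have Y0 := Y_gt0 x.
apply: le_trans (slice_exp2_le_eps S x ltr01) _.
have h2 : Y x ^+ 2 <= B ^+ 2 by apply: lerXn2r => //; rewrite nnegrE ltW.
have h3 : Y x ^+ 3 <= B ^+ 3 by apply: lerXn2r => //; rewrite nnegrE ltW.
have Y3 : 0 <= Y x ^+ 3 by rewrite exprn_ge0 // ltW.
have : 0 <= (B ^+ 2 + B ^+ 3) * E x by rewrite mulr_ge0 // addr_ge0 // exprn_ge0 // ltW.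
by lra.
Qed.

Definition slice_mean x := I (u x).
Definition dslice_mean x := I (ux x).
Definition ddslice_mean x := I (uxx x).

Lemma der_slice_mean x : der slice_mean x (dslice_mean x).
Proof. by apply: (@der_itg _ u ux) => //; exact: (sdux S). Qed.
Lemma der_dslice_mean x : der dslice_mean x (ddslice_mean x).
Proof. by apply: (@der_itg _ ux uxx) => //; exact: (sduxx S). Qed.

Lemma ddslice_meanE x : ddslice_mean x = c1 * expR (u x 0 / 2) + c2 * expR (u x pi / 2) - 2 * K * Y x.
Proof.
have e : I (uyy x) = uy x pi - uy x 0.
  by apply: (itg_FTC (F := uy x)); rewrite ?pi_ge0 //; [cts_tac|cts_tac|exact: (sduyy S)].
have -> : ddslice_mean x = - 2 * K * Y x - I (uyy x).
  rewrite /slice_area -itgZ -?itgB; try by cts_tac.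
  by apply: eq_itg => y hy; have := spde S x hy; lra.
by rewrite e (sbc0 S) (sbcpi S); ring.
Qed.

Lemma norm_mul_le (a b k : R) : `|a| <= k -> 0 <= b -> - (k * b) <= a * b <= k * b.
Proof.
move=> h b0; have : `|a * b| <= k * b by rewrite normrM (ger0_norm b0) ler_wpM2r.
by rewrite ler_norml.
Qed.

(** The boundary exponentials in [ddslice_mean] are at most a multiple of [1 + E], and [E] is
    dominated by [2 * Y''] plus a constant. Hence [slice_mean + 2 * A * Y] has second derivative
    bounded below and lies above a parabola, while [Y] is bounded. *)
Lemma slice_mean_ge : exists2 C, 0 < C & forall x, - (C * (1 + x ^+ 2)) <= slice_mean x.
Proof.
have [B B0 hB] := slice_area_ineq; have [G G0 hG] := boundary_exp_bound.
pose k := `|c1| + `|c2|.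
have k0 : 0 <= k by rewrite addr_ge0.
pose A := k * (1 + G).
have A0 : 0 <= A by rewrite mulr_ge0 //; lra.
pose W x := slice_mean x + 2 * A * Y x.
pose dW x := dslice_mean x + 2 * A * dslice_area u ux x.
pose ddW x := ddslice_mean x + 2 * A * ddslice_area u ux uxx x.
have hW x : der W x (dW x).
  by have := der_slice_mean x; have := der_slice_area S x => h1 h2; rewrite /W; der_tac; rewrite /dW; ring.
have hdW x : der dW x (ddW x).
  by have := der_dslice_mean x; have := der_dslice_area S x => h1 h2; rewrite /dW; der_tac; rewrite /ddW; ring.
pose a := A + A * B + 2 * B.
have AB0 : 0 <= A * B by rewrite mulr_ge0 // ltW.
have a0 : 0 <= a by rewrite /a; lra.
have lb x : - a <= ddW x.
  rewrite /ddW ddslice_meanE; have [YB EB] := hB x; have E0 := E_ge0 x.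
  have pi1 : 0 <= (0 : R) <= pi by rewrite lexx pi_ge0.
  have pi2 : 0 <= (pi : R) <= pi by rewrite lexx pi_ge0.
  have g1 := hG x 0 pi1; have g2 := hG x pi pi2.
  have gle (t : R) : expR t ^+ 2 <= G * (1 + E x) -> expR t <= (1 + G) * (1 + E x).
    by move=> h; have := sqr_ge0 (expR t - 1); rewrite !expr2 in h *; have := expR_ge0 t; lra.
  have {}g1 := gle _ g1; have {}g2 := gle _ g2.
  have b1 := norm_mul_le (lexx `|c1|) (expR_ge0 (u x 0 / 2)).
  have b2 := norm_mul_le (lexx `|c2|) (expR_ge0 (u x pi / 2)).
  have b3 := norm_mul_le K1 (ltW (Y_gt0 x)).
  have b4 : `|c1| * expR (u x 0 / 2) <= `|c1| * ((1 + G) * (1 + E x)) by exact: ler_wpM2l.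
  have b5 : `|c2| * expR (u x pi / 2) <= `|c2| * ((1 + G) * (1 + E x)) by exact: ler_wpM2l.
  have b6 : `|c1| * ((1 + G) * (1 + E x)) + `|c2| * ((1 + G) * (1 + E x)) = A + A * E x.
    by rewrite /A /k; ring.
  have b7 : A * E x <= A * (2 * ddslice_area u ux uxx x + B) by exact: ler_wpM2l.
  by rewrite /a; lra.
pose C := `|W 0| + `|dW 0| + a + 2 * (A * B) + 1.
exists C.
  by rewrite /C; have := normr_ge0 (W 0); have := normr_ge0 (dW 0); lra.
move=> x.
have i0 : - `|x| <= 0 <= `|x| by have := normr_ge0 x; lra.
have ix : - `|x| <= x <= `|x| by rewrite -ler_norml.
have := taylor_ge hW hdW (fun t _ => lb t) i0 ix; rewrite subr0.
have [YB _] := hB x.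
have AY : A * Y x <= A * B by apply: ler_wpM2l.
have w0 : - `|W 0| <= W 0 by have := lexx `|W 0|; rewrite ler_norml; lra.
have x1 : `|x| <= 1 + x ^+ 2.
  have := sqr_ge0 (`|x| - 1); rewrite -(real_normK (num_real x)) !expr2.
  by have := normr_ge0 x; lra.
have w1 : - (`|dW 0| * (1 + x ^+ 2)) <= dW 0 * x.
  have : `|dW 0 * x| <= `|dW 0| * (1 + x ^+ 2) by rewrite normrM ler_wpM2l.
  by rewrite ler_norml; lra.
have x2 := sqr_ge0 x.
have m1 : 0 <= `|W 0| * x ^+ 2 by rewrite mulr_ge0.
have m2 : 0 <= A * B * x ^+ 2 by rewrite mulr_ge0.
have m3 : 0 <= a * x ^+ 2 by rewrite mulr_ge0.
by rewrite (_ : W x = slice_mean x + 2 * A * Y x) // /C; lra.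
Qed.

(** Pointwise [|u| <= 2 * e^u - u], so the bounded slice area and the lower bound on [slice_mean]
    control the L^1 norm. *)
Lemma slice_abs_bound : exists2 C, 1 <= C & forall x, I (fun y => `|u x y|) <= C * (1 + x ^+ 2).
Proof.
have [B B0 hB] := slice_area_ineq; have [C C0 hC] := slice_mean_ge.
exists (1 + 2 * B + C); first by lra.
move=> x; have [YB _] := hB x.
have : I (fun y => `|u x y|) <= 2 * Y x - slice_mean x.
  rewrite /slice_area -itgZ -?itgB; try by cts_tac.
  apply: itg_le; [cts_tac|cts_tac|].
  move=> y _; have := expR_ge1Dx (u x y); have := expR_ge0 (u x y).
  by rewrite ler_norml; lra.
have : 0 <= B * x ^+ 2 by rewrite mulr_ge0 ?sqr_ge0 // ltW.
have := hC x; have := sqr_ge0 x.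
by lra.
Qed.

Definition slice_square x := I (fun y => u x y ^+ 2).
Definition dslice_square x := I (fun y => 2 * u x y * ux x y).
Definition ddslice_square x := I (fun y => 2 * ux x y ^+ 2 + 2 * u x y * uxx x y).

Lemma der_slice_square x : der slice_square x (dslice_square x).
Proof.
apply: (@der_itg _ (fun x y => u x y ^+ 2) (fun x y => 2 * u x y * ux x y)).
- by cts_tac.
- by cts_tac.
- by move=> z y hy; have := sdux S z hy => d; der_tac; rewrite /=; ring.
Qed.

Lemma der_dslice_square x : der dslice_square x (ddslice_square x).
Proof.
apply: (@der_itg _ (fun x y => 2 * u x y * ux x y)
  (fun x y => 2 * ux x y ^+ 2 + 2 * u x y * uxx x y)).
- by cts_tac.
- by cts_tac.
- move=> z y hy; have d1 := sdux S z hy; have d2 := sduxx S z hy.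
  by der_tac; ring.
Qed.

Lemma cts_ddslice_square : cts ddslice_square.
Proof. by apply: cts_itg; cts_tac. Qed.
Lemma cts_ddslice_area : cts (ddslice_area u ux uxx).
Proof. by apply: cts_itg; cts_tac. Qed.

Lemma ddslice_squareE x : ddslice_square x = 2 * D x - 4 * K * I (fun y => u x y * expR (u x y))
  + 2 * (c1 * (u x 0 * expR (u x 0 / 2)) + c2 * (u x pi * expR (u x pi / 2))).
Proof.
have e : I (fun y => uy x y ^+ 2 + u x y * uyy x y) = u x pi * uy x pi - u x 0 * uy x 0.
  apply: (itg_FTC (F := fun y => u x y * uy x y)); rewrite ?pi_ge0 //; [cts_tac|cts_tac|].
  move=> y hy; have d1 := sduy S x hy; have d2 := sduyy S x hy.
  by der_tac; ring.
have -> : ddslice_square x = 2 * D x - 4 * K * I (fun y => u x y * expR (u x y))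
    - 2 * I (fun y => uy x y ^+ 2 + u x y * uyy x y).
  rewrite /energy -!itgZ -?itgB; try by cts_tac.
  apply: eq_itg => y hy.
  have -> : uxx x y = - uyy x y - 2 * K * expR (u x y) by have := spde S x hy; lra.
  by ring.
by rewrite e (sbc0 S) (sbcpi S); ring.
Qed.

(** Controls the boundary terms [u e^(u/2)]: for positive [t] the factor [t] is at most [2 e^(t/2)],
    for negative [t] the product is bounded. *)
Lemma abs_exp_le (t : R) : `|t| * expR (t / 2) <= 2 + 2 * expR (t / 2) ^+ 2.
Proof.
have [t0|t0] := leP 0 t.
  rewrite (ger0_norm t0); have := expR_ge1Dx (t / 2); have := expR_ge0 (t / 2).
  set g := expR _ => g0 h; rewrite expr2.
  have : t * g <= 2 * g * g by apply: ler_wpM2r => //; lra.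
  by lra.
rewrite (ltr0_norm t0).
have h := expR_ge1Dx (- (t / 2)); have g0 := expR_gt0 (t / 2).
have : - t * expR (t / 2) <= 2 * expR (- (t / 2)) * expR (t / 2).
  by apply: ler_wpM2r; [exact: ltW|lra].
rewrite -mulrA -expRD addNr expR0.
by have := sqr_ge0 (expR (t / 2)); lra.
Qed.

Lemma abs_exp2_le (t : R) : `|t * expR t| <= 1 + expR (2 * t).
Proof.
rewrite normrM (ger0_norm (expR_ge0 _)) expR_double.
have [t0|t0] := leP 0 t.
  rewrite (ger0_norm t0); have := expR_ge1Dx t; have := expR_ge0 t.
  set g := expR _ => g0 h; rewrite expr2.
  have : t * g <= g * g by apply: ler_wpM2r => //; lra.
  by lra.
rewrite (ltr0_norm t0).
have h := expR_ge1Dx (- t); have g0 := expR_gt0 t.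
have : - t * expR t <= expR (- t) * expR t.
  by apply: ler_wpM2r; [exact: ltW|lra].
rewrite -expRD addNr expR0.
by have := sqr_ge0 (expR t); lra.
Qed.

Lemma ddslice_square_ge : exists2 C, 0 < C & forall x, 2 * D x - C * (1 + E x) <= ddslice_square x.
Proof.
have [B B0 hB] := slice_area_ineq; have [G G0 hG] := boundary_exp_bound; have [q q0 hq] := slice_exp2_bound.
pose k := `|c1| + `|c2|.
have k0 : 0 <= k by rewrite addr_ge0.
exists (4 * (pi + q) + 4 * k * (1 + G)).
  have : 0 < pi :> R := pi_gt0 R.
  have : 0 <= 4 * k * (1 + G) by rewrite !mulr_ge0 //; lra.
  by lra.
move=> x; rewrite ddslice_squareE.
have [YB EB] := hB x; have E0 := E_ge0 x.
have pi1 : 0 <= (0 : R) <= pi by rewrite lexx pi_ge0.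
have pi2 : 0 <= (pi : R) <= pi by rewrite lexx pi_ge0.
have b0 : `|I (fun y => u x y * expR (u x y))| <= pi + Q x.
  apply: le_trans (itg_norm _ _ _) _; first by cts_tac.
  rewrite /slice_exp2 -[X in _ <= X + _]subr0 -[X in _ <= X + _]mul1r.
  rewrite -[X in _ <= X + _](@itg_cst R 0 pi) ?pi_ge0 // -itgD; [|cts_tac|cts_tac].
  by apply: itg_le; [cts_tac|cts_tac|move=> y _; exact: abs_exp2_le].
have b1 : `|K * I (fun y => u x y * expR (u x y))| <= pi + Q x.
  by rewrite normrM -[leRHS]mul1r; apply: ler_pM.
have bg z a : 0 <= z <= pi -> - (`|a| * (2 * ((1 + G) * (1 + E x)))) <= a * (u x z * expR (u x z / 2)).
  move=> hz; have : `|a * (u x z * expR (u x z / 2))| <= `|a| * (2 * ((1 + G) * (1 + E x))).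
    rewrite normrM normrM (ger0_norm (expR_ge0 _)) ler_wpM2l //.
    by apply: le_trans (abs_exp_le _) _; have := hG x z hz; lra.
  by rewrite ler_norml; lra.
have := bg _ c1 pi1; have := bg _ c2 pi2.
have := hq x.
move: b1; rewrite ler_norml.
have -> : 4 * K * I (fun y => u x y * expR (u x y)) = 4 * (K * I (fun y => u x y * expR (u x y))) by ring.
have : 0 <= pi * E x by rewrite mulr_ge0 ?pi_ge0.
by rewrite /k; lra.
Qed.

End Growth.

(** The mean value theorem on [X - 1, X] and on [X + 1, X + 2] gives two points at distance at least
    1 where [|dW| <= Z]; between them [ddW] is somewhere at most [2 * Z]. *)
Lemma bounded_slow_point (R : realType) (W dW ddW : R -> R) (X Z : R) :
  (forall x, der W x (dW x)) -> (forall x, der dW x (ddW x)) ->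
  (forall x, X - 1 <= x <= X + 2 -> 0 <= W x <= Z) ->
  exists x, X - 1 < x < X + 2 /\ ddW x <= 2 * Z.
Proof.
move=> hW hdW bd.
have b0 : 0 <= W (X - 1) <= Z by apply: bd; lra.
have b1 : 0 <= W X <= Z by apply: bd; lra.
have b2 : 0 <= W (X + 1) <= Z by apply: bd; lra.
have b3 : 0 <= W (X + 2) <= Z by apply: bd; lra.
have cW := der_cts hW; have cdW := der_cts hdW.
have s1 : X - 1 < X by lra.
have s2 : X + 1 < X + 2 by lra.
have [x1 [h1 e1]] := der_mvt s1 cW (fun z _ => hW z).
have {}e1 : dW x1 = W X - W (X - 1) by rewrite e1; ring.
have [x2 [h2 e2]] := der_mvt s2 cW (fun z _ => hW z).
have {}e2 : dW x2 = W (X + 2) - W (X + 1) by rewrite e2; ring.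
have x12 : x1 < x2 by lra.
have [x [hx e]] := der_mvt x12 cdW (fun z _ => hdW z).
exists x; split; first by lra.
have [dn|dp] := leP (ddW x) 0; first by lra.
have : ddW x * 1 <= ddW x * (x2 - x1) by apply: ler_wpM2l; lra.
by lra.
Qed.

(** * Polynomial bounds on the energy of slices *)

Section EnergyBound.
Variables (R : realType) (K c1 c2 : R) (u ux uy uxx uxy uyy : R -> R -> R).
Hypothesis S : strip_solution K c1 c2 u ux uy uxx uxy uyy.
Hypothesis K1 : `|K| <= 1.
Local Notation I := (@itg R 0 pi).
Local Notation Y := (slice_area u).
Local Notation E := (weighted_energy u uy).
Local Notation Q := (slice_exp2 u).
Local Notation D := (energy ux uy).

Let cu : ct2 u := su S. Let cux : ct2 ux := sux S. Let cuy : ct2 uy := suy S.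
Let cuxx : ct2 uxx := suxx S. Let cuxy : ct2 uxy := suxy S. Let cuyy : ct2 uyy := suyy S.

Let Y_gt0 x : 0 < Y x := slice_area_gt0 S x.
Let E_ge0 x : 0 <= E x := weighted_energy_ge0 u uy x.
Let D_ge0 x : 0 <= D x := energy_ge0 ux uy x.
Let Q_ge0 x : 0 <= Q x := slice_exp2_ge0 u x.

Local Notation V := (slice_square u).

(** A form of Nash's inequality: [agmon] bounds the supremum of [u ^+ 2] by [V] and [D], and [V] is
    at most the root of that supremum times the L^1 norm. The hypothesis [M ^+ 2 <= V x] excludes
    nearly constant slices, where [D] may vanish, and absorbs the term [V x / pi]. *)
Lemma gagliardo_nirenberg M x : 1 <= M -> I (fun y => `|u x y|) <= M -> M ^+ 2 <= V x ->
  V x ^+ 3 <= 16 * M ^+ 4 * D x.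
Proof.
move=> M1 hM MV.
have M2 : 0 < M ^+ 2 by rewrite exprn_gt0 //; lra.
have V0 : 0 < V x by lra.
(* This [k] makes [k * V x * M ^+ 2] a quarter of [V x ^+ 2]; the term with [V x / pi] takes at most
   a half, and a quarter remains for [D]. *)
pose k := V x / (4 * M ^+ 2).
have k0 : 0 < k by rewrite divr_gt0 //; lra.
pose B := V x / pi + (k * V x + k^-1 * D x).
have H y : 0 <= y <= pi -> u x y ^+ 2 <= B.
  move=> hy.
  have := @agmon R (fun y => u x y ^+ 2) (fun y => 2 * u x y * uy x y)
    (fun y => k * u x y ^+ 2 + k^-1 * uy x y ^+ 2) y.
  move=> /(_ ltac:(cts_tac) ltac:(cts_tac) ltac:(cts_tac)).
  rewrite itgD ?itgZ; try by cts_tac.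
  move=> /(_ _ _ hy) h; apply: le_trans (h _ _) _.
  - move=> z hz; have d := sduy S x hz; der_tac.
    by rewrite /=; ring.
  - move=> z; rewrite -(ler_pM2l k0) mulrDr (mulrA k k^-1) divff ?lt0r_neq0 // mul1r.
    rewrite !normrM ger0_norm //.
    have := sqr_ge0 (k * `|u x z| - `|uy x z|).
    rewrite -(real_normK (num_real (uy x z))) -(real_normK (num_real (u x z))) !expr2.
    by lra.
  - rewrite /B; have : I (fun y => uy x y ^+ 2) <= D x.
      by apply: itg_le; [cts_tac|cts_tac|move=> z _; have := sqr_ge0 (ux x z); lra].
    by rewrite -(ler_pM2l (_ : 0 < k^-1)) ?invr_gt0 // /slice_square; lra.
have B0 : 0 <= B by apply: le_trans (H 0 _); rewrite ?sqr_ge0 // lexx pi_ge0.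
have VM : V x <= Num.sqrt B * M.
  apply: (@le_trans _ _ (Num.sqrt B * I (fun y => `|u x y|))); last first.
    by apply: ler_wpM2l => //; exact: sqrtr_ge0.
  rewrite -itgZ; last by cts_tac.
  apply: itg_le; [cts_tac|cts_tac|].
  move=> y hy; rewrite -(real_normK (num_real (u x y))) expr2.
  apply: ler_wpM2r => //.
  by rewrite -sqrtr_sqr ler_sqrt // H.
have V2 : V x ^+ 2 <= B * M ^+ 2.
  rewrite -(sqr_sqrtr B0) -exprMn; apply: lerXn2r => //; rewrite nnegrE ltW //.
  exact: lt_le_trans VM.
have Vpi : V x / pi <= V x / 2.
  by apply: ler_wpM2l; [exact: ltW|rewrite lef_pV2 ?posrE ?pi_gt0 // pi_ge2].
have e1 : k * V x * M ^+ 2 = V x ^+ 2 / 4 by rewrite /k; field; rewrite lt0r_neq0 //; lra.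
have e2 : k^-1 * D x * M ^+ 2 * V x = 4 * M ^+ 4 * D x.
  by rewrite /k; field; rewrite !lt0r_neq0 //; lra.
have V3 : V x ^+ 2 / 4 <= k^-1 * D x * M ^+ 2.
  have : V x / 2 * M ^+ 2 <= V x ^+ 2 / 2.
    have : V x * M ^+ 2 <= V x * V x by apply: ler_wpM2l => //; exact: ltW.
    by rewrite [V x ^+ 2]expr2; lra.
  have : V x / pi * M ^+ 2 <= V x / 2 * M ^+ 2 by apply: ler_wpM2r => //; exact: ltW.
  by move: V2; rewrite /B !mulrDl e1; lra.
have : V x ^+ 2 / 4 * V x <= k^-1 * D x * M ^+ 2 * V x by apply: ler_wpM2r => //; exact: ltW.
by rewrite e2 (exprS _ 2); lra.
Qed.

(* Adding a multiple of [Y] absorbs the term in [E], which is not controlled pointwise. *)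
Lemma augmented_square : exists A P : R, [/\ 0 < A, 0 < P,
  forall x, 0 <= A * Y x <= P &
  forall x, 2 * D x + E x - P <= ddslice_square u ux uxx x + A * ddslice_area u ux uxx x].
Proof.
have [B B0 hB] := slice_area_ineq S K1; have [C C0 hC] := ddslice_square_ge S K1.
pose A := 2 * (C + 1).
have A0 : 0 < A by rewrite /A; lra.
have AB0 : 0 < A * B by rewrite mulr_gt0.
exists A, (C + A * B); split => //; first by lra.
  move=> x; have [YB _] := hB x.
  have : A * Y x <= A * B by rewrite ler_pM2l.
  by have : 0 < A * Y x by [rewrite mulr_gt0]; lra.
move=> x; have [_ EB] := hB x; have := hC x.
have : (C + 1) * E x <= (C + 1) * (2 * ddslice_area u ux uxx x + B) by apply: ler_wpM2l => //; lra.
have : 0 < (C + 1) * B by rewrite mulr_gt0 //; lra.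
by rewrite /A; lra.
Qed.

(** [W = V + A * Y] satisfies [W'' >= W ^+ 3 / (128 * M ^+ 4)] where it is at least [4 * M ^+ 2],
    with [M] of order [1 + X ^+ 2], so [keller_osserman] bounds it by a multiple of [M ^+ 2]. Its
    second derivative, which dominates [2 * D + E] up to a constant, is then under control somewhere
    in each window, but not at every point. *)
Lemma good_points : exists2 C, 0 < C & forall X, exists x,
  X - 1 < x < X + 2 /\ D x + E x <= C * (1 + X ^+ 2) ^+ 2.
Proof.
have [A [P [A0 P0 hAY hdd]]] := augmented_square.
have [m m1 hm] := slice_abs_bound S K1.
pose W x := V x + A * Y x.
pose dW x := dslice_square u ux x + A * dslice_area u ux x.
pose ddW x := ddslice_square u ux uxx x + A * ddslice_area u ux uxx x.
have hW x : der W x (dW x).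
  by have h1 := der_slice_square S x; have h2 := der_slice_area S x; rewrite /W; der_tac; rewrite /dW; ring.
have hdW x : der dW x (ddW x).
  by have h1 := der_dslice_square S x; have h2 := der_dslice_area S x; rewrite /dW; der_tac; rewrite /ddW; ring.
have cddW : cts ddW.
  by have h1 := cts_ddslice_square S; have h2 := cts_ddslice_area S; rewrite /ddW; cts_tac.
have V0 x : 0 <= V x by apply: itg_ge0 => y _; exact: sqr_ge0.
(* The factor 3 is for [1 + x ^+ 2 <= 3 * (1 + X ^+ 2)] when [|x - X| <= 1]; the summand [16 * P]
   makes [P] negligible against [M ^+ 2]. *)
pose w := 3 * m + 16 * P.
have w1 : 1 <= w by rewrite /w; lra.
(* 37 satisfies [37 ^+ 2 / 128 > 10], as [keller_osserman] demands for [c = 1 / (128 * M ^+ 4)] and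
   [L = 37 * M ^+ 2]. *)
have growth X : W X <= 37 * (w * (1 + X ^+ 2)) ^+ 2.
  set M := w * _.
  have Mw : w <= M by rewrite /M ler_peMr //; [lra|have := sqr_ge0 X; lra].
  have M1 : 1 <= M by lra.
  have M2 : M <= M ^+ 2 by rewrite expr2 ler_peMr //; lra.
  have PM : 16 * P <= M ^+ 2 by rewrite /w in Mw; lra.
  have M20 : 0 < M ^+ 2 by rewrite exprn_gt0 //; lra.
  have M40 : 0 < M ^+ 4 by rewrite exprn_gt0 //; lra.
  have c0 : 0 < (128 * M ^+ 4)^-1 by rewrite invr_gt0; lra.
  have T0 : 0 <= 4 * M ^+ 2 by lra.
  apply: (keller_osserman c0 T0 hW hdW cddW).
  - move=> x hx TW.
    have ix : I (fun y => `|u x y|) <= M.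
      apply: le_trans (hm x) _; rewrite /M /w.
      have : x ^+ 2 <= 2 + 2 * X ^+ 2.
        have h0 := sqr_ge0 (x - 2 * X).
        have h1 : (x - X) ^+ 2 <= 1.
          rewrite -(real_normK (num_real (x - X))) -(expr1n _ 2).
          by apply: lerXn2r; rewrite ?nnegrE // ler_norml; lra.
        by rewrite !expr2 in h0 h1 *; lra.
      move=> h; have : m * (1 + x ^+ 2) <= m * (3 * (1 + X ^+ 2)).
        by apply: ler_wpM2l; [lra|have := sqr_ge0 X; lra].
      have : 0 <= P * (1 + X ^+ 2) by rewrite mulr_ge0 ?(ltW P0) // addr_ge0 // sqr_ge0.
      by lra.
    have VM : M ^+ 2 <= V x.
      by have := hAY x; move: TW; rewrite /W; lra.
    have h := gagliardo_nirenberg M1 ix VM.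
    have VW : W x / 2 <= V x by have := hAY x; move: TW; rewrite /W; lra.
    have W0 : 0 <= W x by lra.
    have W3 : (W x / 2) ^+ 3 <= V x ^+ 3 by apply: lerXn2r; rewrite ?nnegrE //; lra.
    have h2 := hdd x; have e0 := E_ge0 x; rewrite -/(ddW x) in h2.
    have M128 : 0 < 128 * M ^+ 4 by lra.
    rewrite -(ler_pM2l M128) (mulrA _ (128 * M ^+ 4)^-1) divff ?lt0r_neq0 // mul1r.
    have h3 : 128 * M ^+ 4 * (2 * D x - P) <= 128 * M ^+ 4 * ddW x.
      by apply: ler_wpM2l; lra.
    apply: le_trans h3.
    have h4 : 128 * M ^+ 4 * P <= W x ^+ 3.
      apply: (@le_trans _ _ ((4 * M ^+ 2) ^+ 3)); last by apply: lerXn2r; rewrite ?nnegrE.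
      have : M ^+ 4 * (16 * P) <= M ^+ 4 * M ^+ 2 by apply: ler_wpM2l => //; exact: ltW.
      have -> : (4 * M ^+ 2) ^+ 3 = 64 * (M ^+ 4 * M ^+ 2) by ring.
      have : 0 <= M ^+ 4 * M ^+ 2 by rewrite mulr_ge0 // ltW.
      by lra.
    have h5 : W x ^+ 3 <= 128 * M ^+ 4 * D x.
      by move: W3; rewrite expr_div_n; lra.
    by lra.
  - by lra.
  - have -> : (128 * M ^+ 4)^-1 * (37 * M ^+ 2) ^+ 2 = 37 ^+ 2 / 128.
      by field; rewrite lt0r_neq0 //; lra.
    by rewrite expr2; lra.
(* The factor 9 is for [1 + x ^+ 2 <= 9 * (1 + X ^+ 2)] on the window [X - 1, X + 2]. *)
pose Z := 37 * (9 * w) ^+ 2.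
have Z0 : 0 < Z by rewrite mulr_gt0 // exprn_gt0 //; lra.
exists (2 * Z + P); first by lra.
move=> X.
pose q := (1 + X ^+ 2) ^+ 2.
have q1 : 1 <= q by rewrite /q exprn_ege1 //; have := sqr_ge0 X; lra.
have bd x : X - 1 <= x <= X + 2 -> 0 <= W x <= Z * q.
  move=> hx; apply/andP; split; first by have := hAY x; have := V0 x; rewrite /W; lra.
  apply: le_trans (growth x) _.
  have -> : Z * q = 37 * (w * (9 * (1 + X ^+ 2))) ^+ 2 by rewrite /Z /q; ring.
  rewrite ler_pM2l //; have sx := sqr_ge0 x; have sX := sqr_ge0 X.
  apply: lerXn2r; rewrite ?nnegrE; try by rewrite mulr_ge0; lra.
  apply: ler_wpM2l; first by lra.
  have h0 := sqr_ge0 (x - 2 * X).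
  have h1 : (x - X) ^+ 2 <= 2 ^+ 2.
    rewrite -(real_normK (num_real (x - X))).
    by apply: lerXn2r; rewrite ?nnegrE // ler_norml; lra.
  by rewrite !expr2 in h0 h1 sx sX *; lra.
have [x [hx dd]] := bounded_slow_point hW hdW bd.
exists x; split => //.
have := hdd x; have := D_ge0 x; rewrite -/(ddW x) -/q.
have : P <= P * q by rewrite ler_peMr // ltW.
by lra.
Qed.
End EnergyBound.

(** * Moments of the Hopf differential *)

Lemma cts_eq_at (R : realType) (f g : R -> R) a b c : a < b -> cts f -> cts g ->
  (forall y, a < y < b -> f y = g y) -> a <= c <= b -> f c = g c.
Proof.
move=> ab cf cg h hc; apply/eqP; rewrite -subr_eq0 -normr_le0 leNgt; apply/negP => n0.
have ch : cts (fun y => `|f y - g y|) by cts_tac.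
have : \forall t \near c, 0 < `|f t - g t| by move: n0; apply: cvgr_gt (ch c) _.
move=> [e /= e0 he].
suff [t [ht tc]] : exists t, a < t < b /\ `|c - t| < e.
  by have := he t tc; rewrite h // subrr normr0 ltxx.
have [ca|ca] := leP c ((a + b) / 2).
  pose d := Num.min (e / 2) ((b - a) / 4).
  have d0 : 0 < d by rewrite lt_min; lra.
  have d1 : d <= e / 2 by rewrite ge_min lexx.
  have d2 : d <= (b - a) / 4 by rewrite ge_min lexx orbT.
  by exists (c + d); split; [lra|rewrite ltr_norml; lra].
pose d := Num.min (e / 2) ((b - a) / 4).
have d0 : 0 < d by rewrite lt_min; lra.
have d1 : d <= e / 2 by rewrite ge_min lexx.
have d2 : d <= (b - a) / 4 by rewrite ge_min lexx orbT.
by exists (c - d); split; [lra|rewrite ltr_norml; lra].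
Qed.

(** For interior [y], [u] is its value at [x - 1] plus an integral of [ux]. Both sides are
    continuous in [y], so this persists on the boundary lines, where it can be differentiated in
    [x]. The boundary terms of [moment] need it. *)
Lemma der_closed (R : realType) (u ux : R -> R -> R) a b x y : a < b ->
  ct2 u -> ct2 ux ->
  (forall x y, a < y < b -> der (fun x => u x y) x (ux x y)) ->
  a <= y <= b -> der (fun x => u x y) x (ux x y).
Proof.
move=> ab cu cux hd hy.
pose x0 := x - 1.
have c2 : ct2 (fun y x => ux x y) by cts_tac.
have E x' : x0 <= x' -> u x' y = u x0 y + itg x0 x' (fun x => ux x y).
  move=> hx.
  have := @cts_eq_at R (fun y => u x' y) (fun y => u x0 y + itg x0 x' (fun x => ux x y)) a b y ab.
  apply; [cts_tac| |move=> z hz|exact: hy].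
    by refine (@ctD _ _ (u x0) _ _ _); [cts_tac|exact: cts_itg c2].
  rewrite (itg_FTC (F := fun x => u x z)) //; [ring|cts_tac|cts_tac|].
  by move=> t _; exact: hd.
apply: (@der_near _ _ (fun x' => u x0 y + itg x0 x' (fun x => ux x y))).
  exists 1 => //= t; rewrite /= ltr_norml => ht; apply: E; rewrite /x0; lra.
have x0x : x0 < x by rewrite /x0; lra.
have p := @primitive R (fun x => ux x y) x0 ltac:(cts_tac) x x0x.
by der_tac; rewrite add0r.
Qed.

Lemma exp_poly_decay (R : realType) (n A k : R) : 0 < n -> 0 <= k ->
  (forall t, 1 <= t -> k * expR (n * t) <= A * t ^+ 4) -> k = 0.
Proof.
move=> n0 k0 h; apply/le_anti; rewrite k0 andbT leNgt; apply/negP => kp.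
(* The term of degree 5 of the exponential series, with 120 = 5!, beats [t ^+ 4] by one factor
   [t]. *)
pose B := k * n ^+ 5 / 120.
have B0 : 0 < B by rewrite divr_gt0 // mulr_gt0 // exprn_gt0.
have H t : 1 <= t -> B * t <= A.
  move=> t1; have t0 : 0 < t by lra.
  have t4 : 0 < t ^+ 4 by rewrite exprn_gt0.
  rewrite -(ler_pM2r t4); apply: le_trans (h t t1).
  have nt : 0 <= n * t by rewrite mulr_ge0 ?ltW.
  have := expR_ge1Dxn 4 nt.
  rewrite (_ : 5`!%:R = 120 :> R) // => h2.
  have : k * ((n * t) ^+ 5 / 120) <= k * expR (n * t) by rewrite ler_pM2l //; lra.
  by apply: le_trans; rewrite /B exprMn; apply: eq_imp_le; field.
have := H (1 + `|A| / B).
have e1 : B * (1 + `|A| / B) = B + `|A| by rewrite mulrDr mulr1 mulrCA divff ?lt0r_neq0 // mulr1.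
rewrite e1 => h1.
have : B + `|A| <= A by apply: h1; rewrite lerDl divr_ge0 // ltW.
by have := ler_norm A; lra.
Qed.

Section Moments.
Variables (R : realType) (K c1 c2 : R) (u ux uy uxx uxy uyy : R -> R -> R).
Hypothesis S : strip_solution K c1 c2 u ux uy uxx uxy uyy.
Hypothesis K1 : `|K| <= 1.
Local Notation I := (@itg R 0 pi).
Local Notation Y := (slice_area u).
Local Notation E := (weighted_energy u uy).
Local Notation D := (energy ux uy).

Let cu : ct2 u := su S. Let cux : ct2 ux := sux S. Let cuy : ct2 uy := suy S.
Let cuxx : ct2 uxx := suxx S. Let cuxy : ct2 uxy := suxy S. Let cuyy : ct2 uyy := suyy S.

Section Moment.
Variable n : R.
Hypothesis sinn : sin (n * pi) = 0.

(** For the Hopf differential q, [moment] is the integral over (0, pi) of Re (q e^(i n y)), with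
    [uxx] eliminated by the equation. The terms in [uyy] and [uxy] have been integrated by parts:
    this produces the factor [n / 2] here and the boundary terms of [moment], and leaves a density
    that can be differentiated in [x]. Negative [n] is allowed. *)
Definition moment_density x y := - (n / 2) * (uy x y * sin (n * y) + ux x y * cos (n * y))
  - K / 2 * (expR (u x y) * cos (n * y))
  - 8^-1 * ((ux x y ^+ 2 - uy x y ^+ 2) * cos (n * y))
  - 4^-1 * (ux x y * uy x y * sin (n * y)).
Definition dmoment_density x y := - (n / 2) * (uxy x y * sin (n * y) + uxx x y * cos (n * y))
  - K / 2 * (expR (u x y) * ux x y * cos (n * y))
  - 4^-1 * ((ux x y * uxx x y - uy x y * uxy x y) * cos (n * y))
  - 4^-1 * ((uxx x y * uy x y + ux x y * uxy x y) * sin (n * y)).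

Definition moment x := 2^-1 * (c2 * expR (u x pi / 2) * cos (n * pi) + c1 * expR (u x 0 / 2))
  + I (moment_density x).
Definition dmoment x := 4^-1 * (c2 * expR (u x pi / 2) * ux x pi * cos (n * pi)
   + c1 * expR (u x 0 / 2) * ux x 0)
  + I (dmoment_density x).

Lemma der_moment x : der moment x (dmoment x).
Proof.
have pi1 : 0 <= (0 : R) <= pi by rewrite lexx pi_ge0.
have pi2 : 0 <= (pi : R) <= pi by rewrite lexx pi_ge0.
have d0 := der_closed x (pi_gt0 R) cu cux (sdux S) pi1.
have dpi := der_closed x (pi_gt0 R) cu cux (sdux S) pi2.
have dI : der (fun x => I (moment_density x)) x (I (dmoment_density x)).
  apply: der_itg; [rewrite /moment_density; cts_tac|rewrite /dmoment_density; cts_tac|].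
  move=> z y hy; have e1 := sdux S z hy; have e2 := sduxx S z hy; have e3 := sduyx S z hy.
  by rewrite /moment_density; der_tac; rewrite /dmoment_density /=; field.
rewrite /moment; der_tac.
by rewrite /dmoment; field.
Qed.

(** The relation q_x = - i q_y tested against e^(i n y), in a form without third derivatives:
    [dmoment_density + n * moment_density] is the [y]-derivative of [P]. Because [sin (n * pi) = 0]
    and [uy] is a multiple of e^(u/2) on the boundary lines, the boundary values of [P] combine with
    the differentiated boundary terms into those of [- n * moment]. *)
Lemma moment_ode x : dmoment x = - n * moment x.
Proof.
pose P y := - (n / 2) * (ux x y * sin (n * y)) + n / 2 * (uy x y * cos (n * y))
  + K / 2 * (expR (u x y) * sin (n * y)) + 4^-1 * (ux x y * uy x y * cos (n * y))
  + 8^-1 * ((uy x y ^+ 2 - ux x y ^+ 2) * sin (n * y)).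
have e : I (fun y => dmoment_density x y + n * moment_density x y) = P pi - P 0.
  have cj : cts (fun y => dmoment_density x y + n * moment_density x y) by rewrite /dmoment_density /moment_density; cts_tac.
  have cP : cts P by rewrite /P; cts_tac.
  apply: (itg_FTC (pi_ge0 R) cj cP).
  move=> y hy; have e1 := sduy S x hy; have e2 := sduxy S x hy; have e3 := sduyy S x hy.
  have hy' : 0 <= y <= pi by lra.
  have e4 : uxx x y = - uyy x y - 2 * K * expR (u x y) by have := spde S x hy'; lra.
  by rewrite /P; der_tac; rewrite /dmoment_density /moment_density e4 /=; field.
have -> : dmoment x = 4^-1 * (c2 * expR (u x pi / 2) * ux x pi * cos (n * pi)
   + c1 * expR (u x 0 / 2) * ux x 0) + (P pi - P 0) - n * I (moment_density x).
  rewrite -e itgD ?itgZ; try by rewrite /dmoment_density /moment_density; cts_tac.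
  by rewrite /dmoment; ring.
rewrite /P !sinn !mulr0 !sin0 !cos0 (sbc0 S) (sbcpi S) /moment.
by field.
Qed.

Lemma moment_exp x : expR (n * x) * moment x = moment 0.
Proof.
pose m x := expR (n * x) * moment x.
have dm x' : der m x' 0.
  have d := der_moment x'; rewrite /m; der_tac.
  by rewrite moment_ode; ring.
have cm := @der_cts R m (fun=> 0) dm.
rewrite -/(m x); have -> : moment 0 = m 0 by rewrite /m mulr0 expR0 mul1r.
have [x0|x0] := leP x 0.
  by apply: (@der_const R m (fun=> 0)).
by apply/esym/(@der_const R m (fun=> 0)) => //; exact: ltW.
Qed.

(** The integrated form is at most quadratic in the gradient, hence controlled by [D]; its
    exponentials are bounded through the slice area and [boundary_exp_bound]. *)
Lemma moment_bound : exists2 C, 0 < C & forall x, `|moment x| <= C * (1 + D x + E x).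
Proof.
have [G G0 hG] := boundary_exp_bound S K1; have [B B0 hB] := slice_area_ineq S K1.
exists ((`|c1| + `|c2|) * (1 + G) + `|n| * (1 + pi) + B + 1).
  have h1 : 0 <= (`|c1| + `|c2|) * (1 + G) by rewrite mulr_ge0 // ?addr_ge0 //; lra.
  have : 0 <= `|n| * (1 + pi) by rewrite mulr_ge0 // addr_ge0 ?pi_ge0.
  by lra.
move=> x; have D0 := energy_ge0 ux uy x; have E0 := weighted_energy_ge0 u uy x.
have [YB _] := hB x.
have pi1 : 0 <= (0 : R) <= pi by rewrite lexx pi_ge0.
have pi2 : 0 <= (pi : R) <= pi by rewrite lexx pi_ge0.
have gle (t : R) : expR t ^+ 2 <= G * (1 + E x) -> expR t <= (1 + G) * (1 + E x).
  by move=> h; have := sqr_ge0 (expR t - 1); rewrite !expr2 in h *; have := expR_ge0 t; lra.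
have g1 := gle _ (hG x 0 pi1); have g2 := gle _ (hG x pi pi2).
have b1 : `|c1 * expR (u x 0 / 2)| <= `|c1| * ((1 + G) * (1 + E x)).
  by rewrite normrM (ger0_norm (expR_ge0 _)) ler_wpM2l.
have b2 : `|c2 * expR (u x pi / 2) * cos (n * pi)| <= `|c2| * ((1 + G) * (1 + E x)).
  rewrite normrM -[leRHS]mulr1; apply: ler_pM => //; last exact: cos_max.
  by rewrite normrM (ger0_norm (expR_ge0 _)) ler_wpM2l.
have b3 : `|I (moment_density x)| <= `|n| * (pi + D x) + Y x + D x.
  apply: le_trans (itg_norm _ _ _) _; first by rewrite /moment_density; cts_tac.
  rewrite mulrDr -[X in `|n| * X](subr0 pi) -(@itg_cst R 0 pi `|n|) ?pi_ge0 //.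
  rewrite /slice_area /energy -itgZ -?itgD; try by cts_tac.
  apply: itg_le; [rewrite /moment_density; cts_tac|cts_tac|].
  move=> y _; rewrite /moment_density.
  set a := ux x y; set b := uy x y; set e := expR _; set s := sin _; set k := cos _.
  have e0 : 0 <= e := expR_ge0 _.
  have s1 : `|s| <= 1 := sin_max _. have k1 : `|k| <= 1 := cos_max _.
  have mul1 (p q r : R) : `|p| <= r -> `|q| <= 1 -> `|p * q| <= r.
    move=> h1 h2; rewrite normrM -[leRHS]mulr1; apply: ler_pM => //.
  have sq (z : R) : `|z| <= (1 + z ^+ 2) / 2.
    have := sqr_ge0 (`|z| - 1); rewrite -(real_normK (num_real z)) !expr2.
    by lra.
  have i1 : `|b * s| <= (1 + b ^+ 2) / 2 by apply: mul1.
  have i2 : `|a * k| <= (1 + a ^+ 2) / 2 by apply: mul1.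
  have a2 := sqr_ge0 a. have b2' := sqr_ge0 b.
  have i3 : `|e * k| <= e by apply: mul1 => //; rewrite ger0_norm.
  have i4 : `|(a ^+ 2 - b ^+ 2) * k| <= a ^+ 2 + b ^+ 2.
    by apply: mul1 => //; rewrite ler_norml; lra.
  have i5 : `|a * b * s| <= a ^+ 2 + b ^+ 2.
    apply: mul1 => //; rewrite ler_norml.
    by have := sqr_ge0 (a - b); have := sqr_ge0 (a + b); rewrite !expr2; lra.
  have i6 : `|K * (e * k)| <= e by rewrite mulrC; apply: le_trans i3; apply: mul1.
  have i7 : `|n * (b * s + a * k)| <= `|n| * (1 + (a ^+ 2 + b ^+ 2)).
    rewrite normrM ler_wpM2l //; apply: le_trans (ler_normD _ _) _.
    by lra.
  rewrite !ler_norml in i4 i5 i6 i7 *.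
  by lra.
have nD : 0 <= `|n| * pi * D x by rewrite mulr_ge0 // mulr_ge0 // pi_ge0.
have nE : 0 <= `|n| * (1 + pi) * E x by rewrite mulr_ge0 // mulr_ge0 // addr_ge0 ?pi_ge0.
have nn := normr_ge0 n.
have BE : 0 <= B * (D x + E x) by rewrite mulr_ge0 // ?addr_ge0 // ltW.
have cD : 0 <= (`|c1| + `|c2|) * (1 + G) * D x.
  by apply: mulr_ge0 => //; apply: mulr_ge0; [rewrite addr_ge0|lra].
rewrite !ler_norml /moment in b1 b2 b3 *.
have nY : 0 <= `|n| * (1 + pi) by rewrite mulr_ge0 // addr_ge0 ?pi_ge0.
by lra.
Qed.

(** At a good point [x] near [- sg n * t] the factor e^(n x) is at most e^(2|n| - |n| t), while the
    moment is of order [t ^+ 4] at most; their product is [moment 0] for every [t]. *)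
Lemma moment_eq0 : n != 0 -> moment 0 = 0.
Proof.
move=> n0; have [C C0 hC] := moment_bound; have [G G0 hG] := good_points S K1.
have n1 : 0 < `|n| by rewrite normr_gt0.
apply/eqP; rewrite -normr_eq0; apply/eqP.
apply: (@exp_poly_decay R `|n| (expR (2 * `|n|) * (C * (1 + 4 * G)))) => // t t1.
have [x [hx hD]] := hG (- (Num.sg n * t)).
have sn : (Num.sg n) ^+ 2 = 1 by rewrite sqr_sg n0.
have t20 := sqr_ge0 t.
have t2 : 1 + (- (Num.sg n * t)) ^+ 2 <= 2 * t ^+ 2.
  by rewrite sqrrN exprMn sn mul1r; have : 1 ^+ 2 <= t ^+ 2 by [apply: lerXn2r; rewrite ?nnegrE //; lra]; lra.
have t4 : (1 + (- (Num.sg n * t)) ^+ 2) ^+ 2 <= 4 * t ^+ 4.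
  rewrite (_ : 4 * t ^+ 4 = (2 * t ^+ 2) ^+ 2); last by ring.
  by apply: lerXn2r => //; rewrite nnegrE // ?addr_ge0 ?sqr_ge0 //; lra.
have nx : n * x <= 2 * `|n| - `|n| * t.
  have [np|nn] := ltP 0 n.
    by rewrite gtr0_norm // gtr0_sg // in hx *; rewrite -subr_ge0; nra.
  have nn' : n < 0 by rewrite lt_neqAle n0.
  by rewrite ltr0_norm // ltr0_sg // in hx *; rewrite -subr_ge0; nra.
have h1 : `|moment 0| <= expR (2 * `|n| - `|n| * t) * (C * (1 + G * (4 * t ^+ 4))).
  rewrite -(moment_exp x) normrM (ger0_norm (expR_ge0 _)).
  apply: ler_pM; rewrite ?expR_ge0 ?ler_expR //.
  apply: le_trans (hC x) _; apply: ler_wpM2l; first exact: ltW.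
  by have : G * (1 + (- (Num.sg n * t)) ^+ 2) ^+ 2 <= G * (4 * t ^+ 4); [rewrite ler_pM2l|lra].
have t40 : 1 <= t ^+ 4 by rewrite exprn_ege1.
rewrite expRB -mulrA in h1.
have e0 := expR_gt0 (`|n| * t).
rewrite -(ler_pM2r (_ : 0 < (expR (`|n| * t))^-1)) ?invr_gt0 //.
rewrite mulfK ?lt0r_neq0 //; apply: le_trans h1 _.
rewrite -!mulrA ler_pM2l ?expR_gt0 // mulrCA ler_pM2l //.
rewrite mulrC !mulrA ler_pM2r ?invr_gt0 //.
by lra.
Qed.

End Moment.
End Moments.

(** * Completeness of the cosine and sine systems on [0, pi] *)

Lemma geometric_unbounded (R : realType) (a b A : R) : 0 < a -> a < b ->
  (forall m, b ^+ m <= A * a ^+ m) -> False.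
Proof.
move=> a0 ab h.
pose r := (b - a) / a.
have r0 : 0 < r by rewrite divr_gt0 //; lra.
have H m : m%:R * r <= A.
  have am : 0 < a ^+ m by rewrite exprn_gt0.
  have : (1 + m%:R * r) * a ^+ m <= b ^+ m.
    elim: m {am} => [|m IH]; first by rewrite !expr0; lra.
    have am : 0 < a ^+ m by rewrite exprn_gt0.
    have b0 : 0 <= b by lra.
    apply: (@le_trans _ _ (b * ((1 + m%:R * r) * a ^+ m))); last first.
      by rewrite [leRHS]exprS; apply: ler_wpM2l.
    rewrite exprS mulrA mulrA ler_pM2r //.
    have -> : b = (1 + r) * a by rewrite /r mulrDl divfK ?lt0r_neq0 //; ring.
    rewrite mulrAC ler_pM2r // -natr1.
    have r0w := ltW r0; have : 0 <= m%:R * r * r by do 2 apply: mulr_ge0 => //.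
    by lra.
  have := h m => h1 h2; have : (1 + m%:R * r) * a ^+ m <= A * a ^+ m by lra.
  by rewrite ler_pM2r //; lra.
have A0 : 0 <= A by have := H 0%N; rewrite mul0r.
pose m := Num.bound (A / r).
have := archi_boundP (divr_ge0 A0 (ltW r0)); rewrite -/m.
by rewrite ltr_pdivrMr //; have := H m; lra.
Qed.

Section Peak.
Variable R : realType.
Local Notation I := (@itg R 0 pi).

(** If [w y0] were positive, the integral of [w * T ^+ m] would collect at least a multiple of
    [b ^+ m] close to [y0] and lose at most a multiple of [a ^+ m] at distance [d] or more, where
    [T <= a < b]. In the zone between, [w] is still positive and contributes nothing negative. For
    large [m] the sum could not vanish. *)
Lemma peak_nonpos (w T : R -> R) y0 : 0 < y0 < pi -> cts w -> cts T ->
  (forall y, 0 <= T y) -> T y0 = 1 -> (forall y, 0 <= y <= pi -> y != y0 -> T y < 1) ->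
  (forall m, I (fun y => w y * T y ^+ m) = 0) -> w y0 <= 0.
Proof.
move=> hy cw cT T0 T1 Tlt hI; rewrite leNgt; apply/negP => wpos.
pose e := w y0 / 2.
have e0 : 0 < e by rewrite /e; lra.
have : \forall t \near y0, e < w t.
  by apply: cvgr_gt (cw y0) _ _; rewrite /e; lra.
move=> [d' /= d'0 hd'].
pose d := Num.min (d' / 2) (Num.min (y0 / 2) ((pi - y0) / 2)).
have d0 : 0 < d by rewrite !lt_min; lra.
have d1 : d <= d' / 2 by rewrite ge_min lexx.
have d2 : d <= y0 / 2 by rewrite !ge_min lexx !orbT.
have d3 : d <= (pi - y0) / 2 by rewrite !ge_min lexx !orbT.
have we t : y0 - d <= t <= y0 + d -> e <= w t.
  by move=> ht; apply/ltW/hd'; rewrite /= ltr_norml; lra.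
have [|tl [htl ml]] := @cts_max _ 0 (y0 - d) T _ cT; first by lra.
have [|tr [htr mr]] := @cts_max _ (y0 + d) pi T _ cT; first by lra.
(* The entry 1 / 2 keeps [a] positive even if [T] vanishes away from [y0]. *)
pose a := Num.max (1 / 2) (Num.max (T tl) (T tr)).
have a0 : 0 < a by rewrite lt_max; lra.
have a1 : a < 1.
  rewrite !gt_max; apply/and3P; split; first by lra.
    by apply: Tlt; [lra|apply/eqP; lra].
  by apply: Tlt; [lra|apply/eqP; lra].
have al t : 0 <= t <= y0 - d -> T t <= a.
  by move=> /ml h; rewrite !le_max h orbT.
have ar t : y0 + d <= t <= pi -> T t <= a.
  by move=> /mr h; rewrite !le_max h !orbT.
pose b := (1 + a) / 2.
have : \forall t \near y0, b < T t.
  by apply: cvgr_gt (cT y0) _ _; rewrite T1 /b; lra.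
move=> [g' /= g'0 hg'].
pose g := Num.min (g' / 2) d.
have g0 : 0 < g by rewrite lt_min; lra.
have g1 : g <= g' / 2 by rewrite ge_min lexx.
have g2 : g <= d by rewrite ge_min lexx orbT.
have q1 : y0 - d <= y0 - g by rewrite lerD2l lerN2.
have q2 : y0 - g <= y0 + g by rewrite lerD2l; apply: (@le_trans _ _ 0); rewrite ?oppr_le0 ltW.
have q3 : y0 + g <= y0 + d by rewrite lerD2l.
have q4 : 0 <= y0 - d by lra.
have q5 : y0 + d <= pi by lra.
have q23 := le_trans q2 q3.
have q12 := le_trans q1 q2.
have q25 := le_trans q23 q5.
have q35 := le_trans q3 q5.
have Tb t : y0 - g <= t <= y0 + g -> b <= T t.
  by move=> ht; apply/ltW/hg'; rewrite /= ltr_norml; lra.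
have [M [M0 hM]] := @ct2_bounded R (fun _ y => w y) 0 0 0 pi ltac:(cts_tac).
have {}hM y : 0 <= y <= pi -> - M <= w y by move=> h; have := hM 0 y; rewrite lexx => /(_ isT h); rewrite ler_norml; lra.
apply: (@geometric_unbounded R a b (M * pi / (e * (2 * g)))) => //; first by rewrite /b; lra.
move=> m.
have eg : 0 < e * (2 * g) by rewrite mulr_gt0 //; lra.
rewrite mulrAC ler_pdivlMr //.
have b0 : 0 <= b by rewrite /b; lra.
have cf : cts (fun y => w y * T y ^+ m) by cts_tac.
have am : 0 <= a ^+ m by rewrite exprn_ge0 // ltW.
have out s t : 0 <= s -> s <= t -> t <= pi -> (forall y, s <= y <= t -> T y <= a) ->
    - (M * a ^+ m) * (t - s) <= itg s t (fun y => w y * T y ^+ m).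
  move=> s0 st tp ha; rewrite -itg_cst //; apply: itg_le => //; first by cts_tac.
  move=> y hys.
  have Tm : T y ^+ m <= a ^+ m by apply: lerXn2r; rewrite ?nnegrE ?(ltW a0) // ha.
  have Tm0 : 0 <= T y ^+ m by rewrite exprn_ge0.
  apply: (@le_trans _ _ (- M * T y ^+ m)).
    by rewrite !mulNr lerN2 ler_wpM2l.
  by apply: ler_wpM2r => //; apply: hM; lra.
have inn s t : y0 - d <= s -> s <= t -> t <= y0 + d ->
    0 <= itg s t (fun y => w y * T y ^+ m).
  move=> h1 h2 h3; apply: itg_ge0 => y hys; apply: mulr_ge0; last by rewrite exprn_ge0.
  move: hys => /andP[a1' a2]; apply: le_trans (we y _); first exact: ltW.
  by rewrite (le_trans h1 a1') (le_trans a2 h3).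
have cen : e * b ^+ m * (2 * g) <= itg (y0 - g) (y0 + g) (fun y => w y * T y ^+ m).
  rewrite (_ : 2 * g = (y0 + g) - (y0 - g)); last by ring.
  rewrite -itg_cst; last by lra.
  apply: itg_le => //; first by cts_tac.
  move=> y hys; apply: ler_pM; rewrite ?exprn_ge0 ?(ltW e0) //; first by apply: we; lra.
  by apply: lerXn2r; rewrite ?nnegrE // Tb.
have := hI m.
rewrite -(@itg_cat _ 0 (y0 - d) pi) //; last exact: le_trans q1 q25.
rewrite -(@itg_cat _ (y0 - d) (y0 - g) pi) //.
rewrite -(@itg_cat _ (y0 - g) (y0 + g) pi) //.
rewrite -(@itg_cat _ (y0 + g) (y0 + d) pi) //.
have o1 := out 0 (y0 - d) (lexx 0) q4 (le_trans q1 q25) al.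
have o2 := out (y0 + d) pi (le_trans q4 (le_trans q12 q3)) q5 (lexx _) ar.
have i1 := inn (y0 - d) (y0 - g) (lexx _) q1 (le_trans q2 q3).
have i2 := inn (y0 + g) (y0 + d) q12 q3 (lexx _).
have : 0 <= M * a ^+ m * d by rewrite !mulr_ge0 // ltW.
have -> : b ^+ m * (e * (2 * g)) = e * b ^+ m * (2 * g) by ring.
have -> : M * pi * a ^+ m = M * a ^+ m * (y0 - d - 0) + M * a ^+ m * (pi - (y0 + d)) + 2 * (M * a ^+ m * d).
  by ring.
rewrite !mulNr in o1 o2.
move: (itg (y0 - g) (y0 + g) _) (itg 0 (y0 - d) _) (itg (y0 + d) pi _) cen o1 o2 => j1 j2 j3 cen o1 o2.
move: (itg (y0 - d) (y0 - g) _) (itg (y0 + g) (y0 + d) _) i1 i2 => j4 j5 i1 i2.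
move: cen o1 o2 i1 i2; clear.
move: (M * a ^+ m * (y0 - d - 0)) (M * a ^+ m * (pi - (y0 + d))) => p1 p2.
move: (M * a ^+ m * d) (e * b ^+ m * (2 * g)) => p3 p4.
by lra.
Qed.

(** For each [y0] the trigonometric polynomial [T = 1 - (cos y - cos y0)^2 / 4] has values in [0, 1]
    and equals 1 on [0, pi] only at [y0], as cos is injective there. All its powers are orthogonal
    to [w], so [peak_nonpos] applies to [w] and to [- w]. *)
Lemma cos_complete (w : R -> R) : cts w ->
  (forall k : nat, I (fun y => w y * cos (k%:R * y)) = 0) ->
  forall y, 0 < y < pi -> w y = 0.
Proof.
have key (w' : R -> R) : cts w' ->
  (forall k : nat, I (fun y => w' y * cos (k%:R * y)) = 0) ->
  forall y, 0 < y < pi -> w' y <= 0.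
  move=> cw hw y0 hy0.
  pose c := cos y0.
  pose T (y : R) := 1 - (cos y - c) ^+ 2 / 4.
  have cT : cts T by rewrite /T; cts_tac.
  (* All frequencies [k] are carried through the induction on [m], since multiplication by [cos y]
     shifts them by one. *)
  have hT (m k : nat) : I (fun y => w' y * T y ^+ m * cos (k%:R * y)) = 0.
    elim: m k => [|m IH] k.
      by rewrite -[RHS](hw k); apply: eq_itg => y _; rewrite expr0 mulr1.
    have step (h : R -> R) : cts h ->
        (forall k : nat, I (fun y => h y * cos (k%:R * y)) = 0) ->
        forall k : nat, I (fun y => h y * cos y * cos (k%:R * y)) = 0.
      move=> ch hh [|j].
        rewrite -[RHS](hh 1%N); apply: eq_itg => y _.
        by rewrite mul0r mul1r cos0 mulr1.
      have -> : I (fun y => h y * cos y * cos (j.+1%:R * y)) =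
          2^-1 * (I (fun y => h y * cos (j.+2%:R * y)) + I (fun y => h y * cos (j%:R * y))).
        rewrite -itgD -?itgZ; try by cts_tac.
        apply: eq_itg => y _.
        have -> : j.+2%:R * y = j.+1%:R * y + y by rewrite -(natr1 j.+1); ring.
        have -> : j%:R * y = j.+1%:R * y - y by rewrite -(natr1 j); ring.
        by rewrite cosD cosB; field.
      by rewrite !hh addr0 mulr0.
    pose h (y : R) := w' y * T y ^+ m.
    have ch : cts h by rewrite /h; cts_tac.
    have h1 := step h ch IH.
    have ch1 : cts (fun y => h y * cos y) by cts_tac.
    have h2 := step _ ch1 h1.
    have -> : I (fun y => w' y * T y ^+ m.+1 * cos (k%:R * y)) =
        (1 - c ^+ 2 / 4) * I (fun y => h y * cos (k%:R * y))
        + c / 2 * I (fun y => h y * cos y * cos (k%:R * y))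
        - 4^-1 * I (fun y => h y * cos y * cos y * cos (k%:R * y)).
      rewrite -!itgZ -?itgD -?itgB; try by cts_tac.
      by apply: eq_itg => y _; rewrite /h exprS {1}/T; field.
    by rewrite (IH k) h1 h2 !mulr0 addr0 subr0.
  apply: (@peak_nonpos w' T) => //.
  - move=> y; rewrite /T.
    have h1 := cos_le1 y; have h2 := cos_geN1 y; have h3 := cos_le1 y0; have h4 := cos_geN1 y0.
    have : (cos y - c) ^+ 2 <= 2 ^+ 2.
      rewrite -(real_normK (num_real (cos y - c))).
      by apply: lerXn2r; rewrite ?nnegrE // ler_norml /c; lra.
    by rewrite expr2; lra.
  - by rewrite /T subrr expr0n /=; lra.
  - move=> y hy yy0; rewrite /T.
    have : 0 < (cos y - c) ^+ 2.
      rewrite lt_neqAle sqr_ge0 andbT eq_sym expf_eq0 /= subr_eq0.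
      apply: contra yy0 => /eqP e; apply/eqP.
      by apply: (@cos_inj R) e; rewrite in_itv /=; lra.
    by lra.
  - move=> m; rewrite -[RHS](hT m 0%N); apply: eq_itg => y _.
    by rewrite mul0r cos0 mulr1.
move=> cw hw y hy; apply/le_anti; rewrite (key w cw hw y hy) /=.
rewrite -oppr_le0; apply: (key (fun y => - w y)) => //; first by cts_tac.
move=> k; have -> : I (fun y => - w y * cos (k%:R * y)) = - I (fun y => w y * cos (k%:R * y)).
  by rewrite -itgN; [apply: eq_itg => z _; rewrite mulNr|cts_tac].
by rewrite hw oppr0.
Qed.

Lemma sin_natpi (k : nat) : sin (k%:R * pi) = 0 :> R.
Proof.
elim: k => [|k IH]; first by rewrite mul0r sin0.
by rewrite -natr1 mulrDl mul1r sinD IH sinpi; ring.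
Qed.

(** By the product formulas [q * sin] has vanishing cosine moments, and [sin] is positive inside the
    interval. *)
Lemma sin_complete (q : R -> R) : cts q ->
  (forall k : nat, I (fun y => q y * sin (k%:R * y)) = 0) ->
  forall y, 0 < y < pi -> q y = 0.
Proof.
move=> cq hq y hy.
have := @cos_complete (fun y => q y * sin y) ltac:(cts_tac) _ y hy.
have s0 := sin_gt0_pi hy.
suff H k : I (fun y => q y * sin y * cos (k%:R * y)) = 0.
  by move=> /(_ H)/eqP; rewrite mulf_eq0 (gt_eqF s0) orbF => /eqP.
case: k => [|j].
  rewrite -[RHS](hq 1%N); apply: eq_itg => z _.
  by rewrite mul0r mul1r cos0 mulr1.
have -> : I (fun y => q y * sin y * cos (j.+1%:R * y)) =
    2^-1 * (I (fun y => q y * sin (j.+2%:R * y)) - I (fun y => q y * sin (j%:R * y))).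
  rewrite -itgB -?itgZ; try by cts_tac.
  apply: eq_itg => z _.
  have -> : j.+2%:R * z = j.+1%:R * z + z by rewrite -(natr1 j.+1); ring.
  have -> : j%:R * z = j.+1%:R * z - z by rewrite -(natr1 j); ring.
  by rewrite sinD sinB; field.
by rewrite !hq subrr mulr0.
Qed.
End Peak.

(** * Vanishing of the imaginary part of the Hopf differential *)

Section HopfReal.
Variables (R : realType) (K c1 c2 : R) (u ux uy uxx uxy uyy : R -> R -> R).
Hypothesis S : strip_solution K c1 c2 u ux uy uxx uxy uyy.
Hypothesis K1 : `|K| <= 1.
Local Notation I := (@itg R 0 pi).

Let cu : ct2 u := su S. Let cux : ct2 ux := sux S. Let cuy : ct2 uy := suy S.
Let cuxx : ct2 uxx := suxx S. Let cuxy : ct2 uxy := suxy S. Let cuyy : ct2 uyy := suyy S.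

Lemma moment0 (n x : R) : sin (n * pi) = 0 -> n != 0 ->
  moment K c1 c2 u ux uy n x = 0.
Proof.
move=> sn n0; have := moment_exp S sn x; rewrite (moment_eq0 S K1 sn n0) => /eqP.
by rewrite mulf_eq0 expR_eq0 => /eqP.
Qed.

(** Im q is [- 2^-1 * (uxy - 2^-1 * (ux * uy))]. The moments for [n] and [- n] differ by twice the
    integral of Im q sin (n y), the terms even in [n] cancelling. Undoing the integration by parts
    restores [uxy], so every sine moment of Im q vanishes. *)
Lemma hopf_real x y : 0 < y < pi -> uxy x y = 2^-1 * (ux x y * uy x y).
Proof.
move=> hy; apply/eqP; rewrite -subr_eq0; apply/eqP.
apply: (@sin_complete R (fun y => uxy x y - 2^-1 * (ux x y * uy x y))) hy; first by cts_tac.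
case=> [|j].
  rewrite (@eq_itg R 0 pi _ (fun=> 0)) ?itg_cst ?pi_ge0 ?mul0r // => z _.
  by rewrite mul0r sin0 mulr0.
set n : R := j.+1%:R.
have n0 : n != 0 by rewrite pnatr_eq0.
have sn : sin (n * pi) = 0 := sin_natpi R j.+1.
have snN : sin (- n * pi) = 0 by rewrite mulNr sinN sn oppr0.
have nN0 : - n != 0 by rewrite oppr_eq0.
have m1 := moment0 x sn n0; have m2 := moment0 x snN nN0.
have e : I (fun y => uxy x y * sin (n * y) + n * (ux x y * cos (n * y))) = 0.
  have := @itg_FTC R 0 pi (fun y => uxy x y * sin (n * y) + n * (ux x y * cos (n * y)))
    (fun y => ux x y * sin (n * y)) (pi_ge0 R) ltac:(cts_tac) ltac:(cts_tac).
  rewrite sn !mulr0 sin0 mulr0 subrr; apply => z hz.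
  by have h := sduxy S x hz; der_tac; ring.
have e2 : I (fun y => n * (ux x y * cos (n * y)) + 2^-1 * (ux x y * uy x y * sin (n * y))) = 0.
  have : I (moment_density K u ux uy (- n) x) - I (moment_density K u ux uy n x) = 0.
    move: m1 m2; rewrite /moment mulNr cosN; lra.
  rewrite -itgB; try by rewrite /moment_density; cts_tac.
  move=> e'; rewrite -[RHS]e'; apply: eq_itg => z _.
  by rewrite /moment_density !(mulNr n z) sinN cosN; field.
have : I (fun y => uxy x y * sin (n * y) + n * (ux x y * cos (n * y)))
  - I (fun y => n * (ux x y * cos (n * y)) + 2^-1 * (ux x y * uy x y * sin (n * y))) = 0.
  by rewrite e e2 subrr.
rewrite -itgB; try by cts_tac.
by move=> h; rewrite -[RHS]h; apply: eq_itg => z _; ring.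
Qed.

End HopfReal.

(** * Separation of variables *)

Section Separation.
Variables (R : realType) (K : R) (A A' A'' B B' B'' : R -> R).
Hypotheses (dA : forall x, der A x (A' x)) (dA' : forall x, der A' x (A'' x)).
Hypotheses (cB : cts B) (cB' : cts B') (cB'' : cts B'').
Hypotheses (dB : forall y : R, 0 < y < pi -> der B y (B' y))
           (dB' : forall y : R, 0 < y < pi -> der B' y (B'' y)).
Hypothesis pos : forall x y : R, 0 < y < pi -> 0 < A x + B y.
Hypothesis eqn : forall x y : R, 0 < y < pi ->
  (A x + B y) * (A'' x + B'' y) = K + A' x ^+ 2 + B' y ^+ 2.

(** At a fixed [y], [eqn] expresses [A''] through [A], [A'] and constants; thus [A] has a third
    derivative although none is assumed. *)
Let der_A'' x y : 0 < y < pi -> der A'' x (A' x * (A'' x - B'' y) / (A x + B y)).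
Proof.
move=> hy; have p0 z := lt0r_neq0 (pos z hy).
have E z : A'' z = (K + A' z ^+ 2 + B' y ^+ 2) * (A z + B y)^-1 - B'' y.
  by rewrite -eqn // mulrAC divff ?p0 // mul1r addrK.
rewrite (_ : A'' = fun z => (K + A' z ^+ 2 + B' y ^+ 2) * (A z + B y)^-1 - B'' y); last first.
  exact/funext.
have h1 : der (fun z => A z + B y) x (A' x) by der_tac; ring.
have h2 := derV (f := fun z => A z + B y) (p0 x) h1.
by der_tac; rewrite -E -eqn // /=; field; exact: p0.
Qed.

Let der_B'' x y : 0 < y < pi -> der B'' y (B' y * (B'' y - A'' x) / (A x + B y)).
Proof.
move=> hy; have p0 := lt0r_neq0 (pos x hy).
have h0 : (K + A' x ^+ 2 + B' y ^+ 2) * (A x + B y)^-1 = A'' x + B'' y.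
  by rewrite -eqn // mulrAC divff // mul1r.
apply: (@der_near _ _ (fun z => (K + A' x ^+ 2 + B' z ^+ 2) * (A x + B z)^-1 - A'' x)).
  pose e := Num.min y (pi - y).
  have e1 : e <= y by rewrite ge_min lexx.
  have e2 : e <= pi - y by rewrite ge_min lexx orbT.
  exists e; first by rewrite /= lt_min; lra.
  move=> z; rewrite /= ltr_norml => hz.
  have hz' : 0 < z < pi by lra.
  have pz := lt0r_neq0 (pos x hz').
  by rewrite -eqn // mulrAC divff // mul1r addrC addKr.
have hB := dB hy; have hB' := dB' hy.
have h1 : der (fun z => A x + B z) y (B' y) by der_tac; ring.
have h2 := derV (f := fun z => A x + B z) p0 h1.
der_tac; rewrite -eqn // /=; field; exact: p0.
Qed.

(** Differentiating [eqn] in [x] gives (A + B) A''' = A' (A'' - B''), which says that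
    [(A'' - B'') / (A + B)] does not depend on [x]; the analogous identity for [B'''] shows that it
    does not depend on [y]. The constant is [m]. *)
Lemma separation : exists m n : R, (forall x, A'' x = m * A x + n) /\
  (forall y : R, 0 < y < pi -> B'' y = - m * B y + n).
Proof.
pose q x y := (A'' x - B'' y) * (A x + B y)^-1.
pose h : R := pi / 2.
have hh : 0 < h < pi by have := pi_gt0 R; rewrite /h; lra.
have cA := der_cts dA; have cA'' := der_cts (fun x => der_A'' x hh).
have qx y : 0 < y < pi -> forall x x', x <= x' -> q x y = q x' y.
  move=> hy x x' xx; have p0 z := lt0r_neq0 (pos z hy).
  apply: (@der_const R (fun x => q x y) (fun=> 0)) => //.
    by rewrite /q; apply: ctM; [cts_tac|apply: ctV; [exact: p0|cts_tac]].
  move=> z _; have h1 : der (fun z => A z + B y) z (A' z) by der_tac; ring.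
  have h2 := derV (f := fun z => A z + B y) (p0 z) h1; have h3 := der_A'' z hy.
  by rewrite /q; der_tac; field; exact: p0.
have qy y y' : 0 < y -> y < y' -> y' < pi -> q 0 y = q 0 y'.
  move=> y0 yy yp.
  have s1 : 0 < y < pi by rewrite y0 (lt_trans yy).
  have s2 : 0 < y' < pi by rewrite yp (lt_trans y0).
  have p0 z : 0 < z < pi -> A 0 + B z != 0 by move=> hz; exact: lt0r_neq0 (pos 0 hz).
  pose q' z := (A'' 0 - B'' z) - q 0 y * (A 0 + B z).
  pose l z := q 0 z.
  have dl z : 0 < z < pi -> der l z 0.
    move=> hz; have hB := dB hz; have h1 : der (fun z => A 0 + B z) z (B' z) by der_tac; ring.
    have h2 := derV (f := fun z => A 0 + B z) (p0 z hz) h1; have h3 := der_B'' 0 hz.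
    by rewrite /l /q; der_tac; field; exact: p0.
  have cl : {within `[y, y'], continuous l}.
    apply: derivable_within_continuous => z; rewrite in_itv /= => hz.
    by have [] := dl z ltac:(lra).
  have [c] := @MVT_segment R l (fun=> 0) y y' (ltW yy)
    (fun z hz => dl z ltac:(move: hz; rewrite in_itv /=; lra)) cl.
  by move=> _; rewrite mul0r => /eqP; rewrite subr_eq0 => /eqP.
have Q x y : 0 < y < pi -> q x y = q 0 h.
  move=> hy; transitivity (q 0 y).
    by have [x0|x0] := leP x 0; [apply: qx|apply/esym/qx => //; exact: ltW].
  have [yh|hy'|->//] := ltgtP y h.
    by apply: qy => //; lra.
  by apply/esym/qy => //; lra.
pose m := q 0 h; pose n := B'' h + m * B h.
have E x y : 0 < y < pi -> A'' x - B'' y = m * (A x + B y).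
  by move=> hy; rewrite /m -(Q x y hy) /q divfK // (lt0r_neq0 (pos x hy)).
exists m, n; split.
  by move=> x; have := E x h hh; rewrite /n; lra.
by move=> y hy; have := E 0 y hy; have := E 0 h hh; rewrite /n; lra.
Qed.

End Separation.

(** * Linear second-order equations with constant coefficients *)

Section HarmonicODE.
Variable R : realType.
Implicit Types f : R -> R.

Lemma der_const_all f : (forall x, der f x 0) -> forall x, f x = f 0.
Proof.
move=> h x; have cf := @der_cts R f (fun=> 0) h.
have [x0|x0] := leP x 0; first exact: (@der_const R f (fun=> 0)).
by apply/esym/(@der_const R f (fun=> 0)) => //; exact: ltW.
Qed.

Lemma der_const_oo f a b : cts f -> (forall y, a < y < b -> der f y 0) ->
  forall y, a < y < b -> f y = f ((a + b) / 2).
Proof.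
move=> cf h y hy.
have [yh|hy'] := leP y ((a + b) / 2).
  by apply: (@der_const R f (fun=> 0)) => // z hz; apply: h; lra.
by apply/esym/(@der_const R f (fun=> 0)) => // [|z hz]; [exact: ltW|apply: h; lra].
Qed.

(** The combinations [f' + g f] and [f' - g f] satisfy first-order equations; multiplied by their
    integrating factors they are constant. *)
Lemma hyperbolic_ode (g : R) f (f' : R -> R) : 0 < g -> (forall x, der f x (f' x)) ->
  (forall x, der f' x (g ^+ 2 * f x)) ->
  exists a b, forall x, f x = a * expR (g * x) + b * expR (- (g * x)) /\
    f' x = g * (a * expR (g * x) - b * expR (- (g * x))).
Proof.
move=> g0 h1 h2.
pose p x := (f' x + g * f x) * expR (- (g * x)).
pose q x := (f' x - g * f x) * expR (g * x).
have dp x : der p x 0 by rewrite /p; der_tac; ring.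
have dq x : der q x 0 by rewrite /q; der_tac; ring.
have g1 := lt0r_neq0 g0.
have e x : expR (- (g * x)) * expR (g * x) = 1 by rewrite -expRD addNr expR0.
exists (p 0 / (2 * g)), (- q 0 / (2 * g)) => x.
have ep : f' x + g * f x = p 0 * expR (g * x).
  by rewrite -(der_const_all dp x) /p -mulrA e mulr1.
have eq : f' x - g * f x = q 0 * expR (- (g * x)).
  by rewrite -(der_const_all dq x) /q -mulrA (mulrC (expR _)) e mulr1.
have -> : p 0 / (2 * g) * expR (g * x) = (f' x + g * f x) / (2 * g) by rewrite ep; field.
have -> : - q 0 / (2 * g) * expR (- (g * x)) = - (f' x - g * f x) / (2 * g) by rewrite eq; field.
by split; field.
Qed.

(** The vector [(f, f' / g)], rotated by the angle [g * y], is constant. *)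
Lemma trigonometric_ode (g : R) f (f' : R -> R) a b : 0 < g -> cts f -> cts f' ->
  (forall y, a < y < b -> der f y (f' y)) ->
  (forall y, a < y < b -> der f' y (- g ^+ 2 * f y)) ->
  exists c d, forall y, a < y < b -> f y = c * cos (g * y) + d * sin (g * y) /\
    f' y = g * (d * cos (g * y) - c * sin (g * y)).
Proof.
move=> g0 cf cf' h1 h2; have g1 := lt0r_neq0 g0.
pose p y := f y * cos (g * y) - f' y * sin (g * y) / g.
pose q y := f y * sin (g * y) + f' y * cos (g * y) / g.
have dp y : a < y < b -> der p y 0.
  by move=> hy; have e1 := h1 y hy; have e2 := h2 y hy; rewrite /p; der_tac; field.
have dq y : a < y < b -> der q y 0.
  by move=> hy; have e1 := h1 y hy; have e2 := h2 y hy; rewrite /q; der_tac; field.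
have cp : cts p by rewrite /p; cts_tac.
have cq : cts q by rewrite /q; cts_tac.
exists (p ((a + b) / 2)), (q ((a + b) / 2)) => y hy.
rewrite -(der_const_oo cp dp hy) -(der_const_oo cq dq hy) /p /q.
have e := cos2Dsin2 (g * y).
split.
  by rewrite -[LHS]mulr1 -e; field.
by rewrite -[LHS]mulr1 -e; field.
Qed.

End HarmonicODE.

(** * Classification of the strip solutions *)

Section Classification.
Variables (R : realType) (K c1 c2 : R) (u ux uy uxx uxy uyy : R -> R -> R).
Hypothesis S : strip_solution K c1 c2 u ux uy uxx uxy uyy.
Hypothesis K1 : `|K| <= 1.
Local Notation I := (@itg R 0 pi).

Let cu : ct2 u := su S. Let cux : ct2 ux := sux S. Let cuy : ct2 uy := suy S.
Let cuxx : ct2 uxx := suxx S. Let cuxy : ct2 uxy := suxy S. Let cuyy : ct2 uyy := suyy S.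

(** The reciprocal of the conformal factor e^(u/2). Its mixed derivative is [f] times Im q, which is
    why [hopf_real] separates the variables. *)
Let f x y := expR (- 2^-1 * u x y).
Let fx x y := - 2^-1 * (ux x y * f x y).
Let fy x y := - 2^-1 * (uy x y * f x y).
Let fxx x y := (- 2^-1 * uxx x y + 4^-1 * ux x y ^+ 2) * f x y.
Let fyy x y := (- 2^-1 * uyy x y + 4^-1 * uy x y ^+ 2) * f x y.
Let f_gt0 x y : 0 < f x y. Proof. exact: expR_gt0. Qed.
Let cf : ct2 f. Proof. by rewrite /f; cts_tac. Qed.
Let cfy : ct2 fy. Proof. by rewrite /fy /f; cts_tac. Qed.
Let cfyy : ct2 fyy. Proof. by rewrite /fyy /f; cts_tac. Qed.

Let dfx x y : 0 < y < pi -> der (fun x => f x y) x (fx x y).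
Proof. by move=> hy; have h := sdux S x hy; rewrite /f; der_tac; rewrite /fx /f; ring. Qed.
Let dfy x y : 0 < y < pi -> der (fun y => f x y) y (fy x y).
Proof. by move=> hy; have h := sduy S x hy; rewrite /f; der_tac; rewrite /fy /f; ring. Qed.
Let dfxx x y : 0 < y < pi -> der (fun x => fx x y) x (fxx x y).
Proof.
move=> hy; have h := sduxx S x hy; have h' := dfx x hy.
by rewrite /fx; der_tac; rewrite /fxx /fx; field.
Qed.
Let dfyy x y : 0 < y < pi -> der (fun y => fy x y) y (fyy x y).
Proof.
move=> hy; have h := sduyy S x hy; have h' := dfy x hy.
by rewrite /fy; der_tac; rewrite /fyy /fy; field.
Qed.
Let dfxy x y : 0 < y < pi -> der (fun y => fx x y) y 0.
Proof.
move=> hy; have h := sduxy S x hy; have h' := dfy x hy.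
by rewrite /fx; der_tac; rewrite (hopf_real S K1 x hy) /fy; field.
Qed.

Let h : R := pi / 2.
Let hh : 0 < h < pi. Proof. by have := pi_gt0 R; rewrite /h; lra. Qed.

Let f_sep x y : 0 < y < pi -> f x y = f x h + (f 0 y - f 0 h).
Proof.
move=> hy.
have e x' : fx x' y = fx x' h.
  have cfx : cts (fx x') by rewrite /fx /f; cts_tac.
  by rewrite (der_const_oo cfx (fun z hz => dfxy x' hz) hy) add0r.
pose d x := f x y - f x h.
have dd x' : der d x' 0.
  have d1 := dfx x' hy; have d2 := dfx x' hh.
  by rewrite /d; der_tac; rewrite e; ring.
by have := der_const_all dd x; rewrite /d; lra.
Qed.

Let liouville x y : 0 < y < pi ->
  f x y * (fxx x y + fyy x y) = K + fx x y ^+ 2 + fy x y ^+ 2.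
Proof.
move=> hy; have hy' : 0 <= y <= pi by lra.
have e : expR (u x y) * f x y ^+ 2 = 1.
  rewrite -expRM_natl -expRD (_ : u x y + _ = 0) ?expR0 //.
  by rewrite mulrA mulrN divff ?mulN1r ?subrr // pnatr_eq0.
have p := spde S x hy'.
have -> : fxx x y + fyy x y = (K * expR (u x y) + 4^-1 * (ux x y ^+ 2 + uy x y ^+ 2)) * f x y.
  rewrite /fxx /fyy (_ : uxx x y = - uyy x y - 2 * K * expR (u x y)); last by lra.
  by field.
have -> : forall q, f x y * ((K * expR (u x y) + q) * f x y) =
    K * (expR (u x y) * f x y ^+ 2) + q * f x y ^+ 2 by move=> q; ring.
by rewrite e mulr1 /fx /fy; field.
Qed.

Let Y_lower F x : (forall y, 0 <= y <= pi -> f x y <= F) -> pi * F ^- 2 <= slice_area u x.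
Proof.
move=> hF.
have F0 : 0 < F by apply: lt_le_trans (f_gt0 x h) (hF h _); have := hh; lra.
rewrite -[X in X * _]subr0 mulrC -(@itg_cst R 0 pi) ?pi_ge0 //.
apply: itg_le; [cts_tac|cts_tac|] => y hy.
have -> : expR (u x y) = f x y ^- 2.
  rewrite -expRM_natl -expRN; congr expR.
  by rewrite mulrA mulrN divff ?mulN1r ?opprK // pnatr_eq0.
rewrite lef_pV2 ?posrE ?exprn_gt0 //.
by apply: lerXn2r; rewrite ?nnegrE ?(ltW F0) ?(ltW (f_gt0 x y)) // hF.
Qed.

Let cY : cts (slice_area u).
Proof. exact: der_cts (der_slice_area S). Qed.

(** An upper bound on [f] is a positive lower bound on e^u = f^(-2), hence on the slice area, and a
    half-infinite strip would have infinite area. *)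
Lemma unbounded_right F : ~ (forall x y, 0 <= x -> 0 <= y <= pi -> f x y <= F).
Proof.
move=> hF; have [M hM] := sarea S.
have F0 : 0 < F by apply: lt_le_trans (f_gt0 0 h) (hF 0 h _ _) => //; have := hh; lra.
pose k := pi * F ^- 2.
have k0 : 0 < k by rewrite mulr_gt0 ?pi_gt0 // invr_gt0 exprn_gt0.
pose b := `|M| / k + 1.
have b0 : 0 < b by rewrite /b; have : 0 <= `|M| / k by [rewrite divr_ge0 // ltW]; lra.
have : itg 0 b (fun _ => k) <= itg 0 b (slice_area u).
  apply: itg_le => //; first by cts_tac.
  by move=> x hx; apply: Y_lower => y hy; apply: hF => //; lra.
rewrite itg_cst ?(ltW b0) // subr0 mulrC /b mulrDl mul1r divfK ?lt0r_neq0 //.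
by have := hM 0 b b0; have := ler_norm M; rewrite /slice_area /b; lra.
Qed.

Lemma unbounded_left F : ~ (forall x y, x <= 0 -> 0 <= y <= pi -> f x y <= F).
Proof.
move=> hF; have [M hM] := sarea S.
have F0 : 0 < F by apply: lt_le_trans (f_gt0 0 h) (hF 0 h _ _) => //; have := hh; lra.
pose k := pi * F ^- 2.
have k0 : 0 < k by rewrite mulr_gt0 ?pi_gt0 // invr_gt0 exprn_gt0.
pose b := `|M| / k + 1.
have b0 : 0 < b by rewrite /b; have : 0 <= `|M| / k by [rewrite divr_ge0 // ltW]; lra.
have nb0 : - b < 0 by rewrite oppr_lt0.
have : itg (- b) 0 (fun _ => k) <= itg (- b) 0 (slice_area u).
  apply: itg_le => //; first by cts_tac.
  by move=> x hx; apply: Y_lower => y hy; apply: hF => //; lra.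
rewrite itg_cst ?(ltW nb0) // sub0r opprK mulrC /b mulrDl mul1r divfK ?lt0r_neq0 //.
by have := hM (- b) 0 nb0; have := ler_norm M; rewrite /slice_area /b; lra.
Qed.

Let f_closed (g : R -> R -> R) : ct2 g -> (forall x y, 0 < y < pi -> f x y = g x y) ->
  forall x y, 0 <= y <= pi -> f x y = g x y.
Proof.
move=> cg e x y hy.
by apply: (@cts_eq_at R (f x) (g x) 0 pi y (pi_gt0 R)) => //; [cts_tac|cts_tac|move=> z; exact: e].
Qed.

(** The sign of the separation constant [m] decides. If [m < 0] the part in [x] stays bounded,
    against finite area; [m > 0] gives exponentials in [x] and trigonometric functions in [y];
    [m = 0] gives quadratic polynomials. The sign conditions on the coefficients hold because [f] is
    unbounded towards both ends, and the relation with [K] is the Liouville equation at one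
    point. *)
Theorem strip_classification :
  (exists g a b c d, [/\ 0 < g, 0 < a, 0 < b, 4 * g ^+ 2 * (a * b) = K + g ^+ 2 * (c ^+ 2 + d ^+ 2) &
    forall x y, 0 <= y <= pi -> expR (- 2^-1 * u x y) =
      a * expR (g * x) + b * expR (- (g * x)) + c * cos (g * y) + d * sin (g * y)]) \/
  (exists n p q r, [/\ 0 < n, 2 * n * r = K + p ^+ 2 + q ^+ 2 &
    forall x y, 0 <= y <= pi -> expR (- 2^-1 * u x y) =
      n / 2 * (x ^+ 2 + y ^+ 2) + p * x + q * y + r]).
Proof.
pose A x := f x h. pose A' x := fx x h. pose A'' x := fxx x h.
pose B y := f 0 y - f 0 h. pose B' y := fy 0 y. pose B'' y := fyy 0 y.
have dA x : der A x (A' x) by exact: dfx.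
have dA' x : der A' x (A'' x) by exact: dfxx.
have cB : cts B by rewrite /B; cts_tac.
have cB' : cts B' by rewrite /B'; cts_tac.
have dB y : 0 < y < pi -> der B y (B' y).
  by move=> hy; have e := dfy 0 hy; rewrite /B; der_tac; rewrite /B'; ring.
have dB' y : 0 < y < pi -> der B' y (B'' y) by exact: dfyy.
have AB x y : 0 < y < pi -> f x y = A x + B y by exact: f_sep.
have fxA x y : 0 < y < pi -> fx x y = A' x.
  move=> hy; apply: (der_uniq (dfx x hy)).
  rewrite (_ : (fun x => f x y) = (fun x => A x + B y)); last by apply: funext => z; exact: AB.
  by have d := dA x; der_tac; ring.
have fxxA x y : 0 < y < pi -> fxx x y = A'' x.
  move=> hy; apply: (der_uniq (dfxx x hy)).
  rewrite (_ : (fun x => fx x y) = A'); last by apply: funext => z; exact: fxA.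
  exact: dA'.
have near_oo y (q : R -> Prop) : 0 < y < pi -> (forall z, 0 < z < pi -> q z) ->
    \forall z \near y, q z.
  move=> hy hq; pose e := Num.min y (pi - y).
  have e1 : e <= y by rewrite ge_min lexx.
  have e2 : e <= pi - y by rewrite ge_min lexx orbT.
  exists e; first by rewrite /= lt_min; lra.
  by move=> z; rewrite /= ltr_norml => hz; apply: hq; lra.
have fyB x y : 0 < y < pi -> fy x y = B' y.
  move=> hy; apply: (der_uniq (dfy x hy)).
  apply: (@der_near _ _ (fun y => A x + B y)).
    by apply: near_oo => // z; exact: AB.
  by have d := dB y hy; der_tac; ring.
have fyyB x y : 0 < y < pi -> fyy x y = B'' y.
  move=> hy; apply: (der_uniq (dfyy x hy)).
  apply: (@der_near _ _ B'); first by apply: near_oo => // z; exact: fyB.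
  exact: dB'.
have pos x y : 0 < y < pi -> 0 < A x + B y by move=> hy; rewrite -AB.
have eqn x y : 0 < y < pi -> (A x + B y) * (A'' x + B'' y) = K + A' x ^+ 2 + B' y ^+ 2.
  by move=> hy; rewrite -AB // -(fxxA x y) // -(fyyB x y) // -(fxA x y) // -(fyB x y) // liouville.
have [m [n [hA hB]]] := separation dA dA' dB dB' pos eqn.
have bdd (q : R -> R) : cts q -> exists F, forall y, 0 <= y <= pi -> q y <= F.
  by move=> cq; have [z [_ hz]] := cts_max (pi_ge0 R) cq; exists (q z).
have [m0|m0|m0] := ltgtP m 0.
- exfalso.
  pose a x := A x + n / m. pose b y := B y - n / m.
  have mn := ltr0_neq0 m0.
  (* First integral of [a'' = m * a]; as [m < 0] both summands are nonnegative, so it bounds [a]. *)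
  pose E x := A' x ^+ 2 - m * a x ^+ 2.
  have dE x : der E x 0.
    have d1 := dA x; have d2 := dA' x.
    by rewrite /E /a; der_tac; rewrite hA /=; field.
  have cb : cts b by rewrite /b; cts_tac.
  have [F hF] := bdd b cb.
  apply: (@unbounded_right (1 + E 0 / - m + F)) => x y x0 hy.
  have cg : ct2 (fun x y => a x + b y).
    by have cA := der_cts dA; rewrite /a; cts_tac.
  rewrite (@f_closed _ cg _ x y hy); last first.
    by move=> x' y' hy'; rewrite AB // /a /b; ring.
  apply: lerD; last exact: hF.
  have a2 : a x ^+ 2 <= E 0 / - m.
    rewrite ler_pdivlMr ?oppr_gt0 // -(der_const_all dE x) /E.
    by have := sqr_ge0 (A' x); lra.
  by have := sqr_ge0 (a x); have := sqr_ge0 (a x - 1); rewrite !expr2 in a2 *; lra.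
- left.
  pose g := Num.sqrt m.
  have g0 : 0 < g by rewrite sqrtr_gt0.
  have g2 : g ^+ 2 = m by rewrite sqr_sqrtr // ltW.
  have mn := lt0r_neq0 m0.
  (* The shifts by [n / m] make both equations homogeneous and cancel in the sum [A + B]. *)
  pose al x := A x + n / m. pose be y := B y - n / m.
  have dal x : der al x (A' x) by have d := dA x; rewrite /al; der_tac; ring.
  have dal' x : der A' x (g ^+ 2 * al x).
    by apply: (der_eq (dA' x)); rewrite hA g2 /al; field.
  have [a [b hab]] := hyperbolic_ode g0 dal dal'.
  have cbe : cts be by rewrite /be; cts_tac.
  have dbe y : 0 < y < pi -> der be y (B' y) by move=> hy; have d := dB y hy; rewrite /be; der_tac; ring.
  have dbe' y : 0 < y < pi -> der B' y (- g ^+ 2 * be y).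
    by move=> hy; apply: (der_eq (dB' y hy)); rewrite hB // g2 /be; field.
  have [c [d hcd]] := trigonometric_ode g0 cbe cB' dbe dbe'.
  pose G x y := a * expR (g * x) + b * expR (- (g * x)) + c * cos (g * y) + d * sin (g * y).
  have cG : ct2 G by rewrite /G; cts_tac.
  have fG x y : 0 <= y <= pi -> f x y = G x y.
    apply: (f_closed cG) => x' y' hy'; rewrite AB //.
    have [e1 _] := hab x'; have [e2 _] := hcd y' hy'.
    by move: e1 e2; rewrite /al /be /G; lra.
  have bnd y : c * cos (g * y) + d * sin (g * y) <= `|c| + `|d|.
    apply: lerD; apply: (le_trans (ler_norm _)); rewrite normrM ler_piMr //.
      exact: cos_max.
    exact: sin_max.
  exists g, a, b, c, d; split => //.
  (* With [a <= 0] every term of [G] would be bounded above for [x >= 0]. *)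
  + rewrite ltNge; apply/negP => a0.
    apply: (@unbounded_right (`|b| + `|c| + `|d|)) => x y x0 hy.
    rewrite fG // /G; have := bnd y.
    have : a * expR (g * x) <= 0 by rewrite mulr_le0_ge0 // expR_ge0.
    have : b * expR (- (g * x)) <= `|b|.
      apply: (le_trans (ler_norm _)); rewrite normrM ler_piMr // ger0_norm ?expR_ge0 //.
      by rewrite expR_le1 oppr_le0 mulr_ge0 // ltW.
    by lra.
  + rewrite ltNge; apply/negP => b0.
    apply: (@unbounded_left (`|a| + `|c| + `|d|)) => x y x0 hy.
    rewrite fG // /G; have := bnd y.
    have : b * expR (- (g * x)) <= 0 by rewrite mulr_le0_ge0 // expR_ge0.
    have : a * expR (g * x) <= `|a|.
      apply: (le_trans (ler_norm _)); rewrite normrM ler_piMr // ger0_norm ?expR_ge0 //.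
      by rewrite expR_le1 mulr_ge0_le0 // ltW.
    by lra.
  + have e := eqn 0 h hh.
    have [a1 a2] := hab 0; have [b1 b2] := hcd h hh.
    have e3 : A 0 + B h = al 0 + be h by rewrite /al /be; ring.
    have e4 : A'' 0 + B'' h = g ^+ 2 * (al 0 - be h).
      by rewrite hA hB // g2 /al /be; field.
    rewrite e3 e4 a1 a2 b1 b2 mulr0 oppr0 expR0 in e.
    have cs := cos2Dsin2 (g * h).
    have -> : K + g ^+ 2 * (c ^+ 2 + d ^+ 2) =
      K + g ^+ 2 * (c ^+ 2 + d ^+ 2) * (cos (g * h) ^+ 2 + sin (g * h) ^+ 2) by rewrite cs mulr1.
    by move: e; lra.
- right.
  have hA0 x : A'' x = n by rewrite hA m0 mul0r add0r.
  have hB0 y : 0 < y < pi -> B'' y = n by move=> hy; rewrite hB // m0 oppr0 mul0r add0r.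
  pose a1 x := A' x - n * x.
  have da1 x : der a1 x 0 by have d := dA' x; rewrite /a1; der_tac; rewrite hA0; ring.
  pose a0 x := A x - a1 0 * x - n / 2 * x ^+ 2.
  have da0 x : der a0 x 0.
    have d := dA x; rewrite /a0; der_tac.
    by rewrite -(der_const_all da1 x) /a1 /=; field.
  pose b1 y := B' y - n * y.
  have cb1 : cts b1 by rewrite /b1; cts_tac.
  have db1 y : 0 < y < pi -> der b1 y 0.
    by move=> hy; have d := dB' y hy; rewrite /b1; der_tac; rewrite hB0 //; ring.
  pose q := b1 ((0 + pi) / 2).
  pose b0 y := B y - q * y - n / 2 * y ^+ 2.
  have cb0 : cts b0 by rewrite /b0; cts_tac.
  have db0 y : 0 < y < pi -> der b0 y 0.
    move=> hy; have d := dB y hy; rewrite /b0; der_tac.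
    by rewrite /q -(der_const_oo cb1 db1 hy) /b1 /=; field.
  pose p := a1 0. pose r := a0 0 + b0 ((0 + pi) / 2).
  pose G x y := n / 2 * (x ^+ 2 + y ^+ 2) + p * x + q * y + r.
  have cG : ct2 G by rewrite /G; cts_tac.
  have fG x y : 0 <= y <= pi -> f x y = G x y.
    apply: (f_closed cG) => x' y' hy'; rewrite AB // /G /r.
    rewrite -(der_const_all da0 x') -(der_const_oo cb0 db0 hy') /a0 /b0 /p.
    by ring.
  have qb y : 0 <= y <= pi -> q * y <= `|q| * pi.
    move=> hy; apply: (@le_trans _ _ (`|q| * y)).
      by apply: ler_wpM2r; [lra|exact: ler_norm].
    by apply: ler_wpM2l => //; lra.
  exists n, p, q, r; split => //.
  + rewrite ltNge; apply/negP => n0.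
    have nxy x y : n / 2 * (x ^+ 2 + y ^+ 2) <= 0.
      by apply: mulr_le0_ge0; [lra|rewrite addr_ge0 // sqr_ge0].
    (* With [n <= 0] only [p * x] could be large, and it is bounded above towards one of the two
       ends. *)
    have [p0|p0] := leP p 0.
      apply: (@unbounded_right (`|q| * pi + r)) => x y x0 hy.
      rewrite fG // /G; have := nxy x y; have := qb y hy.
      have : p * x <= 0 by apply: mulr_le0_ge0.
      by lra.
    apply: (@unbounded_left (`|q| * pi + r)) => x y x0 hy.
    rewrite fG // /G; have := nxy x y; have := qb y hy.
    have : p * x <= 0 by apply: mulr_ge0_le0 => //; exact: ltW.
    by lra.
  + have e := eqn 0 h hh.
    have hc : 0 <= h <= pi by have := hh; lra.
    rewrite hA0 hB0 // -AB // fG // /G in e.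
    have e1 : A' 0 = p by rewrite /p /a1; ring.
    have e2 : B' h = q + n * h.
      by rewrite /q -(der_const_oo cb1 db1 hh) /b1; ring.
    rewrite e1 e2 in e.
    by move: e; lra.
Qed.

End Classification.

(** * Area in polar coordinates *)

Section Plane.
Variable R : realType.
Notation mu := (@lebesgue_measure R).

(** An open set is the countable union of the open squares contained in it with rational centre and
    half-side 1 / (n + 1); [F] is empty for the squares that are not contained in it. *)
Lemma open2_measurable (A : set (R * R)) : open A -> measurable A.
Proof.
move=> oA.
pose sq (c1 c2 : R) (n : nat) : set (R * R) :=
  `]c1 - n.+1%:R^-1, c1 + n.+1%:R^-1[ `*` `]c2 - n.+1%:R^-1, c2 + n.+1%:R^-1[.
pose F (q1 q2 : rat) (n : nat) : set (R * R) :=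
  if `[< sq (ratr q1) (ratr q2) n `<=` A >] then sq (ratr q1) (ratr q2) n else set0.
have -> : A = \bigcup_q1 \bigcup_q2 \bigcup_n F q1 q2 n.
  apply/seteqP; split=> [p Ap|p [q1 _ [q2 _ [n _]]]]; last first.
    by rewrite /F; case: asboolP => // h; exact: h.
  have : nbhs p A by apply: open_nbhs_nbhs; split.
  move/nbhs_ballP => [e /= e0 he].
  pose n := Num.bound (2 / e); pose r : R := n.+1%:R^-1.
  have r0 : 0 < r by rewrite invr_gt0.
  have re : 2 * r < e.
    have : 2 / e < n.+1%:R.
      by apply: lt_trans (archi_boundP (divr_ge0 _ (ltW e0))) _ => //; rewrite ltr_nat.
    by rewrite ltr_pdivrMr // -ltr_pdivrMl // mulrC.
  have rat_near (x : R) : exists q : rat, `|x - ratr q| < r.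
    have [|q] := @rat_in_itvoo R (x - r) (x + r); first by lra.
    by rewrite in_itv /= => hq; exists q; rewrite ltr_norml; lra.
  have [q1 h1] := rat_near p.1; have [q2 h2] := rat_near p.2.
  exists q1 => //; exists q2 => //; exists n => //; rewrite /F.
  rewrite !ltr_norml in h1 h2.
  case: asboolP => [_|[]].
    by split; rewrite /= in_itv /= -/r; lra.
  move=> [z1 z2] [/=]; rewrite !in_itv /= -/r => k1 k2; apply: he.
  by split; rewrite /ball /= ltr_norml; lra.
apply: bigcupT_measurable_rat => q1; apply: bigcupT_measurable_rat => q2.
apply: bigcup_measurable => n _; rewrite /F.
by case: asboolP => // _; apply: measurableX; exact: measurable_itv.
Qed.

Lemma open2_measurable_fun (D : set (R * R)) (f : R * R -> R) : open D ->
  (forall p, D p -> {for p, continuous f}) -> measurable_fun D f.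
Proof.
move=> oD cf mD; apply: (measurability _ (RGenOInfty.measurableE R)) => //.
move=> _ [_ [x ->] <-]; apply: open2_measurable.
rewrite openE => p [Dp /=]; rewrite in_itv /= andbT => xp.
apply: filterI; first exact: open_nbhs_nbhs.
have : \forall t \near p, x < f t by move: xp; apply: cvgr_gt (cf p Dp) _.
by apply: filterS => t /=; rewrite in_itv /= andbT.
Qed.

Lemma box_integral (G : R -> R -> R) a b c d : ct2 G -> (forall x y, 0 <= G x y) ->
  (\int[(mu \x mu)%E]_(p in `[a, b] `*` `[c, d]) (G p.1 p.2)%:E)%E
    = (itg a b (fun x => itg c d (G x)))%:E /\
  (\int[(mu \x mu)%E]_(p in `[a, b] `*` `[c, d]) (G p.1 p.2)%:E)%E
    = (itg c d (fun y => itg a b (fun x => G x y)))%:E.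
Proof.
move=> cG G0.
have mB : measurable (`[a, b] `*` `[c, d] : set (R * R)).
  by apply: measurableX; exact: measurable_itv.
pose F : R * R -> \bar R := (fun p => (G p.1 p.2)%:E) \_ (`[a, b] `*` `[c, d]).
have mF : measurable_fun setT F.
  apply/(measurable_restrictT _ mB); apply/measurable_EFinP.
  apply: (@measurable_funS _ _ _ _ setT) => //.
  by apply: open2_measurable_fun => [|p _]; [exact: openT|exact: cG].
have F0 p : (0 <= F p)%E by rewrite /F /patch; case: ifP => // _; rewrite lee_fin.
have cG' : ct2 (fun y x => G x y) by cts_tac.
have fin (h : R -> R) s t : cts h ->
    (\int[mu]_(y in `[s, t]) (h y)%:E)%E = (itg s t h)%:E.
  move=> ch; rewrite /itg /Rintegral fineK //.
  exact: integrable_fin_num (cts_integrable s t ch).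
have FE x y : F (x, y) = if (a <= x <= b) && (c <= y <= d) then (G x y)%:E else 0%E.
  rewrite /F patchE; congr (if _ then _ else _).
  apply/idP/idP; rewrite inE /=; first by case; rewrite !in_itv /= => -> ->.
  by move=> /andP[hx hy]; split; rewrite /= in_itv.
rewrite integral_mkcond -/F; split.
  rewrite (@fubini_tonelli1 _ _ _ _ R mu mu F mF F0) -fin; last exact: cts_itg.
  rewrite [RHS]integral_mkcond; apply: eq_integral => x _.
  rewrite /fubini_F patchE mem_setE in_itv /=.
  under eq_integral do rewrite FE.
  case: (a <= x <= b) => /=; last by rewrite integral0.
  rewrite -fin; last by cts_tac.
  rewrite [RHS]integral_mkcond; apply: eq_integral => y _.
  by rewrite patchE mem_setE in_itv.
rewrite (@fubini_tonelli2 _ _ _ _ R mu mu F mF F0) -fin; last exact: (@cts_itg R (fun y x => G x y)).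
rewrite [RHS]integral_mkcond; apply: eq_integral => y _.
rewrite /fubini_G patchE mem_setE in_itv /=.
under eq_integral do rewrite FE.
case: (c <= y <= d) => /=; last first.
  by under eq_integral do rewrite andbF; rewrite integral0.
under eq_integral do rewrite andbT.
rewrite -fin; last by cts_tac.
rewrite [RHS]integral_mkcond; apply: eq_integral => x _.
by rewrite patchE mem_setE in_itv.
Qed.

Lemma itg_swap (G : R -> R -> R) a b c d : ct2 G -> (forall x y, 0 <= G x y) ->
  itg a b (fun x => itg c d (G x)) = itg c d (fun y => itg a b (fun x => G x y)).
Proof.
by move=> cG G0; have [e1 e2] := box_integral a b c d cG G0; move: e2; rewrite e1 => -[].
Qed.

(** A primitive of [w], started at [c] below the range of [p], is composed with [p]. The form with
    two integrals from [c] serves decreasing and increasing [p] alike. *)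
Lemma itg_subst c (w p dp : R -> R) a b : a <= b -> cts w -> cts p -> cts dp ->
  (forall y, c < p y) -> (forall y, a < y < b -> der p y (dp y)) ->
  itg a b (fun y => w (p y) * dp y) = itg c (p b) w - itg c (p a) w.
Proof.
move=> ab cw cp cdp hc hp.
rewrite (@itg_FTC R a b _ (fun y => itg c (p y) w)) //; first by cts_tac.
  move=> y; have h := der_cont (primitive cw (hc y)).
  by apply: (@continuous_comp _ _ _ p (fun s => itg c s w)); [exact: cp|exact: h].
by move=> y hy; have h := der_comp (hp y hy) (primitive cw (hc y)).
Qed.

Lemma ct_max (T : topologicalType) (f g : T -> R) :
  cts f -> cts g -> cts (fun t => Num.max (f t) (g t)).
Proof.
move=> cf cg; rewrite (_ : (fun t => _) = fun t => (f t + g t + `|f t - g t|) * 2^-1).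
  by cts_tac.
by apply: funext => t; rewrite maxr_absE.
Qed.

(** The difference is 2 cos ((y + e) / 2) sin ((y - e) / 2), with both factors nonnegative. *)
Lemma sin_ge_edge (e y : R) : 0 < e -> e <= y <= pi - e -> sin e <= sin y.
Proof.
move=> e0 hy; pose A : R := (y + e) / 2; pose B : R := (y - e) / 2.
have -> : y = A + B by rewrite /A /B; field.
have -> : e = A - B by rewrite /A /B; field.
rewrite sinB sinD -subr_ge0.
have cA : 0 <= cos A by apply: cos_ge0_pihalf; rewrite /A; lra.
have sB : 0 <= sin B by apply: sin_ge0_pi; rewrite /B; lra.
have -> : sin A * cos B + cos A * sin B - (sin A * cos B - cos A * sin B) = 2 * (cos A * sin B).
  by ring.
by rewrite mulr_ge0 // mulr_ge0.
Qed.

Lemma open_uhp : open (@uhp R).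
Proof.
rewrite openE => p p0.
have : \forall t \near p, 0 < t.2 by move: p0; apply: cvgr_gt (@ct_snd R p) _.
exact.
Qed.

(* Polar coordinates in two steps: [s = t cot y] at fixed [t], then [t = e^x sin y] at fixed
   [y]; all integrands stay continuous because [t] and [sin y] are bounded away from [0]. *)
Lemma polar_area (v : R * R -> R) (u : R -> R -> R) a b e :
  (forall p, uhp p -> {for p, continuous v}) -> ct2 u ->
  (forall x y, 0 < y < pi -> u x y = v (expR x * cos y, expR x * sin y) + 2 * x) ->
  a < b -> 0 < e < pi / 2 ->
  (\int[(mu \x mu)%E]_(p in @uhp R) (expR (v p))%:E < +oo)%E ->
  itg e (pi - e) (fun y => itg a b (fun x => expR (u x y))) <=
  fine (\int[(mu \x mu)%E]_(p in @uhp R) (expR (v p))%:E)%E.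
Proof.
move=> cv cu uv ab he fin.
have e0 : 0 < e by lra.
have ep : e <= pi - e by lra.
have se : 0 < sin e by apply: sin_gt0_pi; lra.
pose t1 := expR a * sin e; pose t2 := expR b.
have t10 : 0 < t1 by rewrite mulr_gt0 ?expR_gt0.
have t12 : t1 <= t2.
  by rewrite /t1 /t2 -[leRHS]mulr1; apply: ler_pM;
    rewrite ?expR_ge0 ?ler_expR ?sin_le1 // ltW.
(* Truncating the height from below keeps the argument in the open half-plane, so that [W] is
   continuous on the whole plane. Nothing changes for [t >= t1], the least height in the sector
   considered. *)
pose m (t : R) := Num.max t1 t.
pose W s t := expR (v (s, m t)).
have cm : cts m by apply: ct_max; cts_tac.
have m0 t : 0 < m t by rewrite /m lt_max t10.
have mE t : t1 <= t -> m t = t by move=> h; apply/max_idPr.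
have cW : ct2 W.
  move=> [s t]; rewrite /W /=.
  apply: (@continuous_comp _ _ _ (fun p : R * R => v (p.1, m p.2)) expR); last exact: continuous_expR.
  have H : {for (s, m t), continuous (fun p : R * R => v (p.1, p.2))}.
    rewrite (_ : (fun p => _) = v); first by apply: cv; exact: m0.
    by apply: funext => -[].
  have cmt : {for (s, t), continuous (fun p : R * R => m p.2)}.
    by apply: (@ct_comp _ _ m (fun p : R * R => p.2)); [exact: cm|exact: ct_snd].
  exact: (cvg_comp2 (h := fun s t => v (s, t)) (@ct_fst R (s, t)) cmt H).
have W0 s t : 0 <= W s t by exact: expR_ge0.
have cWt t : cts (fun s => W s t) by cts_tac.
(* [|t cot y|] is at most [t2 / sin e]; the added 1 makes the inequality strict. *)
pose L := t2 / sin e + 1.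
have mu_uhp : measurable (@uhp R) := open2_measurable open_uhp.
have step0 : itg t1 t2 (fun t => itg (- L) L (fun s => W s t)) <=
    fine (\int[(mu \x mu)%E]_(p in @uhp R) (expR (v p))%:E)%E.
  have finA : (\int[(mu \x mu)%E]_(p in @uhp R) (expR (v p))%:E)%E \is a fin_num.
    rewrite ge0_fin_numE; first exact: fin.
    by apply: integral_ge0 => p _; rewrite lee_fin expR_ge0.
  rewrite -lee_fin (fineK finA).
  have [_ <-] := box_integral (- L) L t1 t2 cW W0.
  apply: (@le_trans _ _ (\int[(mu \x mu)%E]_(p in `[(- L)%R, L] `*` `[t1, t2]) (expR (v p))%:E)%E).
    rewrite le_eqVlt; apply/orP; left; apply/eqP; apply: eq_integral => -[s t]; rewrite inE /= => -[_ /=].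
    by rewrite in_itv /= => ht; rewrite /W mE //; lra.
  apply: ge0_subset_integral => //.
  - by apply: measurableX; exact: measurable_itv.
  - apply/measurable_EFinP.
    apply: (open2_measurable_fun open_uhp) => p p0.
    apply: (@continuous_comp _ _ _ v expR); first exact: cv.
    exact: continuous_expR.
  - by move=> [s t] [_ /=]; rewrite in_itv /uhp /= => ht; lra.
pose sg y := Num.max (sin e) (sin y).
have csg : cts sg by refine (@ct_max _ (fun=> sin e) (fun y => sin y) _ _); cts_tac.
have sg0 y : 0 < sg y by rewrite /sg lt_max se.
have sgn y : sg y != 0 := lt0r_neq0 (sg0 y).
have sgE y : e <= y <= pi - e -> sg y = sin y.
  by move=> hy; apply/max_idPr/sin_ge_edge.
pose sgi y := (sg y)^-1.
have csgi : cts sgi by apply: ctV.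
pose p t y := m t * (cos y * sgi y).
pose h t y := W (p t y) t * (m t * sgi y ^+ 2).
have cp : ct2 p by rewrite /p; cts_tac.
have cp' t : cts (p t) by cts_tac.
have ch : ct2 h by rewrite /h; cts_tac.
have h0 t y : 0 <= h t y.
  by rewrite /h mulr_ge0 ?expR_ge0 // mulr_ge0 ?(ltW (m0 t)) // sqr_ge0.
have step1 t : t1 <= t <= t2 -> itg e (pi - e) (h t) <= itg (- L) L (fun s => W s t).
  move=> ht.
  have pL y : `|p t y| < L.
    rewrite /p normrM (gtr0_norm (m0 t)) mE; last by lra.
    have : t * `|cos y * sgi y| <= t2 * (sin e)^-1.
      apply: ler_pM => //; [lra|lra|].
      rewrite normrM -[leRHS]mul1r; apply: ler_pM => //; first exact: cos_max.
      rewrite /sgi ger0_norm ?invr_ge0 ?(ltW (sg0 y)) // lef_pV2 ?posrE //.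
      by rewrite /sg le_max lexx.
    by rewrite /L; lra.
  have dp y : e < y < pi - e -> der (p t) y (- (m t * sgi y ^+ 2)).
    move=> hy; have hyy : e <= y <= pi - e by lra.
    have sy : 0 < sin y by apply: lt_le_trans se (sin_ge_edge e0 hyy).
    apply: (@der_near _ _ (fun y => m t * (cos y * (sin y)^-1))).
      have : \forall z \near y, e < z < pi - e.
        have i1 : e < y by lra.
        have i2 : y < pi - e by lra.
        near=> z; apply/andP; split; near: z; [exact: lt_nbhsr|exact: lt_nbhsl].
      apply: filterS => z hz; rewrite /p /sgi sgE //; lra.
    have d1 : der (fun y => sin y) y (cos y) by der_tac; ring.
    have d2 := derV (f := fun y => sin y) (lt0r_neq0 sy) d1.
    der_tac; rewrite /sgi (sgE y hyy) mulr1.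
    have := cos2Dsin2 y; set si := sin y; set co := cos y => e1.
    have -> : m t * si^-1 ^+ 2 = m t * ((co ^+ 2 + si ^+ 2) * si^-1 ^+ 2) by rewrite e1 mul1r.
    by field; exact: lt0r_neq0.
  have := @itg_subst (- L) (fun s => W s t) (p t) (fun y => - (m t * sgi y ^+ 2)) e (pi - e)
    ep (cWt t) (cp' t) ltac:(cts_tac) _ dp.
  have -> : itg e (pi - e) (fun y => W (p t y) t * - (m t * sgi y ^+ 2)) = - itg e (pi - e) (h t).
    by rewrite -itgN; [apply: eq_itg => y _; rewrite mulrN|cts_tac].
  move=> /(_ _) h1.
  have {}h1 := h1 (fun y => ltac:(by have := pL y; rewrite ltr_norml; lra)).
  have pe := pL e; have pp := pL (pi - e); rewrite !ltr_norml in pe pp.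
  have : itg (- L) (p t e) (fun s => W s t) <= itg (- L) L (fun s => W s t).
    by apply: itg_sub => //; lra.
  have : 0 <= itg (- L) (p t (pi - e)) (fun s => W s t) by apply: itg_ge0.
  by lra.
have step2 : itg e (pi - e) (fun y => itg t1 t2 (fun t => h t y)) <=
    fine (\int[(mu \x mu)%E]_(p in @uhp R) (expR (v p))%:E)%E.
  rewrite -(@itg_swap h t1 t2 e (pi - e) ch h0); apply: (le_trans _ step0).
  have ch' : ct2 (fun t s => W s t) by cts_tac.
  apply: itg_le; [exact: cts_itg|exact: (@cts_itg R (fun t s => W s t))|exact: step1].
apply: le_trans step2.
apply: itg_le.
- by apply: cts_itg; cts_tac.
- by apply: cts_itg; cts_tac.
move=> y hy; have hy' : 0 < y < pi by lra.
have sy : 0 < sin y by apply: sin_gt0_pi.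
pose q x := expR x * sin y.
have cq : cts q by rewrite /q; cts_tac.
have dq x : der q x (q x) by rewrite /q; der_tac; ring.
have q0 x : 0 < q x by rewrite mulr_gt0 ?expR_gt0.
have t1q x : a <= x -> t1 <= q x.
  move=> ax; rewrite /t1 /q; apply: ler_pM; rewrite ?expR_ge0 ?(ltW se) ?ler_expR //.
  exact: sin_ge_edge.
have cw : cts (fun t => h t y) by cts_tac.
have := @itg_subst 0 (fun t => h t y) q q a b (ltW ab) cw cq cq q0 (fun x _ => dq x).
have -> : itg a b (fun x => h (q x) y * q x) = itg a b (fun x => expR (u x y)).
  apply: eq_itg => x hx.
  have ax : a <= x by lra.
  rewrite /h /W /p /sgi (mE (q x) (t1q x ax)) sgE // uv // expRD.
  rewrite (_ : q x * (cos y / sin y) = expR x * cos y); last first.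
    by rewrite /q; field; exact: lt0r_neq0.
  by rewrite -mulrA expR_double /q; congr (_ * _); field; exact: lt0r_neq0.
move=> ->.
have qab : q a <= q b by rewrite /q ler_pM2r // ler_expR ltW.
rewrite -(@itg_cat R 0 (q a) (q b)) ?(ltW (q0 a)) // addrC addKr.
apply: itg_sub => //; first exact: t1q.
by rewrite /q /t2 -[leRHS]mulr1; apply: ler_pM; rewrite ?expR_ge0 ?(ltW sy) ?sin_le1.
Unshelve. all: by end_near. Qed.
End Plane.

(** * From the half-plane to the strip *)

Section Extension.
Variable R : realType.
Implicit Types (f : R * R -> R) (D : set (R * R)) (q : R * R).

Lemma cvg_withinP f D q l : f p @[p --> within D (nbhs q)] --> l <->
  forall e, 0 < e -> exists2 d, 0 < d & forall p, D p ->
    `|q.1 - p.1| < d -> `|q.2 - p.2| < d -> `|l - f p| < e.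
Proof.
split=> [h e e0|h].
  move/cvgrPdist_lt : h => /(_ e e0)/nbhs_ballP[d /= d0 hd].
  by exists d => // p Dp h1 h2; apply: hd => //; split.
apply/cvgrPdist_lt => e e0; have [d d0 hd] := h e e0.
apply/nbhs_ballP; exists d => // p [h1 h2] Dp.
exact: hd.
Qed.

Lemma uhp_near_cuhp0 q d : cuhp0 q -> 0 < d ->
  exists p, [/\ uhp p, `|q.1 - p.1| < d & `|q.2 - p.2| < d].
Proof.
move=> [q0 _] d0; exists (q.1, q.2 + d / 2); rewrite /uhp /=; split.
- by lra.
- by rewrite subrr normr0.
- by rewrite ltr_norml; lra.
Qed.

Lemma cvg_uhp_unique f q (l l' : R) : cuhp0 q ->
  f p @[p --> within (@uhp R) (nbhs q)] --> l ->
  f p @[p --> within (@uhp R) (nbhs q)] --> l' -> l = l'.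
Proof.
move=> hq /cvg_withinP h /cvg_withinP h'.
apply/eqP; rewrite -subr_eq0 -normr_le0 leNgt; apply/negP => n0.
pose e := `|l - l'| / 2; have e0 : 0 < e by rewrite divr_gt0.
have [d d0 hd] := h e e0; have [d' d'0 hd'] := h' e e0.
have [|p [up p1 p2]] := @uhp_near_cuhp0 q (Num.min d d') hq; first by rewrite lt_min d0.
rewrite !lt_min in p1 p2; move/andP: p1 => [a1 a2]; move/andP: p2 => [b1 b2].
have g1 := hd p up a1 b1; have g2 := hd' p up a2 b2.
have : `|l - l'| <= `|l - f p| + `|l' - f p|.
  by rewrite (distrC l'); apply: ler_distD.
by rewrite /e in g1 g2; lra.
Qed.

Lemma uhp_cuhp0 q : uhp q -> cuhp0 q.
Proof.
rewrite /uhp /cuhp0 /= => q0; split; first exact: ltW.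
by apply: contraTneq q0 => ->; rewrite ltxx.
Qed.

Lemma continuous_within f D q : {for q, continuous f} -> f p @[p --> within D (nbhs q)] --> f q.
Proof. by move=> h; apply: cvg_within_filter; exact: h. Qed.

(** The boundary limits depend continuously on the point: a value of [F] near [q] is approximated by
    values of [f] at points of the open half-plane that are still near [q]. *)
Lemma boundary_extension f : (forall p, uhp p -> {for p, continuous f}) ->
  (forall q, cuhp0 q -> exists l : R, f p @[p --> within (@uhp R) (nbhs q)] --> l) ->
  exists F : R * R -> R, [/\ forall p, uhp p -> F p = f p,
    forall q, cuhp0 q -> f p @[p --> within (@uhp R) (nbhs q)] --> F q &
    forall q, cuhp0 q -> F p @[p --> within (@cuhp0 R) (nbhs q)] --> F q].
Proof.
move=> cf lf.
have : forall q, exists l : R, cuhp0 q -> f p @[p --> within (@uhp R) (nbhs q)] --> l.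
  move=> q; have [hq|hq] := pselect (cuhp0 q); last by exists 0.
  by have [l hl] := lf q hq; exists l.
move=> /choice[F hF]; exists F; split => //.
  move=> p hp; have hp' := uhp_cuhp0 hp.
  by apply: (cvg_uhp_unique hp' (hF p hp')); apply: continuous_within; exact: cf.
move=> q hq; apply/cvg_withinP => e e0.
have e2 : 0 < e / 2 by lra.
have [d d0 hd] := (cvg_withinP _ _ _ _).1 (hF q hq) _ e2.
have d2 : 0 < d / 2 by lra.
exists (d / 2) => // p hp h1 h2.
have [d' d'0 hd'] := (cvg_withinP _ _ _ _).1 (hF p hp) _ e2.
have [|z [uz z1 z2]] := @uhp_near_cuhp0 p (Num.min (d / 2) d') hp; first by rewrite lt_min d2.
rewrite !lt_min in z1 z2; move/andP: z1 => [a1 a2]; move/andP: z2 => [b1 b2].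
have g1 : `|F q - f z| < e / 2.
  apply: hd => //.
    by apply: le_lt_trans (ler_distD p.1 _ _) _; lra.
  by apply: le_lt_trans (ler_distD p.2 _ _) _; lra.
have g2 := hd' z uz a2 b2.
apply: le_lt_trans (ler_distD (f z) _ _) _; rewrite (distrC (f z)); lra.
Qed.

(** Continuity relative to [D] becomes continuity everywhere when the inner maps take all their
    values in [D], as the clamped polar coordinates do. *)
Lemma cts_comp_within (f : R * R -> R) D (a b : R -> R -> R) :
  (forall q, D q -> f p @[p --> within D (nbhs q)] --> f q) ->
  ct2 a -> ct2 b -> (forall x y, D (a x y, b x y)) -> ct2 (fun x y => f (a x y, b x y)).
Proof.
move=> hf ca cb hD w.
apply/cvgrPdist_lt => e e0.
have [d d0 hd] := (cvg_withinP _ _ _ _).1 (hf _ (hD w.1 w.2)) _ e0.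
have /cvgrPdist_lt/(_ d d0) h1 := ca w; have /cvgrPdist_lt/(_ d d0) h2 := cb w.
near=> p; apply: hd => //=; near: p; [exact: h1|exact: h2].
Unshelve. all: by end_near. Qed.

End Extension.

(** * Chain rule and symmetry of mixed derivatives *)

Section ChainRule.
Variable R : realType.

Lemma der_mvt_cc (f df : R -> R) a b : a <= b ->
  (forall x, a <= x <= b -> der f x (df x)) ->
  exists2 c, a <= c <= b & f b - f a = df c * (b - a).
Proof.
move=> ab h.
have h1 z : z \in `]a, b[ -> is_derive z 1 f (df z).
  by rewrite in_itv /= => hz; apply: h; lra.
have h2 : {within `[a, b], continuous f}.
  by apply: derivable_within_continuous => z; rewrite in_itv /= => /h[].
have [c] := MVT_segment ab h1 h2.
by rewrite in_itv /= => hc e; exists c.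
Qed.

Lemma ds_der (f : R * R -> R) p : partials_at f p -> der (fun s => f (s, p.2)) p.1 (ds f p).
Proof. by move=> [h _]; split => //; rewrite /ds derive1E. Qed.
Lemma dt_der (f : R * R -> R) p : partials_at f p -> der (fun t => f (p.1, t)) p.2 (dt f p).
Proof. by move=> [_ h]; split => //; rewrite /dt derive1E. Qed.

(** The increment splits into a change [G] of the first argument and a change of the second, which
    is a one-variable composition. For [G] the mean value theorem yields [ds f] at a nearby point,
    whose continuity gives the limit; Caratheodory's criterion avoids dividing by [a z - a x] where
    it vanishes. *)
Lemma chain_rule (f : R * R -> R) (a b : R -> R) x a' b' :
  (forall p, uhp p -> partials_at f p) ->
  (forall p, uhp p -> {for p, continuous (ds f)}) ->
  0 < b x -> der a x a' -> der b x b' ->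
  der (fun z => f (a z, b z)) x (ds f (a x, b x) * a' + dt f (a x, b x) * b').
Proof.
move=> pf cf bx da db.
have hp : uhp (a x, b x) by [].
have d2 : der (fun z => f (a x, b z)) x (dt f (a x, b x) * b').
  exact: (der_comp (f := fun t => f (a x, t)) db (dt_der (pf _ hp))).
pose G z := f (a z, b z) - f (a x, b z).
have d1 : der G x (ds f (a x, b x) * a').
  have [g [hg cg gx]] := (is_derive1_caratheodory a x a').1 da.
  pose c z := if a z == a x then ds f (a x, b x) else G z / (a z - a x).
  apply/(is_derive1_caratheodory G x).
  have Gx : G x = 0 by rewrite /G subrr.
  exists (fun z => c z * g z); split.
  - move=> z; rewrite Gx subr0 -mulrA -hg /c.
    have [e|n] := eqVneq (a z) (a x); first by rewrite /G e !subrr mulr0.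
    by rewrite divfK // subr_eq0.
  - apply: cvgM; last exact: cg.
    rewrite {2}/c eqxx; apply/cvgrPdist_lt => e e0.
    have /cvgrPdist_lt/(_ e e0)/nbhs_ballP[d /= d0 hd] := cf _ hp.
    have ca := der_cont da; have cb := der_cont db.
    have /cvgrPdist_lt/(_ d d0) h1 := ca; have /cvgrPdist_lt/(_ d d0) h2 := cb.
    have h3 : \forall z \near x, 0 < b z by move: bx; apply: cvgr_gt cb _.
    have key z : 0 < b z -> `|a x - a z| < d -> `|b x - b z| < d -> `|ds f (a x, b x) - c z| < e.
      move=> bz az bz'; rewrite /c.
      have [_|n] := eqVneq (a z) (a x); first by rewrite subrr normr0.
      have D s : der (fun s => f (s, b z)) s (ds f (s, b z)).
        exact: (ds_der (p := (s, b z)) (pf (s, b z) bz)).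
      have [xi hxi ->] : exists2 xi, `|a x - xi| < d & G z / (a z - a x) = ds f (xi, b z).
        rewrite ltr_norml in az.
        have nz : a z - a x != 0 by rewrite subr_eq0.
        have [le|gt] := leP (a x) (a z).
          have [xi hxi E] := der_mvt_cc le (fun s _ => D s).
          exists xi; first by rewrite ltr_norml; lra.
          by rewrite /G E mulfK.
        have [xi hxi E] := der_mvt_cc (ltW gt) (fun s _ => D s).
        exists xi; first by rewrite ltr_norml; lra.
        by rewrite /G -opprB E -mulrN opprB mulfK.
      by apply: hd; split.
    near=> z; apply: key; near: z; [exact: h3|exact: h1|exact: h2].
  - by rewrite gx /c eqxx.
rewrite (_ : (fun z => _) = fun z => G z + f (a x, b z)); last first.
  by apply: funext => z; rewrite /G subrK.
exact: derD.
Unshelve. all: by end_near. Qed.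

(** The integral of [uy] over [y1, z] is a difference of values of [u]; its [x]-derivative is
    computed through [ux] and under the integral sign. So [uxy] and [uyx] have equal integrals over
    all these intervals, and differentiating in [z] concludes. [C2_cuhp0] itself does not identify
    the two mixed derivatives. *)
Lemma schwarz (u ux uy uxy uyx : R -> R -> R) a b :
  ct2 u -> ct2 ux -> ct2 uy -> ct2 uxy -> ct2 uyx ->
  (forall x y, a < y < b -> der (fun x => u x y) x (ux x y)) ->
  (forall x y, a < y < b -> der (fun y => u x y) y (uy x y)) ->
  (forall x y, a < y < b -> der (fun y => ux x y) y (uxy x y)) ->
  (forall x y, a < y < b -> der (fun x => uy x y) x (uyx x y)) ->
  forall x y, a < y < b -> uxy x y = uyx x y.
Proof.
move=> cu cux cuy cuxy cuyx dx dy dxy dyx x y hy.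
pose y1 := (a + y) / 2.
have H z : y1 <= z < b -> itg y1 z (fun y => uxy x y - uyx x y) = 0.
  move=> hz; rewrite itgB; [|cts_tac|cts_tac].
  have e1 : itg y1 z (uxy x) = ux x z - ux x y1.
    by apply: (itg_FTC (F := ux x)); [rewrite /y1 in hz *; lra|cts_tac|cts_tac|move=> t ht; apply: dxy; rewrite /y1 in ht; lra].
  have d1 : der (fun x => itg y1 z (uy x)) x (itg y1 z (uyx x)).
    by apply: der_itg => // x' t ht; apply: dyx; rewrite /y1 in ht; lra.
  have d2 : der (fun x => itg y1 z (uy x)) x (ux x z - ux x y1).
    rewrite (_ : (fun x => itg y1 z (uy x)) = fun x => u x z - u x y1).
      have h1 : der (fun x => u x z) x (ux x z) by apply: dx; rewrite /y1 in hz; lra.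
      have h2 : der (fun x => u x y1) x (ux x y1) by apply: dx; rewrite /y1; lra.
      by der_tac; ring.
    apply: funext => x'.
    by apply: (itg_FTC (F := u x')); [lra|cts_tac|cts_tac|move=> t ht; apply: dy; rewrite /y1 in ht; lra].
  by rewrite (der_uniq d1 d2) e1 subrr.
have yy : y1 < y by rewrite /y1; lra.
have p := @primitive R (fun y => uxy x y - uyx x y) y1 ltac:(cts_tac) y yy.
apply/eqP; rewrite -subr_eq0; apply/eqP; apply: (der_uniq p).
apply: (@der_near _ _ (fun=> 0)); last exact: der_cst.
near=> z; apply: H; apply/andP; split; last by near: z; apply: lt_nbhsl; lra.
by apply: ltW; near: z; exact: lt_nbhsr.
Unshelve. all: by end_near. Qed.

End ChainRule.

(** * Polar coordinates on the closed strip *)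

Section Polar.
Variable R : realType.

(** Freezing the angle outside [0, pi] makes the polar maps continuous on the whole plane, with
    values in the closed half-plane minus the origin. *)
Definition clamp (y : R) : R := Num.max 0 (Num.min y pi).

Lemma clampE y : 0 <= y <= pi -> clamp y = y.
Proof. by move=> /andP[y0 yp]; rewrite /clamp (min_idPl yp); apply/max_idPr. Qed.

Lemma clamp_in y : 0 <= clamp y <= pi.
Proof. by rewrite /clamp le_max lexx ge_max pi_ge0 ge_min lexx orbT. Qed.

Lemma cts_clamp : cts clamp.
Proof.
rewrite (_ : clamp = fun y => Num.max 0 (pi - Num.max 0 (pi - y))).
  by do 2 (refine (@ct_max _ _ (fun=> 0) _ _ _); cts_tac).
apply: funext => y; congr Num.max; rewrite maxEle minEle.
by case: leP => h1; case: leP => h2; lra.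
Qed.

Definition polar_s x y := expR x * cos (clamp y).
Definition polar_t x y := expR x * sin (clamp y).

Lemma ct2_polar_s : ct2 polar_s.
Proof. by have h := cts_clamp; rewrite /polar_s; cts_tac. Qed.
Lemma ct2_polar_t : ct2 polar_t.
Proof. by have h := cts_clamp; rewrite /polar_t; cts_tac. Qed.

Lemma polar_cuhp0 x y : cuhp0 (polar_s x y, polar_t x y).
Proof.
split => /=; first by rewrite mulr_ge0 ?expR_ge0 // sin_ge0_pi // clamp_in.
apply/eqP => -[h1 h2].
have : expR x ^+ 2 = polar_s x y ^+ 2 + polar_t x y ^+ 2.
  by rewrite /polar_s /polar_t !exprMn -mulrDr cos2Dsin2 mulr1.
by rewrite h1 h2 expr0n addr0 => /eqP; rewrite sqrf_eq0 expR_eq0.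
Qed.

Lemma polar_uhp x y : 0 < y < pi -> uhp (polar_s x y, polar_t x y).
Proof.
move=> hy; rewrite /uhp /= /polar_t clampE; last by lra.
by rewrite mulr_gt0 ?expR_gt0 // sin_gt0_pi.
Qed.

Lemma near_oo (y a b : R) (q : R -> Prop) : a < y < b -> (forall z, a < z < b -> q z) ->
  \forall z \near y, q z.
Proof.
move=> /andP[ay yb] hq; near=> z; apply: hq; apply/andP; split; near: z.
  exact: lt_nbhsr.
exact: lt_nbhsl.
Unshelve. all: by end_near. Qed.

(** The chain rule for z = e^(x + i y), phrased with the extensions [F], [Fs], [Ft] that are
    continuous up to the boundary; it is meant for [w] equal to [v], [ds v] and [dt v]. *)
Lemma polar_der (w F Fs Ft : R * R -> R) x y :
  (forall p, uhp p -> partials_at w p) -> (forall p, uhp p -> {for p, continuous (ds w)}) ->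
  (forall p, uhp p -> F p = w p) -> (forall p, uhp p -> Fs p = ds w p) ->
  (forall p, uhp p -> Ft p = dt w p) -> 0 < y < pi ->
  der (fun x => F (polar_s x y, polar_t x y)) x
    (Fs (polar_s x y, polar_t x y) * polar_s x y + Ft (polar_s x y, polar_t x y) * polar_t x y) /\
  der (fun y => F (polar_s x y, polar_t x y)) y
    (Fs (polar_s x y, polar_t x y) * - polar_t x y + Ft (polar_s x y, polar_t x y) * polar_s x y).
Proof.
move=> pw cw hF hFs hFt hy.
have up := polar_uhp x hy; rewrite hFs // hFt //.
have E z : 0 < z < pi -> polar_s x z = expR x * cos z /\ polar_t x z = expR x * sin z.
  by move=> hz; rewrite /polar_s /polar_t clampE //; lra.
have [ex ey] := E y hy.
have py : 0 < expR x * sin y by rewrite -ey.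
split.
  rewrite (_ : (fun x => _) = fun x => w (expR x * cos y, expR x * sin y)); last first.
    apply: funext => x'; rewrite hF; last exact: polar_uhp.
    by rewrite /polar_s /polar_t clampE //; lra.
  rewrite ex ey; apply: (chain_rule (a := fun x => expR x * cos y) (b := fun x => expR x * sin y)) => //.
    by der_tac; ring.
  by der_tac; ring.
apply: (@der_near _ _ (fun y => w (expR x * cos y, expR x * sin y))).
  apply: near_oo hy _ => z hz; rewrite hF; last exact: polar_uhp.
  by have [-> ->] := E z hz.
rewrite ex ey; apply: (chain_rule (a := fun y => expR x * cos y) (b := fun y => expR x * sin y)) => //.
  by der_tac; ring.
by der_tac; ring.
Qed.

Lemma der_polar_s_x x y : der (fun x => polar_s x y) x (polar_s x y).
Proof. by rewrite /polar_s; der_tac; ring. Qed.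
Lemma der_polar_t_x x y : der (fun x => polar_t x y) x (polar_t x y).
Proof. by rewrite /polar_t; der_tac; ring. Qed.
Lemma der_polar_s_y x y : 0 < y < pi -> der (fun y => polar_s x y) y (- polar_t x y).
Proof.
move=> hy; apply: (@der_near _ _ (fun y => expR x * cos y)).
  by apply: near_oo hy _ => z hz; rewrite /polar_s clampE //; lra.
by rewrite /polar_t clampE; [der_tac; ring|lra].
Qed.
Lemma der_polar_t_y x y : 0 < y < pi -> der (fun y => polar_t x y) y (polar_s x y).
Proof.
move=> hy; apply: (@der_near _ _ (fun y => expR x * sin y)).
  by apply: near_oo hy _ => z hz; rewrite /polar_t clampE //; lra.
by rewrite /polar_s clampE; [der_tac; ring|lra].
Qed.

Lemma polar_coordinates (z : R * R) : cuhp0 z ->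
  exists x y, [/\ 0 <= y <= pi, cabs z = expR x, carg z = y &
    z = (expR x * cos y, expR x * sin y)].
Proof.
case: z => s t [/= t0 n0].
have r2 : 0 < s ^+ 2 + t ^+ 2.
  rewrite lt_neqAle addr_ge0 ?sqr_ge0 // andbT eq_sym paddr_eq0 ?sqr_ge0 //.
  by rewrite !sqrf_eq0; apply: contra n0 => /andP[/eqP-> /eqP->].
set r := Num.sqrt (s ^+ 2 + t ^+ 2).
have r0 : 0 < r by rewrite sqrtr_gt0.
have rr : r ^+ 2 = s ^+ 2 + t ^+ 2 by rewrite sqr_sqrtr // ltW.
have srE : s / r * r = s by rewrite divfK // lt0r_neq0.
have sr : -1 <= s / r <= 1.
  rewrite -ler_norml normrM normfV (gtr0_norm r0) ler_pdivrMr // mul1r.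
  rewrite -ler_sqr ?nnegrE // ?(ltW r0) // real_normK ?num_real // rr.
  by rewrite lerDl sqr_ge0.
exists (ln r), (acos (s / r)); split.
- by rewrite acos_ge0 // acos_lepi.
- by rewrite lnK ?posrE.
- by [].
rewrite lnK ?posrE // acosK; last by rewrite in_itv.
rewrite sin_acos // mulrC srE; congr pair.
rewrite -{1}(gtr0_norm r0) -sqrtr_sqr -sqrtrM ?sqr_ge0 //.
rewrite mulrBr mulr1 -exprMn (mulrC r) srE rr addrAC subrr add0r sqrtr_sqr.
by rewrite ger0_norm.
Qed.

End Polar.

(** The two margins of width [e] contribute at most [2 * e * C * (b - a)], where [C] bounds [G] on
    the rectangle. *)
Lemma itg_shrink (R : realType) (G : R -> R -> R) a b M : a < b -> ct2 G ->
  (forall x y, 0 <= G x y) ->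
  (forall e, 0 < e < pi / 2 -> itg a b (fun x => itg e (pi - e) (G x)) <= M) ->
  itg a b (fun x => itg 0 pi (G x)) <= M.
Proof.
move=> ab cG G0 hM.
have p0 := pi_gt0 R.
have [C [C0 hC]] := ct2_bounded a b 0 pi cG.
have H (e : R) : 0 < e < pi / 2 -> itg a b (fun x => itg 0 pi (G x)) <= M + 2 * e * C * (b - a).
  move=> he; have h1 := hM e he.
  have b1 : 0 <= e by lra.
  have b2 : e <= pi by lra.
  have b3 : e <= pi - e by lra.
  have b4 : pi - e <= pi by lra.
  have b5 : 0 <= pi - e by lra.
  have c1 : cts (fun x => itg 0 pi (G x)) := cts_itg cG.
  have c2 : cts (fun x => itg e (pi - e) (G x)) := cts_itg cG.
  apply: (@le_trans _ _ (itg a b (fun x => itg e (pi - e) (G x) + 2 * e * C))).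
    apply: itg_le => //; first by cts_tac.
    move=> x hx; have cx : cts (G x) by cts_tac.
    rewrite -(itg_cat b1 b2 cx) -(itg_cat b3 b4 cx).
    have bd s t : 0 <= s -> s <= t -> t <= pi -> itg s t (G x) <= C * (t - s).
      move=> s0 st tp; rewrite -(@itg_cst R s t C st); apply: itg_le => //; first by cts_tac.
      move=> y /andP[sy yt]; apply: le_trans (ler_norm _) (hC x y hx _).
      by rewrite (le_trans s0 sy) (le_trans yt tp).
    have k1 := bd _ _ (lexx 0) b1 b2; have k2 := bd _ _ b5 b4 (lexx pi).
    by move: k1 k2; clear; lra.
  rewrite (itgD _ _ c2); last by cts_tac.
  by rewrite (itg_cst _ (ltW ab)); lra.
rewrite leNgt; apply/negP => gt.
pose k := 2 * C * (b - a).
have k0 : 0 <= k by apply: mulr_ge0; [apply: mulr_ge0|rewrite subr_ge0 ltW].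
set A := itg a b _ in H gt; pose d := A - M.
have d0 : 0 < d by rewrite subr_gt0.
(* Small enough for the margins to account for at most half of the excess [d]. *)
pose e := Num.min (pi / 4) (d / (2 * (k + 1))).
have k1 : 0 < 2 * (k + 1) by lra.
have e0 : 0 < e by rewrite lt_min divr_gt0 // divr_gt0.
have ep : e <= pi / 4 by rewrite ge_min lexx.
have ed : e <= d / (2 * (k + 1)) by rewrite ge_min lexx orbT.
rewrite ler_pdivlMr // in ed.
have := H e ltac:(lra).
have : 0 <= e * k by rewrite mulr_ge0 // ltW.
have -> : 2 * e * C * (b - a) = e * k by rewrite /k; ring.
by have -> : A = d + M by [rewrite /d subrK]; move: ed d0 e0; clear; lra.
Qed.

(** * Passage from the half-plane problem to the strip problem *)

Section Transfer.
Variables (R : realType) (K c1 c2 : R) (v : R * R -> R).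
Hypothesis C2v : C2_cuhp0 v.
Hypothesis pde : forall p, uhp p -> laplacian v p + 2 * K * expR (v p) = 0.
Hypothesis bc1 : forall s : R, 0 < s ->
  dt v p @[p --> within (@uhp R) (nbhs (s, 0))] --> c1 * expR (v (s, 0) / 2).
Hypothesis bc2 : forall s : R, s < 0 ->
  dt v p @[p --> within (@uhp R) (nbhs (s, 0))] --> c2 * expR (v (s, 0) / 2).
Hypothesis area : (\int[(@lebesgue_measure R \x @lebesgue_measure R)%E]_(p in @uhp R)
      (expR (v p))%:E < +oo)%E.

(** The chain rule formulas are written with the continuous extensions of the derivatives of [v], so
    that they make sense on the boundary lines; the equation is checked inside and reaches the
    closed strip by continuity. *)
Lemma strip_transfer : exists u ux uy uxx uxy uyy : R -> R -> R,
  strip_solution K c1 c2 u ux uy uxx uxy uyy /\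
  forall x y, 0 <= y <= pi -> u x y = v (expR x * cos y, expR x * sin y) + 2 * x.
Proof.
have [C2 cv ext] := C2v.
have cont f : f \in derivs2 v -> forall p, uhp p -> {for p, continuous f}.
  by move=> hf p hp; have [_ _ _ h] := C2 p hp; exact: h.
have pv p : uhp p -> partials_at v p by move=> /C2[].
have pvs p : uhp p -> partials_at (ds v) p by move=> /C2[].
have pvt p : uhp p -> partials_at (dt v) p by move=> /C2[].
have EX f : f \in derivs2 v -> exists F : R * R -> R, [/\ forall p, uhp p -> F p = f p,
    forall q, cuhp0 q -> f p @[p --> within (@uhp R) (nbhs q)] --> F q &
    ct2 (fun x y => F (polar_s x y, polar_t x y))].
  move=> hf; have [F [h1 h2 h3]] := boundary_extension (cont f hf) (fun q hq => ext q hq f hf).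
  exists F; split => //.
  exact: (cts_comp_within h3 (ct2_polar_s (R := R)) (ct2_polar_t (R := R)) (@polar_cuhp0 R)).
have i0 : v \in derivs2 v := @mem_nth _ v (derivs2 v) 0 isT.
have is' : ds v \in derivs2 v := @mem_nth _ v (derivs2 v) 1 isT.
have it : dt v \in derivs2 v := @mem_nth _ v (derivs2 v) 2 isT.
have iss : ds (ds v) \in derivs2 v := @mem_nth _ v (derivs2 v) 3 isT.
have ist : ds (dt v) \in derivs2 v := @mem_nth _ v (derivs2 v) 4 isT.
have its : dt (ds v) \in derivs2 v := @mem_nth _ v (derivs2 v) 5 isT.
have itt : dt (dt v) \in derivs2 v := @mem_nth _ v (derivs2 v) 6 isT.
have [F [F1 F2 cF]] := EX _ i0.
have [Fs [Fs1 Fs2 cFs]] := EX _ is'.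
have [Ft [Ft1 Ft2 cFt]] := EX _ it.
have [Fss [Fss1 _ cFss]] := EX _ iss.
have [Fst [Fst1 _ cFst]] := EX _ ist.
have [Fts [Fts1 _ cFts]] := EX _ its.
have [Ftt [Ftt1 _ cFtt]] := EX _ itt.
(* At boundary points the extension built from interior limits agrees with [v], by the continuity of
   [v] on the closed half-plane minus the origin. *)
have Fv q : cuhp0 q -> F q = v q.
  move=> hq; apply: (cvg_uhp_unique hq (F2 q hq)).
  apply/cvg_withinP => e e0; have [d d0 hd] := (cvg_withinP _ _ _ _).1 (cv q hq) e e0.
  by exists d => // p up; apply: hd; exact: uhp_cuhp0.
pose P (G : R * R -> R) x y := G (polar_s x y, polar_t x y).
have cP := ct2_polar_s (R := R); have cQ := ct2_polar_t (R := R).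
have {}cF : ct2 (P F) := cF. have {}cFs : ct2 (P Fs) := cFs. have {}cFt : ct2 (P Ft) := cFt.
have {}cFss : ct2 (P Fss) := cFss. have {}cFst : ct2 (P Fst) := cFst.
have {}cFts : ct2 (P Fts) := cFts. have {}cFtt : ct2 (P Ftt) := cFtt.
have dF x y (hy : 0 < y < pi) := polar_der x pv (cont _ is') F1 Fs1 Ft1 hy.
have dFs x y (hy : 0 < y < pi) := polar_der x pvs (cont _ iss) Fs1 Fss1 Fts1 hy.
have dFt x y (hy : 0 < y < pi) := polar_der x pvt (cont _ ist) Ft1 Fst1 Ftt1 hy.
pose X := polar_s (R := R). pose T := polar_t (R := R).
pose u x y := P F x y + 2 * x.
pose ux x y := P Fs x y * X x y + P Ft x y * T x y + 2.
pose uy x y := P Fs x y * - T x y + P Ft x y * X x y.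
pose uxx x y := (P Fss x y * X x y + P Fts x y * T x y) * X x y + P Fs x y * X x y
  + ((P Fst x y * X x y + P Ftt x y * T x y) * T x y + P Ft x y * T x y).
pose uxy x y := (P Fss x y * - T x y + P Fts x y * X x y) * X x y + P Fs x y * - T x y
  + ((P Fst x y * - T x y + P Ftt x y * X x y) * T x y + P Ft x y * X x y).
pose uyx x y := (P Fss x y * X x y + P Fts x y * T x y) * - T x y + P Fs x y * - T x y
  + ((P Fst x y * X x y + P Ftt x y * T x y) * X x y + P Ft x y * X x y).
pose uyy x y := (P Fss x y * - T x y + P Fts x y * X x y) * - T x y + P Fs x y * - X x y
  + ((P Fst x y * - T x y + P Ftt x y * X x y) * X x y + P Ft x y * - T x y).
have {}cP : ct2 X := cP. have {}cQ : ct2 T := cQ.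
have cu : ct2 u by rewrite /u; cts_tac.
have cux : ct2 ux by rewrite /ux; cts_tac.
have cuy : ct2 uy by rewrite /uy; cts_tac.
have cuxx : ct2 uxx by rewrite /uxx; cts_tac.
have cuxy : ct2 uxy by rewrite /uxy; cts_tac.
have cuyx : ct2 uyx by rewrite /uyx; cts_tac.
have cuyy : ct2 uyy by rewrite /uyy; cts_tac.
have Xx x y : der (fun x => X x y) x (X x y) by exact: der_polar_s_x.
have Tx x y : der (fun x => T x y) x (T x y) by exact: der_polar_t_x.
have Xy x y (hy : 0 < y < pi) : der (fun y => X x y) y (- T x y) by exact: der_polar_s_y.
have Ty x y (hy : 0 < y < pi) : der (fun y => T x y) y (X x y) by exact: der_polar_t_y.
have dux x y : 0 < y < pi -> der (fun x => u x y) x (ux x y).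
  by move=> hy; have h : der (fun x => P F x y) x _ := (dF x y hy).1; rewrite /u; der_tac; rewrite /ux /P /X /T; ring.
have duy x y : 0 < y < pi -> der (fun y => u x y) y (uy x y).
  by move=> hy; have h : der (fun y => P F x y) y _ := (dF x y hy).2; rewrite /u; der_tac; rewrite /uy /P /X /T; ring.
have duxx x y : 0 < y < pi -> der (fun x => ux x y) x (uxx x y).
  move=> hy; have h : der (fun x => P Fs x y) x _ := (dFs x y hy).1.
  have h' : der (fun x => P Ft x y) x _ := (dFt x y hy).1.
  have h1 := Xx x y; have h2 := Tx x y.
  by rewrite /ux; der_tac; rewrite /uxx /P /X /T; ring.
have duyx x y : 0 < y < pi -> der (fun x => uy x y) x (uyx x y).
  move=> hy; have h : der (fun x => P Fs x y) x _ := (dFs x y hy).1.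
  have h' : der (fun x => P Ft x y) x _ := (dFt x y hy).1.
  have h1 := Xx x y; have h2 := Tx x y.
  by rewrite /uy; der_tac; rewrite /uyx /P /X /T; ring.
have duxy x y : 0 < y < pi -> der (fun y => ux x y) y (uxy x y).
  move=> hy; have h : der (fun y => P Fs x y) y _ := (dFs x y hy).2.
  have h' : der (fun y => P Ft x y) y _ := (dFt x y hy).2.
  have h1 := Xy x y hy; have h2 := Ty x y hy.
  by rewrite /ux; der_tac; rewrite /uxy /P /X /T; ring.
have duyy x y : 0 < y < pi -> der (fun y => uy x y) y (uyy x y).
  move=> hy; have h : der (fun y => P Fs x y) y _ := (dFs x y hy).2.
  have h' : der (fun y => P Ft x y) y _ := (dFt x y hy).2.
  have h1 := Xy x y hy; have h2 := Ty x y hy.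
  by rewrite /uy; der_tac; rewrite /uyy /P /X /T; ring.
have E x y : 0 <= y <= pi -> X x y = expR x * cos y /\ T x y = expR x * sin y.
  by move=> hy; rewrite /X /T /polar_s /polar_t clampE.
have uE x y : 0 <= y <= pi -> u x y = v (expR x * cos y, expR x * sin y) + 2 * x.
  move=> hy; have [<- <-] := E x y hy; rewrite /u /P Fv //; exact: polar_cuhp0.
have pi1 : 0 <= (0 : R) <= pi by rewrite lexx pi_ge0.
have pi2 : 0 <= (pi : R) <= pi by rewrite lexx pi_ge0.
have e2x (x : R) : expR (2 * x) = expR x ^+ 2 := expR_double x.
exists u, ux, uy, uxx, uxy, uyy; split; last exact: uE.
split => //.
- move=> x y hy.
  by rewrite (schwarz cu cux cuy cuxy cuyx dux duy duxy duyx x hy); exact: duyx.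
- move=> x y hy.
  pose l y := uxx x y + uyy x y. pose r y := - 2 * K * expR (u x y).
  apply: (@cts_eq_at R l r 0 pi y (pi_gt0 R)) => //.
    by rewrite /l; cts_tac.
    by rewrite /r; cts_tac.
  move=> z hz; have up := polar_uhp x hz.
  have := pde up; rewrite /laplacian -Fss1 // -Ftt1 // -F1 // => h.
  have hz' : 0 <= z <= pi by lra.
  have [ex ez] := E x z hz'.
  have XT : X x z ^+ 2 + T x z ^+ 2 = expR x ^+ 2.
    by rewrite ex ez !exprMn -mulrDr cos2Dsin2 mulr1.
  (* The mixed and first-order terms of [uxx + uyy] cancel, leaving |z|^2 times the Laplacian. *)
  have -> : l z = (X x z ^+ 2 + T x z ^+ 2) * (P Fss x z + P Ftt x z).
    by rewrite /l /uxx /uyy; ring.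
  have -> : r z = expR x ^+ 2 * (- 2 * K * expR (P F x z)).
    by rewrite /r /u expRD e2x; ring.
  by rewrite XT; congr (_ * _); move: h; rewrite /P; lra.
- move=> x; have [e1 e2] := E x 0 pi1; rewrite cos0 mulr1 in e1; rewrite sin0 mulr0 in e2.
  have hq : cuhp0 (X x 0, T x 0) := polar_cuhp0 x 0.
  have hft : Ft (X x 0, T x 0) = c1 * expR (v (expR x, 0) / 2).
    apply: (cvg_uhp_unique hq (Ft2 _ hq)); rewrite e1 e2; apply: bc1; exact: expR_gt0.
  rewrite /uy e2 oppr0 mulr0 add0r /P -/(X x 0) -/(T x 0) hft e1 uE // cos0 sin0 mulr1 mulr0.
  by rewrite mulrDl expRD (mulrC 2 x) mulfK ?pnatr_eq0 //; ring.
- move=> x; have [e1 e2] := E x pi pi2; rewrite cospi mulrN1 in e1; rewrite sinpi mulr0 in e2.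
  have hq : cuhp0 (X x pi, T x pi) := polar_cuhp0 x pi.
  have hft : Ft (X x pi, T x pi) = c2 * expR (v (- expR x, 0) / 2).
    by apply: (cvg_uhp_unique hq (Ft2 _ hq)); rewrite e1 e2; apply: bc2; rewrite oppr_lt0 expR_gt0.
  rewrite /uy e2 oppr0 mulr0 add0r /P -/(X x pi) -/(T x pi) hft e1 uE // cospi sinpi mulrN1 mulr0.
  rewrite mulrDl expRD (mulrC 2 x) mulfK ?pnatr_eq0 //; ring.
- pose M := fine (\int[(@lebesgue_measure R \x @lebesgue_measure R)%E]_(p in @uhp R) (expR (v p))%:E)%E.
  exists M => a b ab.
  have cE : ct2 (fun x y => expR (u x y)) by cts_tac.
  apply: (itg_shrink ab cE (fun x y => expR_ge0 _)) => e he.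
  rewrite (@itg_swap R (fun x y => expR (u x y)) a b e (pi - e) cE (fun x y => expR_ge0 _)).
  apply: (polar_area (cont _ i0) cu _ ab he area) => x y hy; apply: uE.
  by move/andP: hy => [? ?]; rewrite !ltW.
Qed.

End Transfer.

(** * Canonical form *)

Section Canonical.
Variables (R : realType) (K : R) (v : R * R -> R) (u : R -> R -> R).
Hypothesis uv : forall x y : R, 0 <= y <= pi ->
  u x y = v (expR x * cos y, expR x * sin y) + 2 * x.

Let v_ln (z : R * R) x y : 0 <= y <= pi -> z = (expR x * cos y, expR x * sin y) ->
  v z = ln (expR x ^- 2 * expR (- 2^-1 * u x y) ^- 2).
Proof.
move=> hy hz; have := uv x hy; rewrite -hz => e.
by rewrite -!expR_double -!expRN -expRD expRK e; field.
Qed.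

(** Completing the square: for [l = 1 / (2 a g)] and [z0 = - l g (c + i d)], the denominator K l^2 +
    |z^g - z0|^2 equals 2 l g e^(g x) e^(-u/2). It is therefore positive away from 0; at 0 it is
    positive because [b] is. *)
Lemma canonical_a_of_strip g a b c d : 0 < g -> 0 < a -> 0 < b ->
  4 * g ^+ 2 * (a * b) = K + g ^+ 2 * (c ^+ 2 + d ^+ 2) ->
  (forall x y : R, 0 <= y <= pi -> expR (- 2^-1 * u x y) =
      a * expR (g * x) + b * expR (- (g * x)) + c * cos (g * y) + d * sin (g * y)) ->
  canonical_a K v.
Proof.
move=> g0 a0 b0 e hf.
have g1 := lt0r_neq0 g0; have a1 := lt0r_neq0 a0.
pose l := (2 * a * g)^-1.
have l0 : 0 < l by rewrite invr_gt0 !mulr_gt0.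
have l1 := lt0r_neq0 l0.
pose z0 : R * R := (- (c * l * g), - (d * l * g)).
(* The relation between the coefficients and [K] enters here: it identifies the constant term of the
   expanded square. *)
have B : K * l ^+ 2 + (z0.1 ^+ 2 + z0.2 ^+ 2) = 2 * l * g * b.
  have -> : K * l ^+ 2 + (z0.1 ^+ 2 + z0.2 ^+ 2) = (K + g ^+ 2 * (c ^+ 2 + d ^+ 2)) * l ^+ 2.
    by rewrite /z0 /=; ring.
  by rewrite -e /l; field; apply/andP.
have N z x y : 0 <= y <= pi -> cabs z = expR x -> carg z = y ->
    K * l ^+ 2 + cdist2 (cpow z g) z0 = 2 * l * g * expR (g * x) * expR (- 2^-1 * u x y).
  move=> hy ex ey; rewrite hf // /cdist2 /cpow ex ey -expRM (mulrC x).
  set E := expR (g * x); set C := cos _; set S := sin _ => /=.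
  have EE : E * expR (- (g * x)) = 1 by rewrite /E -expRD subrr expR0.
  have CS : C ^+ 2 + S ^+ 2 = 1 := cos2Dsin2 _.
  have -> : K * l ^+ 2 + ((E * C - - (c * l * g)) ^+ 2 + (E * S - - (d * l * g)) ^+ 2) =
    (K * l ^+ 2 + (z0.1 ^+ 2 + z0.2 ^+ 2)) + E ^+ 2 * (C ^+ 2 + S ^+ 2)
      + 2 * l * g * E * (c * C + d * S) by rewrite /z0 /=; ring.
  rewrite B CS.
  have -> : 2 * l * g * E * (a * E + b * expR (- (g * x)) + c * C + d * S) =
    (2 * a * g) * l * E ^+ 2 + 2 * l * g * b * (E * expR (- (g * x))) + 2 * l * g * E * (c * C + d * S).
    by ring.
  by rewrite EE /l divff ?mulf_neq0 // ?pnatr_eq0 //; ring.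
exists g, l, z0; split => //.
- move=> z hz.
  have [->|n0] := eqVneq z (0, 0).
    have -> : K * l ^+ 2 + cdist2 (cpow (0, 0) g) z0 = 2 * l * g * b.
      have c0 : cabs (0, 0) = 0 :> R by rewrite /cabs /= expr0n /= addr0 sqrtr0.
      by rewrite -B /cdist2 /cpow c0 powR0 // !mul0r /=; ring.
    by rewrite !mulf_neq0 ?pnatr_eq0 // lt0r_neq0.
  have [x [y [hy ex ey _]]] := polar_coordinates (conj hz n0).
  by rewrite (N z x y) // !mulf_neq0 ?pnatr_eq0 // ?lt0r_neq0 ?expR_gt0.
- move=> z hz; have [x [y [hy ex ey ez]]] := polar_coordinates hz.
  rewrite (v_ln hy ez) (N z x y) // ex -expRM; congr ln.
  have f0 := lt0r_neq0 (expR_gt0 (- 2^-1 * u x y)).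
  have x0 := lt0r_neq0 (expR_gt0 x); have gx0 := lt0r_neq0 (expR_gt0 (g * x)).
  have -> : expR (x * (2 * (g - 1))) = expR (g * x) ^+ 2 * expR x ^- 2.
    by rewrite -!expR_double -expRN -expRD; congr expR; ring.
  by field; rewrite x0 f0 gx0 l1 g1.
Qed.

(** Completing the square in log z = x + i y: with [l = 1 / n] and centre - (p + i q) / n the
    denominator K l^2 + |log z - z0|^2 equals 2 l e^(-u/2). *)
Lemma canonical_b_of_strip n p q r : 0 < n -> 2 * n * r = K + p ^+ 2 + q ^+ 2 ->
  (forall x y : R, 0 <= y <= pi -> expR (- 2^-1 * u x y) =
      n / 2 * (x ^+ 2 + y ^+ 2) + p * x + q * y + r) ->
  canonical_b K v.
Proof.
move=> n0 e hf.
have n1 := lt0r_neq0 n0.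
pose l := n^-1.
have l0 : 0 < l by rewrite invr_gt0.
have l1 := lt0r_neq0 l0.
have N z x y : 0 <= y <= pi -> cabs z = expR x -> carg z = y ->
    K * l ^+ 2 + cdist2 (clog z) (- (p * l), - (q * l)) = 2 * l * expR (- 2^-1 * u x y).
  move=> hy ex ey; rewrite hf // /cdist2 /clog ex ey expRK /=.
  have -> : K = 2 * n * r - p ^+ 2 - q ^+ 2 by rewrite e; ring.
  by rewrite /l; field.
exists l, (- (p * l), - (q * l)); split => //.
- move=> z hz; have [x [y [hy ex ey _]]] := polar_coordinates hz.
  by rewrite (N z x y) // !mulf_neq0 ?pnatr_eq0 // ?lt0r_neq0 ?expR_gt0.
- move=> z hz; have [x [y [hy ex ey ez]]] := polar_coordinates hz.
  rewrite (v_ln hy ez) (N z x y) // ex; congr ln.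
  have f0 := lt0r_neq0 (expR_gt0 (- 2^-1 * u x y)).
  have x0 := lt0r_neq0 (expR_gt0 x).
  by field; rewrite x0 f0 l1.
Qed.

End Canonical.

Unset Implicit Arguments.

Theorem theorem6p1 (R : realType) (K c1 c2 : R) (v : R * R -> R) :
  (K = -1 \/ K = 0 \/ K = 1) ->
  C2_cuhp0 v ->
  (forall p, uhp p -> laplacian v p + 2 * K * expR (v p) = 0) ->
  (forall s : R, 0 < s ->
     dt v p @[p --> within (@uhp R) (nbhs (s, 0))] --> c1 * expR (v (s, 0) / 2)) ->
  (forall s : R, s < 0 ->
     dt v p @[p --> within (@uhp R) (nbhs (s, 0))] --> c2 * expR (v (s, 0) / 2)) ->
  (\int[(@lebesgue_measure R \x @lebesgue_measure R)%E]_(p in @uhp R)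
      (expR (v p))%:E < +oo)%E ->
  canonical_solution K v.
Proof.
move=> hK C2v pde bc1 bc2 area.
have K1 : `|K| <= 1 by rewrite ler_norml; case: hK => [|[]] ->; lra.
have [u [ux [uy [uxx [uxy [uyy [S uv]]]]]]] := strip_transfer C2v pde bc1 bc2 area.
have [[g [a [b [c [d [g0 a0 b0 e hf]]]]]]|[n [p [q [r [n0 e hf]]]]]] :=
  strip_classification S K1.
  by left; exact: (canonical_a_of_strip uv g0 a0 b0 e hf).
by right; exact: (canonical_b_of_strip uv n0 e hf).
Qed.
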